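(* (1) The mapping $\Phi_+$ is a bijection between the $\mathbb N$-biorientations in $\mathcal B$ and the $\mathbb N$-mobiles of positive excess. For $T=\Phi_+(O)$, the excess of $T$ equals the outer degree of $O$, and there are correspondences (bijections) from the inner faces of $O$ to the black vertices of $T$ preserving degree, from the vertices of $O$ to the white vertices of $T$ preserving weight, and from the edges of $O$ to the edges of $T$ preserving weight. (2) The mapping $\Phi_-$ is a bijection between the $\mathbb N$-biorientations in $\widetilde{\mathcal B}$ and the $\mathbb N$-mobiles of negative excess. For $T=\Phi_-(O)$, the excess of $T$ equals minus the outer degree of $O$, and there are correspondences from the inner faces of $O$ to the black vertices of $T$ preserving degree, from the inner vertices of $O$ to the white vertices of $T$ preserving weight, and from the inner edges of $O$ to the edges of $T$ preserving weight.
   Context: A map is a connected finite graph (loops and multiple edges allowed) embedded in the oriented sphere up to orientation-preserving homeomorphism; corners are angular sectors between consecutive half-edges around a vertex; the degree of a face is its number of corners. A face-rooted map has a marked root-face; the other faces are inner; vertices/edges incident to the root-face are outer, the others inner; the outer degree is the degree of the root-face. A biorientation assigns to each half-edge a direction, ingoing (toward its vertex) or outgoing; an edge is $i$-way if exactly $i$ of its half-edges are ingoing. Directed paths follow 2-way edges or 1-way edges toward their ingoing half-edge; a circuit is a simple closed directed path. In a face-rooted biorientation a circuit is counterclockwise if the root-face is on its right; the biorientation is minimal if it has no counterclockwise circuit, clockwise-minimal if moreover each outer edge is 2-way or 1-way with a non-root face on its right, and accessible if every vertex is reachable by a directed path from some outer vertex. A weighted biorientation gives a real weight to each half-edge; edge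 weight = sum of its two half-edge weights; vertex weight = sum of weights of incident ingoing half-edges. An $\mathbb N$-biorientation is a weighted biorientation with weights in $\{0,1,2,\dots\}$, positive on ingoing and zero on outgoing half-edges. It is admissible if the root-face contour is a simple cycle, every outer vertex has indegree $1$, and every outer edge is 1-way with weights $0$ (outgoing) and $1$ (ingoing). $\mathcal B$ is the set of clockwise-minimal accessible face-rooted weighted biorientations; $\widetilde{\mathcal B}$ its admissible subset. A mobile is a plane tree with vertices colored black or white (not necessarily properly), where black vertices may carry dangling half-edges (buds); its excess is the number of black-white edges plus twice the number of white-white edges minus the number of buds. An $\mathbb N$-mobile gives each non-bud half-edge a weight in $\{0,1,2,\dots\}$, positive if incident to a white vertex, zero if incident to a black vertex; the weight of a vertex is the sum of weights of its non-bud half-edges, the weight of an edge the sum of its two half-edge weights, and the degree of a black vertex counts all its half-edges including buds. Local transformations (a black vertex $b_g$ placed in each face $g$): for an edge $e$ with half-edges $h$ at $v$, $h'$ at $v'$, of weights $w,w'$, with $c,c'$ the corners preceding $h,h'$ clockwise around $v,v'$ lying in faces $f,f'$: if $e$ is 1-way with $h$ ingoing, create an edge $b_f$–$v$ in corner $c$ (weight $w$ at $v$, $w'$ at $b_f$), a bud at $b_{f'}$ toward $c'$, and delete $e$; if 0-way, create an edge $b_f$–$b_{f'}$ (weight $w'$ at $b_f$, $w$ at $b_{f'}$) and delete $e$; if 2-way, attach buds at $b_f$ and $b_{f'}$ toward $c$ and $c'$ and keep $e$. For $O\in\mathcal B$ with root-face $f_0$ (vertices white): $\Phi_+(O)$ is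 obtained by transforming every edge then deleting $b_{f_0}$ and its buds. For $O\in\widetilde{\mathcal B}$: $\Phi_-(O)$ is obtained by reversing every edge of the root-face contour, transforming every edge, then deleting $b_{f_0}$, the outer vertices and the edges between them. *)

(* Defs.v *)
From HB Require Import structures.
From mathcomp Require Import all_boot all_order all_algebra.
Set Implicit Arguments. Unset Strict Implicit. Unset Printing Implicit Defensive.

(* Conventions (combinatorial maps on a finite set of half-edges/darts): *)
(*  - sigma h = the half-edge following h in CLOCKWISE order around its  *)
(*    vertex; vertices = sigma-orbits.                                   *)
(*  - alpha = the other half-edge of the same edge; edges = {h, alpha h}.*)
(*  - the dart h also names the corner preceding h clockwise around its  *)
(*    vertex; this corner lies in the face = (sigma \o alpha)-orbit of h.*)
(*    Hence faces = phi-orbits, phi := sigma \o alpha, degree = size.    *)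
(*  - the faces on the two sides of edge {h, alpha h} are face h (on the *)
(*    left when walking along the edge from the vertex of h) and          *)
(*    face (alpha h) (on the right).                                      *)

Definition orbits (T : finType) (f : T -> T) : {set {set T}} :=
  [set [set y | fconnect f x y] | x : T].

Definition sa_rel (T : finType) (s a : T -> T) : rel T :=
  fun x y => (y == s x) || (y == a x).

Unset Implicit Arguments.
Record bio := Bio {
  bD : finType;              (* half-edges *)
  bs : bD -> bD;             (* clockwise rotation around vertices *)
  ba : bD -> bD;             (* edge involution *)
  bing : bD -> bool;         (* true = ingoing half-edge *)
  bw : bD -> nat;
  broot : {set bD}           (* the darts/corners of the root face *)
}.
Set Implicit Arguments.

Section BioDefs.
Variable O : bio.
Local Notation D := (bD O).
Local Notation sigma := (bs O).
Local Notation alpha := (ba O).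
Local Notation ing := (bing O).
Local Notation w := (bw O).
Local Notation root := (broot O).

Definition bphi (x : D) : D := sigma (alpha x).

Definition bedges : {set {set D}} := [set [set x; alpha x] | x : D].

Definition is_rooted_map : Prop :=
  [/\ 0 < #|D|, injective sigma, involutive alpha & (forall x, alpha x != x)] /\
  [/\ (forall x y, connect (sa_rel sigma alpha) x y),
      (* Euler's formula: genus 0 *)
      #|orbits sigma| + #|orbits bphi| = #|bedges| + 2
    & exists r, root = [set y | fconnect bphi r y]].

Definition is_Nbio : Prop :=
  forall x, (ing x -> 0 < w x) /\ (~~ ing x -> w x = 0).

(* A circuit: list of darts h_0 ... h_{k-1}; h_i is traversed from its vertex
   to the vertex of alpha h_i, which requires alpha h_i ingoing (2-way edge,
   or 1-way edge traversed toward its ingoing half-edge). *)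
Definition circuit (s : seq D) : bool :=
  [&& s != [::], all (fun h => ing (alpha h)) s,
      cycle (fun x y => fconnect sigma (alpha x) y) s,
      pairwise (fun x y => ~~ fconnect sigma x y) s &
      pairwise (fun x y => (y != x) && (y != alpha x)) s].

(* moving between darts of faces without crossing the edges of s *)
Definition dual_rel_avoid (s : seq D) : rel D :=
  fun x y => (y == bphi x) || [&& y == alpha x, x \notin s & alpha x \notin s].

(* the root face is on the right of the circuit s: it is in the region of the
   face on the right of the first traversed edge (i.e. face (alpha h_0)) *)
Definition root_on_right (s : seq D) : Prop :=
  if s is h0 :: _ then exists2 r, r \in root & connect (dual_rel_avoid s) (alpha h0) r
  else False.

Definition minimal : Prop := forall s, circuit s -> ~ root_on_right s.

Definition clockwise_minimal : Prop :=
  minimal /\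
  forall h, (h \in root \/ alpha h \in root) -> ~~ ing (alpha h) ->
     (* the edge is 1-way with ingoing h; traversed from alpha h to h the face on
        its right is face h, which must be a non-root face *)
     ing h /\ h \notin root.

Definition acc_rel : rel D :=
  fun x y => (y == sigma x) || (ing (alpha x) && (y == alpha x)).

Definition accessible : Prop :=
  forall h, exists2 r, r \in root & connect acc_rel r h.

Definition inB : Prop := [/\ is_rooted_map, clockwise_minimal & accessible].

Definition admissible : Prop :=
  [/\ (* root-face contour is a simple cycle *)
      (forall x y, x \in root -> y \in root -> fconnect sigma x y -> x = y),
      (forall x, x \in root -> alpha x \notin root),
      (forall x, x \in root -> #|[set y | fconnect sigma x y & ing y]| = 1)
    &
      (forall x, (x \in root \/ alpha x \in root) ->
        (ing x /\ ~~ ing (alpha x) /\ w x = 1 /\ w (alpha x) = 0) \/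
        (ing (alpha x) /\ ~~ ing x /\ w (alpha x) = 1 /\ w x = 0))].

Definition inBtilde : Prop := inB /\ admissible.

Definition outer_degree : nat := #|root|.
Definition inner_faces : {set {set D}} := orbits bphi :\ root.
Definition bvertices : {set {set D}} := orbits sigma.
Definition inner_vertices : {set {set D}} :=
  [set v in orbits sigma | [disjoint v & root]].
Definition inner_edges : {set {set D}} := [set e in bedges | [disjoint e & root]].
Definition bvertex_weight (v : {set D}) : nat := \sum_(x in v | ing x) w x.
Definition bedge_weight (e : {set D}) : nat := \sum_(x in e) w x.

(* darts of the result live in D + D: inl h = white half-edge at the vertex of
   h (exists when h is ingoing); inr h = black half-edge at b_(face h) issued in
   the slot of the corner of h (or of the edge {h, alpha h} for 0-way edges). *)
Section Transfo.
Variable ing' : D -> bool.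

Definition next_in (h : D) : D :=
  let s := traject sigma (sigma h) #|D| in nth h s (find ing' s).

Definition raw_sigma (x : D + D) : D + D :=
  match x with
  | inl h => inl (next_in h)
  | inr h => inr (alpha (finv sigma h))            (* = phi^-1 h: clockwise around b_f *)
  end.

Definition raw_alpha (x : D + D) : D + D :=
  match x with
  | inl h => if ing' (alpha h) then inl (alpha h) (* 2-way edge kept *)
             else inr h                              (* 1-way: edge b_(face h) -- v *)
  | inr h => if ing' h && ~~ ing' (alpha h) then inl h
             else if ~~ ing' h && ~~ ing' (alpha h) then inr (alpha h) (* 0-way *)
             else inr h                              (* bud *)
  end.

Definition raw_weight (x : D + D) : nat :=
  match x with inl h => w h | inr h => w (alpha h) end.

Variable keep : pred (D + D).

Definition tD : finType := {x : (D + D)%type | keep x}.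

Definition t_sigma (x : tD) : tD := insubd x (raw_sigma (val x)).
Definition t_alpha (x : tD) : tD := insubd x (raw_alpha (val x)).
Definition t_black (x : tD) : bool := ~~ is_inl (val x).
Definition t_weight (x : tD) : nat :=
  if t_alpha x == x then 0 else raw_weight (val x).

End Transfo.

Definition outer_vertex (h : D) : bool := [exists y in root, fconnect sigma h y].

Definition ing_rev (h : D) : bool :=
  if (h \in root) || (alpha h \in root) then ~~ ing h else ing h.

Definition keep_plus : pred (D + D) :=
  fun x => match x with inl h => ing h | inr h => h \notin root end.
Definition keep_minus : pred (D + D) :=
  fun x => match x with inl h => ing_rev h && ~~ outer_vertex h
                      | inr h => h \notin root end.

End BioDefs.

(* A mobile (raw data): buds are the fixed points of the half-edge involution *)
Unset Implicit Arguments.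
Record mob := Mob {
  mD : finType;
  ms : mD -> mD;           (* clockwise rotation around vertices *)
  ma : mD -> mD;           (* other half-edge; ma x = x iff x is a bud *)
  mblack : mD -> bool;     (* colour of the vertex of the half-edge *)
  mw : mD -> nat           (* weights (buds carry weight 0 by convention) *)
}.
Set Implicit Arguments.

Section MobDefs.
Variable T : mob.
Local Notation X := (mD T).
Local Notation sigma := (ms T).
Local Notation alpha := (ma T).
Local Notation black := (mblack T).
Local Notation w := (mw T).

Definition mbuds : {set X} := [set x | alpha x == x].
Definition medges : {set {set X}} := [set [set x; alpha x] | x : X & alpha x != x].

Definition is_Nmobile : Prop :=
  [/\ injective sigma, involutive alpha,
      (forall x, black (sigma x) = black x) &
      (forall x, alpha x = x -> black x)] /\
  [/\ (forall x y, connect (sa_rel sigma alpha) x y),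
      (* connected with #vertices = #edges + 1 : a (plane) tree *)
      #|orbits sigma| = #|medges| + 1,
      (forall x, alpha x != x -> (black x -> w x = 0) /\ (~~ black x -> 0 < w x))
    & (forall x, alpha x = x -> w x = 0)].

Definition excess : int :=
  (#|[set e in medges | [exists x in e, black x] && [exists x in e, ~~ black x]]|
   + 2 * #|[set e in medges | [forall x in e, ~~ black x]]|)%:Z
  - (#|mbuds|)%:Z.

Definition black_vertices : {set {set X}} :=
  [set v in orbits sigma | [exists x in v, black x]].
Definition white_vertices : {set {set X}} :=
  [set v in orbits sigma | [exists x in v, ~~ black x]].
Definition mvertex_weight (v : {set X}) : nat := \sum_(x in v | alpha x != x) w x.
Definition medge_weight (e : {set X}) : nat := \sum_(x in e) w x.

End MobDefs.

Definition Phi_plus (O : bio) : mob :=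
  Mob (@tD O (@keep_plus O)) (@t_sigma O (bing O) (@keep_plus O))
      (@t_alpha O (bing O) (@keep_plus O)) (@t_black O (@keep_plus O))
      (@t_weight O (bing O) (@keep_plus O)).

(* Phi_minus: reverse the root-face contour (orientation ing_rev), transform,
   delete b_(f0) (darts inr h with h in the root face, all of them buds or
   edges to outer vertices) and the outer vertices (darts inl h with h at an
   outer vertex). *)
Definition Phi_minus (O : bio) : mob :=
  Mob (@tD O (@keep_minus O)) (@t_sigma O (@ing_rev O) (@keep_minus O))
      (@t_alpha O (@ing_rev O) (@keep_minus O)) (@t_black O (@keep_minus O))
      (@t_weight O (@ing_rev O) (@keep_minus O)).

(* isomorphisms (maps are considered up to orientation-preserving homeomorphism) *)
Definition iso_bio (O1 O2 : bio) : Prop :=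
  exists f : bD O1 -> bD O2,
    [/\ bijective f, forall x, f (bs O1 x) = bs O2 (f x),
        forall x, f (ba O1 x) = ba O2 (f x) & forall x, bing O2 (f x) = bing O1 x] /\
    (forall x, bw O2 (f x) = bw O1 x) /\ f @: broot O1 = broot O2.

Definition iso_mob (T1 T2 : mob) : Prop :=
  exists f : mD T1 -> mD T2,
    [/\ bijective f, forall x, f (ms T1 x) = ms T2 (f x),
        forall x, f (ma T1 x) = ma T2 (f x), forall x, mblack T2 (f x) = mblack T1 x
      & forall x, mw T2 (f x) = mw T1 x].

Definition corresp (T1 T2 : finType) (A : {set {set T1}}) (B : {set {set T2}})
  (m1 : {set T1} -> nat) (m2 : {set T2} -> nat) : Prop :=
  exists f : {set T1} -> {set T2},
    [/\ {in A &, injective f}, f @: A = B & {in A, forall a, m2 (f a) = m1 a}].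

(* Main.v *)
Require Import Defs.
From HB Require Import structures.
From mathcomp Require Import all_boot all_order all_algebra.
From mathcomp Require Import zify ring lra.

(* Every ingoing dart [h] has a parent: the first ingoing dart met when turning
   counterclockwise around the origin of its edge, starting from the opposite
   half-edge [a h].  For a planar biorientation whose root-face contour is
   suitably oriented, being minimal and accessible is equivalent to the parents
   of every dart leading back to the root-face.  In one direction a potential on
   the faces (planarity makes every circulation a coboundary) is monotone along
   parents; in the other a cycle of parents not around the root-face bounds a region contradicting
   minimality or accessibility.

   Along the contour of the mobile, the white half-edges and the buds form a
   cyclic parenthesis word in which the white half-edge of [h] is closed by the
   bud facing [a h], and the pair of [h] is directly enclosed by the pair of its
   parent.  Hence the opening is connected, thus a tree by Euler's relation, and
   the mobile determines the biorientation.  Conversely the contour of a plane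
   tree is a single cycle, and matching its parentheses yields the closure.
   The mobiles of negative excess are obtained from those of positive excess by
   cutting the white leaves opposite to the root-face. *)

Set Implicit Arguments. Unset Strict Implicit. Unset Printing Implicit Defensive.
Import Order.TTheory GRing.Theory Num.Theory.

(** * Orbits and rational homology *)

(** Planarity is given only as Euler's relation, so the two sides of a closed curve are told apart
    by a rational potential on the faces, which a rank count provides. The same count, used as an
    inequality, leaves a plane tree with a single contour.

    The closure of a mobile is built from the matching alone, and nothing says beforehand that it is
    connected or of genus 0. The opening is therefore studied under [premap], [root_in], [vertex_in]
    and [reaches_root], which can be checked on the closure directly. Once the opening of the
    closure is identified with the mobile, Euler's relation is read back from the tree, and
    minimality then follows from [reaches_root].

    Both mappings are instances of one opening [KM], governed by the set [K] of kept white
    half-edges. After the reversal of the contour, an outer edge leaves nothing but a bud in its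
    inner face, which is also what remains of it in the unreversed opening when its white end is
    cut. *)

Lemma connect_fwd (T : finType) (e : rel T) (P : T -> Prop) x y :
  (forall u v, e u v -> P u -> P v) -> connect e x y -> P x -> P y.
Proof.
move=> H /connectP[p]; elim: p x => [|z p IH] x /=; first by move=> _ ->.
by case/andP=> xz pp lst /(H _ _ xz); apply: IH.
Qed.

Lemma connect_sym_gen (T : finType) (e : rel T) :
  (forall u v, e u v -> connect e v u) -> connect_sym e.
Proof.
move=> H; suff H2 x y : connect e x y -> connect e y x by move=> x y; apply/idP/idP; apply: H2.
move=> xy; apply: (connect_fwd (P := fun z => connect e z x) _ xy) => // u v uv ux.
exact: connect_trans (H _ _ uv) ux.
Qed.

Section Orbits.
Variables (T : finType) (f : T -> T).

Definition orb (x : T) : {set T} := [set y | fconnect f x y].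

Lemma mem_orb x y : (y \in orb x) = fconnect f x y.
Proof. by rewrite inE. Qed.

Lemma orb_in x : orb x \in orbits f.
Proof. by apply/imsetP; exists x. Qed.

Lemma orbitsP A : reflect (exists x, A = orb x) (A \in orbits f).
Proof. by apply: (iffP imsetP) => [[x _ ->]|[x ->]]; exists x. Qed.

Hypothesis f_inj : injective f.

Lemma fcsym x y : fconnect f x y = fconnect f y x.
Proof. exact: fconnect_sym. Qed.

Lemma orb_eqP x y : reflect (orb x = orb y) (fconnect f x y).
Proof.
apply: (iffP idP) => [xy|E].
  by apply/setP=> z; rewrite !inE (same_connect (fconnect_sym f_inj) xy).
by rewrite -mem_orb E mem_orb.
Qed.

Lemma orb_mem A x : A \in orbits f -> x \in A -> A = orb x.
Proof. by case/orbitsP=> y ->; rewrite mem_orb => /orb_eqP. Qed.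

Lemma fconnect_fwd (P : T -> Prop) x y :
  (forall z, P z -> P (f z)) -> fconnect f x y -> P x -> P y.
Proof.
move=> H /iter_findex <-; elim: (findex f x y) => [//|n IH] /= /IH; exact: H.
Qed.

Lemma fconnect_inv (R : Type) (P : T -> R) x y :
  (forall z, P (f z) = P z) -> fconnect f x y -> P x = P y.
Proof.
by move=> H xy; apply: (fconnect_fwd (P := fun z => P x = P z)) xy _ => // z ->.
Qed.

Lemma fconnect_iterP x y : reflect (exists n, y = iter n f x) (fconnect f x y).
Proof.
apply: (iffP idP) => [/iter_findex <-|[n ->]]; first by exists (findex f x y).
exact: fconnect_iter.
Qed.

Lemma iter_finv_iter n x : iter n f (iter n (finv f) x) = x.
Proof.
by elim: n x => [//|n IH] x; rewrite iterSr iterS (f_finv f_inj) IH.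
Qed.

Lemma iter_finv_sub n m x : m <= n -> iter m (finv f) (iter n f x) = iter (n - m) f x.
Proof.
elim: m n => [|m IH] n le_mn; first by rewrite subn0.
case: n le_mn => // n le_mn.
by rewrite iterSr iterS (finv_f f_inj) IH.
Qed.

Definition idx (x : T) : 'I_#|orbits f| := enum_rank_in (orb_in x) (orb x).

Lemma idxK x : enum_val (idx x) = orb x.
Proof. by rewrite /idx enum_rankK_in ?orb_in. Qed.

Lemma idx_eq x y : (idx x == idx y) = fconnect f x y.
Proof.
apply/eqP/orb_eqP => [E|E]; first by rewrite -!idxK E.
by apply: enum_val_inj; rewrite !idxK.
Qed.

Lemma idx_f x : idx (f x) = idx x.
Proof. by apply/esym/eqP; rewrite idx_eq fconnect1. Qed.

Lemma idx_onto i : exists x, idx x = i.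
Proof.
have /orbitsP[x E] := enum_valP i; exists x; apply: enum_val_inj.
by rewrite idxK.
Qed.

Lemma card_orbits_sum : #|T| = \sum_(A in orbits f) #|A|.
Proof.
rewrite -sum1_card (partition_big orb (mem (orbits f))) /=; last by move=> x _; exact: orb_in.
apply: eq_bigr => A Ao; rewrite -sum1_card; apply: eq_bigl => x.
apply/eqP/idP => [<-|xA]; first by rewrite mem_orb.
by rewrite -(orb_mem Ao xA).
Qed.

End Orbits.

Section Involution.
Variables (T : finType) (a : T -> T).
Hypothesis aK : involutive a.

Lemma orb_invol x : orb a x = [set x; a x].
Proof.
apply/setP=> y; rewrite !inE; apply/idP/orP => [/fconnect_iterP[n ->]|].
  elim: n => [|n [] /eqP /= ->]; first by left.
    by right.
  by left; rewrite aK.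
by case=> /eqP ->; rewrite ?connect0 ?fconnect1.
Qed.

Definition pairs : {set {set T}} := [set [set x; a x] | x : T & a x != x].
Definition fixeds : {set T} := [set x | a x == x].

Lemma orbits_invol : orbits a = pairs :|: [set [set x] | x in fixeds].
Proof.
apply/setP=> A; rewrite inE; apply/orbitsP/orP => [[x ->]|[]].
- rewrite orb_invol; case E: (a x == x).
    right; apply/imsetP; exists x; rewrite ?inE ?E //.
    by rewrite (eqP E) setUid.
  by left; apply/imsetP; exists x; rewrite ?inE ?E.
- by case/imsetP=> x _ ->; exists x; rewrite orb_invol.
- case/imsetP=> x; rewrite inE => /eqP E ->; exists x.
  by rewrite orb_invol E setUid.
Qed.

Lemma card_pairsE A : A \in pairs -> #|A| = 2.
Proof. by case/imsetP=> x; rewrite inE eq_sym => H ->; rewrite cards2 H. Qed.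

Lemma card_orbits_invol : #|orbits a| = #|pairs| + #|fixeds|.
Proof.
rewrite orbits_invol cardsU (_ : _ :&: _ = set0); last first.
  apply/setP=> A; rewrite !inE; apply/negP=> /andP[/card_pairsE H /imsetP[x _ E]].
  by rewrite E cards1 in H.
by rewrite cards0 subn0 (card_imset _ set1_inj).
Qed.

Lemma card_invol : #|T| = 2 * #|pairs| + #|fixeds|.
Proof.
have ainj : injective a by apply: can_inj aK.
rewrite (card_orbits_sum ainj) orbits_invol (bigID (mem pairs)) /=; congr (_ + _).
  rewrite (eq_bigl (mem pairs)); last first.
    by move=> A; rewrite !inE andb_orl andbb; case: (A \in pairs); rewrite ?orbT //= andbF.
  by rewrite (eq_bigr (fun=> 2)) => [|A /card_pairsE //]; rewrite sum_nat_const mulnC.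
rewrite (eq_bigl (mem [set [set x] | x in fixeds])); last first.
  move=> A; rewrite !inE; apply/andP/idP => [[/orP[->|//]]|/imsetP[x xf ->]]; first by [].
  split; first by rewrite imset_f ?orbT.
  by apply/negP=> /card_pairsE; rewrite cards1.
rewrite (eq_bigr (fun=> 1)) => [|A /imsetP[x _ ->]]; last by rewrite cards1.
by rewrite sum_nat_const muln1 (card_imset _ set1_inj).
Qed.

End Involution.

Lemma sa_connect_sym (T : finType) (s a : T -> T) :
  injective s -> involutive a -> connect_sym (sa_rel s a).
Proof.
move=> si aK; apply: connect_sym_gen => u v /orP[] /eqP ->.
  have : fconnect s (s u) u by rewrite fcsym // fconnect1.
  by apply: connect_sub => x y /eqP <-; apply: connect1; rewrite /sa_rel eqxx.
by apply: connect1; rewrite /sa_rel aK eqxx orbT.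
Qed.

(** * Face potentials of a planar map, by a rank count *)

Section Homology.
Variables (D : finType) (s a : D -> D).
Hypotheses (s_inj : injective s) (aK : involutive a).
Hypothesis conn : forall x y, connect (sa_rel s a) x y.
Local Notation p := (fun x => s (a x)).
Import GRing.Theory.
Local Open Scope ring_scope.

Let a_inj : injective a := can_inj aK.
Let p_inj : injective p := inj_comp s_inj a_inj.

Lemma connect_const (R : Type) (P : D -> R) :
  (forall x, P (s x) = P x) -> (forall x, P (a x) = P x) -> forall x y, P x = P y.
Proof.
move=> Hs Ha x y; case/connectP: (conn x y) => l; elim: l x => [|z l IH] x /=.
  by move=> _ ->.
case/andP=> /orP[] /eqP -> Hl Hy; first by rewrite -Hs; apply: IH Hl Hy.
by rewrite -Ha; apply: IH Hl Hy.
Qed.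

Local Notation n := #|D|.
Local Notation nV := #|orbits s|.
Local Notation nE := #|orbits a|.
Local Notation nF := #|orbits p|.
Local Notation dl b := (b%:R : rat).
Local Notation ev := (@enum_val D predT).

(** A row vector over the darts is orthogonal to [GE] when it is antisymmetric under [a], and then
    orthogonal to [GV] when it is a circulation. The rows of [GF] are the boundaries of the
    faces. *)
Let GV : 'M[rat]_(nV, n) :=
  \matrix_(i, j) (dl (idx s (ev j) == i) - dl (idx s (a (ev j)) == i)).
Let GE : 'M[rat]_(nE, n) := \matrix_(i, j) dl (idx a (ev j) == i).
Let GF : 'M[rat]_(nF, n) :=
  \matrix_(i, j) (dl (idx p (ev j) == i) - dl (idx p (a (ev j)) == i)).
Let B := col_mx GV GE.

Lemma sum_delta m (u : 'rV[rat]_m) k : \sum_i u 0 i * dl (k == i) = u 0 k.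
Proof.
rewrite (bigD1 k) //= eqxx mulr1 big1 ?addr0 // => i /negPf.
by rewrite eq_sym => ->; rewrite mulr0.
Qed.

Let GVE (u : 'rV_nV) j : (u *m GV) 0 j = u 0 (idx s (ev j)) - u 0 (idx s (a (ev j))).
Proof.
rewrite mxE; under eq_bigr do rewrite mxE mulrBr.
by rewrite sumrB !sum_delta.
Qed.
Let GFE (u : 'rV_nF) j : (u *m GF) 0 j = u 0 (idx p (ev j)) - u 0 (idx p (a (ev j))).
Proof.
rewrite mxE; under eq_bigr do rewrite mxE mulrBr.
by rewrite sumrB !sum_delta.
Qed.
Let GEE (u : 'rV_nE) j : (u *m GE) 0 j = u 0 (idx a (ev j)).
Proof. by rewrite mxE; under eq_bigr do rewrite mxE; rewrite sum_delta. Qed.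

Lemma rank_le1_ker m k (A : 'M[rat]_(m, k)) (w : 'rV[rat]_m) :
  (forall u : 'rV_m, u *m A = 0 -> exists c, u = c *: w) -> (m.-1 <= \rank A)%N.
Proof.
move=> H; have: (\rank (kermx A) <= 1)%N.
  apply: leq_trans (rank_leq_row w); apply: mxrankS.
  apply/row_subP=> i; have [|c ->] := H (row i (kermx A)); last exact: scalemx_sub.
  by rewrite -row_mul mulmx_ker row0.
by rewrite mxrank_ker; lia.
Qed.

Hypothesis D0 : (0 < n)%N.

Let const_face (P : D -> rat) :
  (forall x, P (s (a x)) = P x) -> (forall x, P (a x) = P x) -> forall x y, P x = P y.
Proof.
move=> Hs Ha; apply: connect_const => // x.
by rewrite -{1}(aK x) Hs Ha.
Qed.

(** A face function in the left kernel takes equal values on both sides of every edge, hence is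
    constant by connectedness. *)
Let rankF : (nF.-1 <= \rank GF)%N.
Proof.
apply: (rank_le1_ker (w := const_mx 1)) => u u0.
case/card_gt0P: D0 => x0 _; exists (u 0 (idx p x0)).
apply/rowP=> i; rewrite !mxE mulr1; have [x <-] := idx_onto i.
apply: (const_face (P := fun x => u 0 (idx p x))) => {}x; first by rewrite idx_f.
have := GFE u (enum_rank x); rewrite u0 mxE enum_rankK => /esym/eqP.
by rewrite subr_eq0 => /eqP ->.
Qed.

(** In a vanishing combination the contribution of [GV] is antisymmetric under [a] and that of [GE]
    symmetric, so both vanish: the vertex function is constant and the edge function zero. *)
Let rankB : ((nV + nE).-1 <= \rank B)%N.
Proof.
apply: (rank_le1_ker (w := row_mx (const_mx 1) 0)) => u.
rewrite -(hsubmxK u); move: (lsubmx u) (rsubmx u) => v w; rewrite mul_row_col => u0.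
have H x : v 0 (idx s x) - v 0 (idx s (a x)) + w 0 (idx a x) = 0.
  have := congr1 (fun M : 'M_(_,_) => M 0 (enum_rank x)) u0.
  by rewrite mxE GVE GEE enum_rankK [RHS]mxE.
have H2 x : v 0 (idx s (a x)) - v 0 (idx s x) + w 0 (idx a x) = 0.
  by have := H (a x); rewrite aK idx_f.
case/card_gt0P: D0 => x0 _; exists (v 0 (idx s x0)).
rewrite scale_row_mx scaler0; congr row_mx.
  apply/rowP=> i; rewrite !mxE mulr1; have [x <-] := idx_onto i.
  apply: (connect_const (P := fun x => v 0 (idx s x))) => {}x; first by rewrite idx_f.
  by have := H x; have := H2 x; lra.
apply/rowP=> i; rewrite !mxE; have [x <-] := idx_onto i.
by have := H x; have := H2 x; lra.
Qed.

Let reindex_a (h : D -> rat) : \sum_x h (a x) = \sum_x h x.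
Proof. by rewrite [RHS](reindex_inj a_inj). Qed.

Let reindex_s (h : D -> rat) : \sum_x h (s x) = \sum_x h x.
Proof. by rewrite [RHS](reindex_inj s_inj). Qed.

Let sum_ev (h : D -> rat) : \sum_j h (ev j) = \sum_x h x.
Proof.
rewrite [RHS](reindex ev) //=; last first.
  by apply: onW_bij; exact: enum_val_bij.
Qed.

Let sumN0 (h : D -> rat) : (forall x, h (a x) = - h x) -> \sum_x h x = 0.
Proof.
move=> H; have: \sum_x h x = - \sum_x h x.
  by rewrite -{1}reindex_a -sumrN; apply: eq_bigr.
by lra.
Qed.

Let orthB (c : D -> rat) : (forall x, c (a x) = - c x) ->
  (forall P : D -> rat, (forall x, P (s x) = P x) -> \sum_x P x * c x = 0) ->
  (\row_j c (ev j)) *m B^T = 0.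
Proof.
move=> ca cs; rewrite tr_col_mx mul_mx_row -[RHS]row_mx0; congr row_mx.
  apply/rowP=> i; rewrite !mxE.
  under eq_bigr do rewrite !mxE.
  rewrite (sum_ev (fun x => c x * (dl (idx s x == i) - dl (idx s (a x) == i)))).
  under eq_bigr do rewrite mulrBr.
  rewrite sumrB -(reindex_a (fun x => c x * dl (idx s (a x) == i))).
  under [X in _ - X]eq_bigr do rewrite aK ca mulNr.
  rewrite sumrN; have := cs (fun x => dl (idx s x == i)).
  under eq_bigr do rewrite mulrC.
  by move=> ->; [rewrite oppr0 subr0|move=> x; rewrite idx_f].
apply/rowP=> i; rewrite !mxE.
under eq_bigr do rewrite !mxE.
rewrite (sum_ev (fun x => c x * dl (idx a x == i))).
by apply: sumN0 => x; rewrite ca idx_f // mulNr.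
Qed.

Let GF_ker : (GF <= kermx B^T)%MS.
Proof.
apply/sub_kermxP/row_matrixP=> i; rewrite row_mul row0.
set F := fun x => dl (idx p x == i).
have Fp x : F (s (a x)) = F x by rewrite /F idx_f.
have -> : row i GF = \row_j (fun x => F x - F (a x)) (ev j).
  by apply/rowP=> j; rewrite !mxE.
apply: (orthB (c := fun x => F x - F (a x))) => [x|P Ps]; first by rewrite aK opprB.
under eq_bigr do rewrite mulrBr.
rewrite sumrB -(reindex_s (fun x => P x * F x)).
rewrite -(reindex_a (fun x => P (s x) * F (s x))).
under eq_bigr do rewrite Fp Ps.
rewrite -(reindex_a (fun x => P x * F (a x))).
under [X in _ - X]eq_bigr do rewrite aK.
by rewrite subrr.
Qed.

Let rank_ineq : (nF.-1 <= \rank GF /\ \rank GF <= n - \rank B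
  /\ (nV + nE).-1 <= \rank B <= n)%N.
Proof.
split=> //; split; first by have := mxrankS GF_ker; rewrite mxrank_ker mxrank_tr.
by rewrite rankB rank_leq_col.
Qed.

(** Boundaries of faces are circulations, so the rank of [GF] is at most the dimension left by [B].
    Fixed points of [a] are allowed, so that the bound also covers mobiles with buds. *)
Lemma euler_ineq : (nV + nE + nF <= n + 2)%N.
Proof. by have := rank_ineq; lia. Qed.

(** Equality in the rank count forces the boundaries of the faces to span all circulations. *)
Lemma potential (c : D -> rat) : (nV + nE + nF = n + 2)%N ->
  (forall x, c (a x) = - c x) ->
  (forall P : D -> rat, (forall x, P (s x) = P x) -> \sum_x P x * c x = 0) ->
  exists F : D -> rat, (forall x, F (s (a x)) = F x) /\ (forall x, c x = F x - F (a x)).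
Proof.
move=> planar ca cs.
have/sub_kermxP cK := orthB ca cs.
have gf : (kermx B^T <= GF)%MS.
  rewrite -(mxrank_leqif_sup GF_ker) mxrank_ker mxrank_tr.
  by apply/eqP; have := rank_ineq; lia.
have /submxP[u Eu] := submx_trans cK gf.
exists (fun x => u 0 (idx p x)); split=> [x|x]; first by rewrite idx_f.
have := congr1 (fun M : 'M_(_,_) => M 0 (enum_rank x)) Eu.
by rewrite mxE enum_rankK GFE enum_rankK.
Qed.

End Homology.

(** * First returns, and the parent of an ingoing dart *)

Section FirstReturn.
Variables (T : finType) (f : T -> T) (P : pred T).

(** Same term as [next_in], for a general map: the rotation of the white half-edges is an instance
    by conversion. The default [x] is returned when no iterate satisfies [P]. *)
Definition nxt (x : T) : T :=
  let s := traject f (f x) #|T| in nth x s (find P s).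

Hypothesis f_inj : injective f.

Lemma nxt_uniq x j : P (iter j.+1 f x) -> (forall i, i < j -> ~~ P (iter i.+1 f x)) ->
  nxt x = iter j.+1 f x.
Proof.
(* A first hit later than a full period would already have occurred one period earlier. *)
move=> Pj Hj; have ltj : j < #|T|.
  rewrite ltnNge; apply/negP=> le_j.
  have le_o : order f x <= #|T| by apply: max_card.
  have o0 : 0 < order f x by rewrite order_gt0.
  have := Hj (j - order f x).
  have -> : (j - order f x).+1 = j.+1 - order f x by lia.
  suff -> : iter (j.+1 - order f x) f x = iter j.+1 f x.
    by rewrite Pj => /(_ _)/negP; apply=> //; lia.
  rewrite -[in RHS](@subnK (order f x) j.+1); last by lia.
  by rewrite iterD iter_order.
rewrite /nxt; set s := traject _ _ _.
have ns i : i < #|T| -> nth x s i = iter i.+1 f x.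
  by move=> lti; rewrite /s (set_nth_default (f x)) ?size_traject // nth_traject // -iterSr.
have sz : size s = #|T| by rewrite size_traject.
have hs : has P s.
  by apply/(has_nthP x); exists j; rewrite ?sz ?ns.
have ltf : find P s < #|T| by rewrite -sz -has_find.
suff -> : find P s = j by rewrite ns.
apply/eqP; rewrite eqn_leq; apply/andP; split; rewrite leqNgt; apply/negP=> H.
  by have := before_find x H; rewrite ns ?Pj.
by have := Hj _ H; rewrite -ns // nth_find.
Qed.

Lemma nxt_spec x y : fconnect f x y -> P y ->
  exists j, [/\ nxt x = iter j.+1 f x, P (nxt x)
    & forall i, i < j -> ~~ P (iter i.+1 f x)].
Proof.
move=> xy Py.
have ex : exists j, P (iter j.+1 f x).
  case/fconnect_iterP: xy => [[|n] E]; last by exists n; rewrite -E.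
  by exists (order f x).-1; rewrite prednK ?order_gt0 // iter_order // -[x]/(iter 0 f x) -E.
have [j Pj jmin] := ex_minnP ex.
have Hj i : i < j -> ~~ P (iter i.+1 f x).
  by apply: contraTN => /jmin; rewrite -leqNgt.
have E : nxt x = iter j.+1 f x by apply: nxt_uniq.
by exists j; split; rewrite ?E.
Qed.

Lemma nxt_connect x y : fconnect f x y -> P y -> fconnect f x (nxt x).
Proof. by move=> xy Py; have [j [-> _ _]] := nxt_spec xy Py; exact: fconnect_iter. Qed.

End FirstReturn.

Lemma fconnect_finv' (T : finType) (f : T -> T) : injective f ->
  fconnect (finv f) =2 fconnect f.
Proof. by move=> fi x y; rewrite (same_fconnect_finv fi). Qed.

Lemma iter_finvK (T : finType) (f : T -> T) n m x : injective f ->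
  m <= n -> iter m f (iter n (finv f) x) = iter (n - m) (finv f) x.
Proof.
move=> fi; elim: m n x => [|m IH] n x le_mn; first by rewrite subn0.
case: n le_mn => // n le_mn.
by rewrite iterSr iterS (f_finv fi) IH.
Qed.

Lemma nxt_finvK (T : finType) (f : T -> T) (P : pred T) : injective f ->
  forall p, P p -> nxt (finv f) P (nxt f P p) = p.
Proof.
move=> fi p Pp; have [j [E Pn Hj]] := nxt_spec fi (connect0 _ p) Pp.
have H i : i <= j.+1 -> iter i (finv f) (nxt f P p) = iter (j.+1 - i) f p.
  by move=> le_i; rewrite E iter_finv_sub.
rewrite (@nxt_uniq _ _ _ (finv_inj fi) _ j) ?H ?subnn // => i ltij.
rewrite H; last by lia.
have -> : j.+1 - i.+1 = (j - i.+1).+1 by lia.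
by apply: Hj; lia.
Qed.

Lemma nxtK_finv (T : finType) (f : T -> T) (P : pred T) : injective f ->
  forall p, P p -> nxt f P (nxt (finv f) P p) = p.
Proof.
move=> fi p Pp; have [j [E Pn Hj]] := nxt_spec (finv_inj fi) (connect0 _ p) Pp.
have H i : i <= j.+1 -> iter i f (nxt (finv f) P p) = iter (j.+1 - i) (finv f) p.
  by move=> le_i; rewrite E iter_finvK.
rewrite (@nxt_uniq _ _ _ fi _ j) ?H ?subnn // => i ltij.
rewrite H; last by lia.
have -> : j.+1 - i.+1 = (j - i.+1).+1 by lia.
by apply: Hj; lia.
Qed.

Lemma nxt_inj (T : finType) (f : T -> T) (P : pred T) : injective f ->
  forall p q, P p -> P q -> nxt f P p = nxt f P q -> p = q.
Proof. by move=> fi p q Pp Pq E; rewrite -(nxt_finvK fi Pp) E nxt_finvK. Qed.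

Lemma nxt_fconnect (T : finType) (f : T -> T) (P : pred T) h k : injective f ->
  P h -> P k -> fconnect f h k -> fconnect (nxt f P) h k.
Proof.
move=> fi Ph Pk /fconnect_iterP[m Ek]; elim/ltn_ind: m h Ph Ek => m IH h Ph Ek.
case: m => [|m] in IH Ek *; first by rewrite Ek connect0.
have [j [Ej Pj Hj]] := nxt_spec fi (connect0 _ h) Ph.
have le_jm : j <= m by rewrite leqNgt; apply/negP=> /Hj; rewrite -Ek Pk.
rewrite fconnect_eqVf; apply/orP; right.
apply: (IH (m - j)) => //; first by lia.
by rewrite Ej -iterD (_ : m - j + j.+1 = m.+1) //; lia.
Qed.

Lemma eq_nxt (T : finType) (f : T -> T) (P Q : pred T) x : 
  (forall y, fconnect f x y -> P y = Q y) -> nxt f P x = nxt f Q x.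
Proof.
move=> H; rewrite /nxt; congr nth; apply: eq_in_find => y /trajectP[i _ ->].
by apply: H; rewrite -iterSr fconnect_iter.
Qed.

Section RootedBio.
Variable O : bio.
Local Notation D := (bD O).
Local Notation s := (bs O).
Local Notation a := (ba O).
Local Notation ing := (bing O).
Local Notation root := (broot O).
Local Notation phi := (@bphi O).

Definition premap : Prop :=
  [/\ injective s, involutive a, (forall x, a x != x)
    & exists r, root = [set y | fconnect phi r y]].

(** The local content of clockwise-minimality: every contour edge can be followed with the root-face
    on its left. *)
Definition root_in : Prop := forall r, r \in root -> ing (a r).
Definition vertex_in : Prop := forall x, exists2 y, fconnect s x y & ing y.

Lemma rooted_premap : is_rooted_map O -> premap.
Proof. by case=> [[_ si ai an] [_ _ Hr]]; split. Qed.

Lemma rooted_conn : is_rooted_map O -> forall x y, connect (sa_rel s a) x y.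
Proof. by case=> _ []. Qed.

Definition prv : D -> D := nxt (finv s) ing.
Definition par (h : D) : D := prv (a h).

Definition reaches_root : Prop := forall h, ing h -> exists n, a (iter n par h) \in root.

Lemma clockwise_root_in : clockwise_minimal O -> root_in.
Proof.
move=> [_ H] r rr; case E: (ing (a r)) => //.
by have [] := H r (or_introl rr) (negbT E); rewrite rr.
Qed.

Section Pre.
Hypothesis pre : premap.
Let s_inj : injective s. Proof. by case: pre. Qed.
Let aK : involutive a. Proof. by case: pre. Qed.
Let a_inj : injective a := can_inj aK.

Lemma phi_inj : injective phi.
Proof. exact: inj_comp s_inj a_inj. Qed.

Lemma root_phi x : (phi x \in root) = (x \in root).
Proof.
case: pre => _ _ _ [r ->]; rewrite !inE.
by rewrite -same_fconnect1_r //; exact: phi_inj.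
Qed.
End Pre.
End RootedBio.

(** * Parents reaching the root-face imply minimality *)

Lemma sum_cycle (T : eqType) (e : rel T) (P Q : T -> rat) (l : seq T) :
  (forall x y, e x y -> Q x = P y) -> cycle e l ->
  (\sum_(x <- l) Q x = \sum_(x <- l) P x)%R.
Proof.
move=> H; case: l => [|h t] /=; first by rewrite !big_nil.
have path_sum u : path e h u ->
    (\sum_(x <- belast h u) Q x = \sum_(x <- u) P x)%R.
  elim: u h {t} => [|y u IH] h /=; first by rewrite !big_nil.
  by case/andP=> hy /IH E; rewrite !big_cons E (H _ _ hy).
move/path_sum; rewrite belast_rcons => ->.
by rewrite -cats1 big_cat /= big_cons big_nil addr0 big_cons addrC.
Qed.

Lemma sum_mem_uniq (T : finType) (l : seq T) (Q : T -> rat) : uniq l ->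
  (\sum_x Q x * (x \in l)%:R = \sum_(x <- l) Q x)%R.
Proof.
move=> ul; rewrite (bigID (mem l)) /= [X in (_ + X)%R]big1; last first.
  by move=> x /= /negPf ->; rewrite mulr0.
by rewrite addr0 big_uniq //=; apply: eq_bigr => x xl; rewrite xl mulr1.
Qed.

Section Minimality.
Variable O : bio.
Local Notation D := (bD O).
Local Notation s := (bs O).
Local Notation a := (ba O).
Local Notation ing := (bing O).
Local Notation root := (broot O).
Local Notation phi := (@bphi O).
Local Notation par := (@par O).
Local Notation prv := (@prv O).

Hypothesis pre : premap O.
Let s_inj : injective s. Proof. by case: pre. Qed.
Let aK : involutive a. Proof. by case: pre. Qed.
Let a_inj : injective a := can_inj aK.
Let a_neq x : a x != x. Proof. by case: pre. Qed.

Definition phiV (x : D) : D := a (finv s x).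
Lemma phiVK : cancel phiV phi.
Proof. by move=> x; rewrite /phi /phiV aK f_finv. Qed.
Lemma phiK : cancel phi phiV.
Proof. by move=> x; rewrite /phi /phiV finv_f ?aK. Qed.

Lemma root_phiV x : (phiV x \in root) = (x \in root).
Proof. by rewrite -(root_phi pre) phiVK. Qed.

Lemma root_const (R : Type) (F : D -> R) : (forall x, F (phi x) = F x) ->
  forall x y, x \in root -> y \in root -> F x = F y.
Proof.
move=> H x y; case: pre => _ _ _ [r ->]; rewrite !inE => rx ry.
by rewrite -(fconnect_inv H rx) -(fconnect_inv H ry).
Qed.

Lemma root_ex : exists r, r \in root.
Proof. by case: pre => _ _ _ [r ->]; exists r; rewrite inE. Qed.

Lemma bedges_orbits : bedges O = orbits a.
Proof. by apply/setP=> A; apply/imsetP/orbitsP=> [[x _ ->]|[x ->]]; exists x; rewrite // ?(orb_invol aK). Qed.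

Lemma card_darts : #|D| = (2 * #|bedges O|)%N.
Proof.
rewrite bedges_orbits card_orbits_invol // (card_invol aK).
rewrite (_ : fixeds a = set0) ?cards0 ?addn0 //.
by apply/setP=> x; rewrite !inE (negPf (a_neq x)).
Qed.

Hypothesis vin : vertex_in O.

Lemma prv_spec x : exists j, [/\ prv x = iter j.+1 (finv s) x, ing (prv x)
    & forall i, (i < j)%N -> ~~ ing (iter i.+1 (finv s) x)].
Proof.
have [y xy iy] := vin x.
by apply: (nxt_spec (finv_inj s_inj)) iy; rewrite fconnect_finv'.
Qed.

Lemma ing_prv x : ing (prv x).
Proof. by have [j []] := prv_spec x. Qed.

Lemma ing_par h : ing (par h).
Proof. exact: ing_prv. Qed.

Lemma ing_iter_par n h : ing h -> ing (iter n par h).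
Proof. by case: n => [//|n] _; exact: ing_par. Qed.

Lemma fconnect_prv x : fconnect s x (prv x).
Proof.
by have [j [-> _ _]] := prv_spec x; rewrite -(fconnect_finv' s_inj) fconnect_iter.
Qed.

Section Potential.
Variable F : D -> rat.
Hypothesis Fphi : forall x, F (phi x) = F x.

Lemma pot_finv x : F (a (finv s x)) = F x.
Proof. by rewrite -(Fphi (a _)) phiVK. Qed.

Lemma pot_s x : F (s x) = F (a x).
Proof. by rewrite -(Fphi (a x)) /bphi aK. Qed.

(* Turning counterclockwise from [x] to the previous ingoing dart only crosses
   outgoing darts, hence can only increase a potential which is not smaller on
   the left of these. *)
Lemma pot_prv x : (forall y, ~~ ing y -> (F (a y) <= F y)%R) ->
  (F x <= F (a (prv x)))%R.
Proof.
move=> Fout; have [j [-> _ Hj]] := prv_spec x.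
suff: forall i, (i <= j)%N -> (F x <= F (a (iter i.+1 (finv s) x)))%R by apply.
elim=> [|i IH] lij; first by rewrite /= pot_finv.
apply: le_trans (IH (ltnW lij)) _; rewrite [iter i.+2 _ _]iterS pot_finv.
by apply: Fout; apply: Hj.
Qed.

Lemma pot_par_iter h n : (forall y, ~~ ing y -> (F (a y) <= F y)%R) ->
  (F (a h) <= F (a (iter n par h)))%R.
Proof.
move=> Fout; elim: n => [//|n IH]; apply: le_trans IH _; exact: pot_prv.
Qed.

End Potential.

Hypothesis planar : is_rooted_map O.

Lemma bio_potential (c : D -> rat) :
  (forall x, c (a x) = - c x)%R ->
  (forall P : D -> rat, (forall x, P (s x) = P x) -> \sum_x P x * c x = 0)%R ->
  exists F : D -> rat, (forall x, F (phi x) = F x) /\ (forall x, c x = F x - F (a x))%R.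
Proof.
case: (planar) => [[D0 _ _ _] [con eul _]]; apply: potential => //.
by rewrite -bedges_orbits card_darts; move: eul; rewrite -[@bphi O]/(fun x => s (a x)); lia.
Qed.

Lemma circuit_uniq l : @circuit O l -> uniq l.
Proof.
case/and5P=> _ _ _ _ H; rewrite uniq_pairwise.
by apply: sub_pairwise H => x y /andP[]; rewrite eq_sym.
Qed.

Lemma flow_circuit l : @circuit O l -> forall P : D -> rat, (forall x, P (s x) = P x) ->
  (\sum_x P x * ((x \in l)%:R - (a x \in l)%:R) = 0)%R.
Proof.
move=> cl P Ps; have ul := circuit_uniq cl; case/and5P: cl => _ _ cyc _ _.
under eq_bigr do rewrite mulrBr.
rewrite sumrB [X in (_ - X)%R](reindex_inj a_inj) /=.
under [X in (_ - X)%R]eq_bigr do rewrite aK.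
rewrite !sum_mem_uniq // (@sum_cycle _ _ P (fun x => P (a x)) l _ cyc) ?subrr // => x y xy.
exact: fconnect_inv xy.
Qed.

(** The potential of the unit flow along a circuit is larger by one on the left. It never decreases
    along parents, so their chain, starting with the left value at [h0], cannot end at a root-face
    having the right value. *)
Lemma reaches_root_minimal : reaches_root O -> minimal O.
Proof.
move=> reach l cl; set c := fun x : D => ((x \in l)%:R - (a x \in l)%:R)%R : rat.
have [x|F [Fphi Fc]] := bio_potential (c := c) _ (flow_circuit cl).
  by rewrite /c aK opprB.
have lin x : x \in l -> ing (a x).
  by case/and5P: cl => _ /allP H _ _ _ /H.
have Fout y : ~~ ing y -> (F (a y) <= F y)%R.
  move=> ny; rewrite -subr_ge0 -Fc /c subr_ge0.
  case E: (a y \in l); last by case: (y \in l).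
  by have := lin _ E; rewrite aK (negPf ny).
case: l @c cl Fc lin {Fout} (Fout) => // h0 l c cl Fc lin Fout [r rr con].
have h0l : h0 \in h0 :: l by rewrite mem_head.
have ah0 : a h0 \in h0 :: l = false.
  apply/negbTE; rewrite inE (negPf (a_neq h0)) /=; apply/negP=> hl.
  case/and5P: cl => _ _ _ _ /= /andP[/allP/(_ _ hl)].
  by rewrite eqxx andbF.
have F0 : F h0 = (F (a h0) + 1)%R.
  by have := Fc h0; rewrite /c h0l ah0 /=; lra.
have Fr : F (a h0) = F r.
  (* Moves that do not cross the circuit preserve the potential, so the root-face has the value of
     the right side. *)
  case/connectP: con => p; elim: p (a h0) => [|y p IH] x /=; first by move=> _ ->.
  case/andP=> [xy pp] /(IH _ pp) <-; case/orP: xy => [/eqP ->|/and3P[/eqP -> n1 n2]].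
    by rewrite Fphi.
  by have := Fc x; rewrite /c (negPf n1) (negPf n2) /=; lra.
have [n rn] := reach _ (lin _ h0l).
have := pot_par_iter Fphi (a h0) n Fout; rewrite aK (root_const Fphi rn rr); lra.
Qed.

(** Read backwards, the chain of parents is a directed path from a root corner: [par h] is an
    ingoing dart at the vertex where the edge of [h] starts. *)
Lemma reaches_root_accessible : reaches_root O -> accessible O.
Proof.
move=> reach h; have [k hk ik] := vin h; have [n rn] := reach _ ik.
exists (a (iter n par k)) => //.
have acc_s x y : fconnect s x y -> connect (acc_rel (O:=O)) x y.
  move=> xy; apply: (fconnect_fwd (P := fun z => connect (acc_rel (O:=O)) x z) _ xy) => // z xz.
  by apply: connect_trans xz _; apply: connect1; rewrite /acc_rel eqxx.
have acc_a x : ing x -> connect (acc_rel (O:=O)) (a x) x.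
  by move=> ix; apply: connect1; rewrite /acc_rel aK ix eqxx orbT.
have skh : fconnect s k h by rewrite fcsym.
apply: connect_trans (acc_s _ _ skh).
suff: connect (acc_rel (O:=O)) (iter n par k) k.
  by apply: connect_trans; apply: acc_a; apply: ing_iter_par.
elim: n {rn} => [//|n IH]; apply: connect_trans IH.
apply: connect_trans (acc_a _ (ing_iter_par n ik)).
by apply: acc_s; rewrite fcsym //; apply: fconnect_prv.
Qed.

End Minimality.

(** * Minimality and accessibility imply that parents reach the root-face *)

Lemma periodic_point (T : finType) (f : T -> T) x :
  exists n k, iter k.+1 f (iter n f x) = iter n f x.
Proof.
have /trajectP[i lti E] := looping_order f x.
exists i, (order f x - i.+1)%N; rewrite -[RHS]E -iterD; congr (iter _ f x); lia.
Qed.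

Section Reach.
Variable O : bio.
Local Notation D := (bD O).
Local Notation s := (bs O).
Local Notation a := (ba O).
Local Notation ing := (bing O).
Local Notation root := (broot O).
Local Notation phi := (@bphi O).
Local Notation par := (@par O).
Local Notation phiV := (@phiV O).

Hypothesis pre : premap O.
Let s_inj : injective s. Proof. by case: pre. Qed.
Let aK : involutive a. Proof. by case: pre. Qed.
Let a_inj : injective a := can_inj aK.
Let phiVK := phiVK pre.
Let phiK := phiK pre.

Hypothesis conn : forall x y, connect (sa_rel s a) x y.
Hypothesis mini : minimal O.

Section Region.
Variable S : {set D}.
Hypothesis S_phi : forall x, (phi x \in S) = (x \in S).
Hypothesis S_root : forall r, r \in root -> r \notin S.
Hypothesis S_dir : forall x, x \in S -> a x \notin S -> ing (a x).

(* The boundary of the region of the root-face outside [S] splits into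
   circuits having the root-face on their right. *)
Lemma minimal_no_region : S = set0.
Proof.
apply/setP=> x0; rewrite inE; apply/negbTE/negP => x0S.
have [r0 r0r] := root_ex pre.
(* [R] is the dual-connected component of the root-face in the complement of [S], and [bd] below
   marks the darts having [R] on their right but not on their left. *)
pose relR := fun x y => (y == phi x) || ((y == a x) && ((x \in S) == (y \in S))).
pose R x := connect relR x r0.
have relRS x y : relR x y -> (x \in S) = (y \in S).
  by case/orP=> [/eqP->|/andP[_ /eqP]//]; rewrite S_phi.
have R_S x : R x -> x \notin S.
  case/connectP=> p; elim: p x => [|y p IH] x /=; first by move=> _ <-; exact: S_root.
  by case/andP=> /relRS -> /IH H /H.
have R_step x y : relR x y -> R y -> R x by move=> /connect1; exact: connect_trans.
have R_phi x : R (phi x) = R x.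
  apply/idP/idP; first by apply: R_step; rewrite /relR eqxx.
  move=> Rx; apply: connect_trans Rx.
  have : fconnect phi (phi x) x by rewrite fcsym ?fconnect1 //; exact: phi_inj.
  by apply: connect_sub => u v /eqP <-; apply: connect1; rewrite /relR eqxx.
pose bd x := ~~ R x && R (a x).
have bd_ing x : bd x -> ing (a x).
  case/andP=> nR Ra; have nS := R_S _ Ra; apply: S_dir => //.
  apply: contraR nR => xS; apply: R_step Ra; rewrite /relR eqxx.
  by rewrite (negPf xS) (negPf nS) orbT.
(* Choosing a single boundary dart at each vertex makes the periodic orbits of [G] visit every
   vertex at most once, as a circuit must. *)
pose nu z := odflt z [pick y | bd y && fconnect s z y].
have nuP x : bd x -> bd (nu (a x)) && fconnect s (a x) (nu (a x)).
  (* Without a boundary dart at this vertex, membership in [R] would propagate counterclockwise from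
     [a x] all around it, up to the corner [phi x], which is outside [R]. *)
  move=> bx; rewrite /nu; case: pickP => [y //|] none; exfalso.
  have H : forall y, fconnect s (a x) y -> R y.
    suff H y : fconnect (finv s) (a x) y -> R y /\ fconnect s (a x) y.
      by move=> y; rewrite -(fconnect_finv' s_inj) => /H[].
    move=> xy; apply: (fconnect_fwd (P := fun z => R z /\ fconnect s (a x) z) _ xy).
      move=> z [Rz cz]; have cz' : fconnect s (a x) (finv s z).
        by apply: connect_trans cz _; exact: fconnect_finv.
      split=> //; have := none (finv s z); rewrite cz' andbT /bd.
      by rewrite -(R_phi (a _)) phiVK Rz andbT => /negbT; rewrite negbK.
    by case/andP: bx.
  have := H (s (a x)) (fconnect1 _ _); rewrite -/(phi x) R_phi.
  by case/andP: bx => /negPf ->.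
have nu_eq x y z : fconnect s x y -> bd z -> fconnect s x z -> nu x = nu y.
  move=> xy bz xz; rewrite /nu (eq_pick (Q := fun z => bd z && fconnect s y z)).
    case: pickP => //= /(_ z); rewrite bz -(same_connect (fconnect_sym s_inj) xy).
    by rewrite xz.
  by move=> u /=; rewrite (same_connect (fconnect_sym s_inj) xy).
have [b bdb] : exists b, bd b.
  apply/existsP; apply: contraT; rewrite negb_exists => /forallP nbd.
  have Ra x : R (a x) -> R x.
    by move=> Rx; have := nbd x; rewrite /bd Rx andbT negbK.
  have RaE x : R (a x) = R x by apply/idP/idP; [exact: Ra|rewrite -{1}(aK x); exact: Ra].
  have RsE x : R (s x) = R x by rewrite -(RaE x) -(R_phi (a x)) /bphi aK.
  have E := connect_const conn RsE RaE x0 r0.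
  have := R_S x0; rewrite x0S E => H.
  by have := H (connect0 _ _).
pose G x := nu (a x).
have [n [k Gk]] := periodic_point G b.
set x := iter n G b in Gk.
have bdG y m : bd y -> bd (iter m G y).
  by move=> by_; elim: m => [//|m /nuP/andP[]].
have bdx : bd x by exact: bdG.
have l_img y : y \in orbit G x -> bd y /\ y = nu y.
  rewrite -fconnect_orbit => /fconnect_iterP[m E].
  have by_ : bd y by rewrite E; exact: bdG.
  split=> //.
  have [z [bz Ez]] : exists z, bd z /\ y = G z.
    case: m E => [|m] -> /=; first by exists (iter k G x); split; [exact: bdG|rewrite -[LHS]Gk].
    by exists (iter m G x); split=> //; exact: bdG.
  have /andP[b1 c1] := nuP _ bz; rewrite -/(G z) -Ez in b1 c1.
  by rewrite {1}Ez; exact: (nu_eq _ _ _ c1 b1 c1).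
have cl : circuit (orbit G x).
  apply/and5P; split.
  - by rewrite -size_eq0 size_orbit -lt0n order_gt0.
  - by apply/allP=> y /l_img[/bd_ing].
  - have cG : fcycle G (orbit G x) by apply/(orbitPcycle 0 3); exists k.
    apply: (sub_in_cycle (P := bd) (e := frel G)) cG; last by apply/allP=> y /l_img[].
    by move=> y z by_ _ /= /eqP <-; case/andP: (nuP _ by_).
  - apply: (sub_in_pairwise (P := mem (orbit G x)) (r := [rel x y | x != y])).
    + move=> y z /l_img[by_ Ey] /l_img[bz Ez] /=; apply: contra => yz.
      by rewrite Ey Ez; apply/eqP; exact: nu_eq yz by_ (connect0 _ _).
    + by apply/allP.
    + by rewrite -uniq_pairwise orbit_uniq.
  - apply: (sub_in_pairwise (P := mem (orbit G x)) (r := [rel x y | x != y])).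
    + move=> y z /l_img[by_ _] /l_img[bz _] /= yz; rewrite eq_sym yz /=.
      apply: contraTneq bz => ->; rewrite /bd aK.
      by case/andP: by_ => /negPf -> ->.
    + by apply/allP.
    + by rewrite -uniq_pairwise orbit_uniq.
apply: (mini cl).
have hx : head x (orbit G x) \in orbit G x.
  by rewrite /orbit -orderSpred /= mem_head.
have [bh _] := l_img _ hx.
rewrite /root_on_right; case: (orbit G x) l_img {cl} bh hx => [//|h l] l_img /= bh _.
exists r0 => //; case/andP: bh => _.
(* A dual path to the root-face stays in [R], while the darts of the circuit are outside [R], so the
   path never crosses the circuit. *)
move=> Rh; case/connectP: Rh => p; elim: p (a h) => [|y p IH] u /=; first by move=> _ <-.
case/andP=> uy pp lst; apply: connect_trans (IH _ pp lst); apply: connect1.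
have Ry : R y by apply/connectP; exists p.
have Ru : R u by apply: R_step Ry.
case/orP: uy => [/eqP->|/andP[/eqP E _]]; first by rewrite /dual_rel_avoid eqxx.
have nl z : R z -> z \notin h :: l.
  by move=> Rz; apply/negP=> /l_img[/andP[/negPf]]; rewrite Rz.
by rewrite /dual_rel_avoid -E eqxx !nl ?orbT.
Qed.
End Region.

Hypothesis rin : root_in O.
Hypothesis acc : accessible O.

Lemma root_finv r : r \in root -> ing (finv s r).
Proof. by move=> rr; have := rin (r := phiV r); rewrite root_phiV // /phiV aK; apply. Qed.

(** A directed path starts at a vertex with an ingoing dart, the one preceding a root corner, and it
    enters each further vertex through an ingoing dart. *)
Lemma accessible_vertex_in : vertex_in O.
Proof.
move=> x; have [r rr rx] := acc x.
have V0 : exists2 y, fconnect s r y & ing y.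
  by exists (finv s r); [exact: fconnect_finv|exact: root_finv].
case/connectP: rx V0 => p; elim: p r {rr} => [|y p IH] r /=; first by move=> _ ->.
case/andP=> ry pp lst [z rz iz]; apply: (IH y) => //.
case/orP: ry => [/eqP->|/andP[iy /eqP ->]]; last by exists (a r).
by exists z => //; rewrite -same_fconnect1.
Qed.

Let vin := accessible_vertex_in.

Section ParentCycle.
Variables (h1 : D) (k : nat).
Hypotheses (h1_ing : ing h1) (h1_per : iter k.+1 par h1 = h1).
Hypothesis h1_root : forall n, a (iter n par h1) \notin root.
Hypothesis planar : is_rooted_map O.

Local Notation C := (orbit par h1).

Let C_iter h : h \in C -> exists n, h = iter n par h1.
Proof. by rewrite -fconnect_orbit => /fconnect_iterP. Qed.

Let C_ing h : h \in C -> ing h.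
Proof. by case/C_iter=> n ->; apply: ing_iter_par. Qed.

Let C_root h : h \in C -> a h \notin root.
Proof. by case/C_iter=> n ->. Qed.

Let C_par h : h \in C -> par h \in C.
Proof. by case/C_iter=> n ->; rewrite -iterS -fconnect_orbit fconnect_iter. Qed.

Let C_pre h : h \in C -> exists2 h', h' \in C & par h' = h.
Proof.
case/C_iter=> [[|n] ->]; last by exists (iter n par h1); rewrite // -fconnect_orbit fconnect_iter.
by exists (iter k par h1); rewrite // -fconnect_orbit fconnect_iter.
Qed.

Let c (x : D) : rat := ((a x \in C)%:R - (x \in C)%:R)%R.

Let c_flow (P : D -> rat) : (forall x, P (s x) = P x) -> (\sum_x P x * c x = 0)%R.
Proof.
move=> Ps; under eq_bigr do rewrite mulrBr.
rewrite sumrB [X in (X - _)%R](reindex_inj a_inj) /=.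
under [X in (X - _)%R]eq_bigr do rewrite aK.
have cyc : fcycle par C by apply/(orbitPcycle 0 3); exists k.
rewrite !sum_mem_uniq ?orbit_uniq // (@sum_cycle _ _ P (fun x => P (a x)) C _ cyc) ?subrr //.
by move=> x y /= /eqP <-; apply: (fconnect_inv Ps); apply: fconnect_prv.
Qed.

(** Let [F] be the potential of the cycle of parents. Monotonicity along a cycle makes [F (a h)] a
    constant [M] on it, and [M] is the maximum of [F]. If the root-face lay below [M], the region
    where [F] is at least [M] would contradict [minimal_no_region]. If it lies at [M], the vertices
    of the cycle together with those whose corners all lie below [M] (the predicate [B]) can only be
    entered from one another, so accessibility puts a root corner among them, which is
    impossible. *)
Lemma parent_cycle_root : False.
Proof.
have [x|F [Fphi Fc]] := bio_potential pre planar (c := c) _ c_flow.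
  by rewrite /c aK opprB.
have Fs := pot_s pre Fphi.
have Fout y : ~~ ing y -> (F (a y) <= F y)%R.
  move=> ny; rewrite -subr_ge0 -Fc /c (_ : y \in C = false) ?subr0 //.
  by apply: contraNF ny; exact: C_ing.
set M := F (a h1).
have FC h : h \in C -> F (a h) = M.
  move=> hC; have [n E] := C_iter hC; apply/eqP; rewrite eq_le; apply/andP; split.
    (* The product is a multiple of the period [k.+1] which is at least [n]: the exponent completes
       the [n] steps from [h1] to [h] into whole turns. *)
    have Em : h1 = iter (n.+1 * k.+1 - n) par h.
      rewrite E -iterD subnK; last by nia.
      by elim: n.+1 => [//|m IH]; rewrite mulSn iterD -IH h1_per.
    by rewrite /M [in leRHS]Em; apply: pot_par_iter.
  by rewrite E; apply: pot_par_iter.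
have Fle x : (F x <= M)%R.
  (* The set where [F] exceeds [M] is stable under crossing edges: [F] can only decrease from [y] to
     [a y] when [a y] is in the cycle, and then [F y] is [M]. By connectedness this set would
     contain [a h1]. *)
  rewrite leNgt; apply/negP=> Mx; pose P y := (M < F y)%R.
  have Pa1 y : P y -> P (a y).
    move=> Py; rewrite /P ltNge; apply/negP=> le_y.
    case Ey : (a y \in C); first by have := FC _ Ey; rewrite aK /P in Py *; lra.
    by have := Fc y; rewrite /c Ey /P in Py *; case: (y \in C) => /=; lra.
  have Pa y : P (a y) = P y by apply/idP/idP=> [|/Pa1//]; rewrite -{2}(aK y); exact: Pa1.
  have Ps y : P (s y) = P y by rewrite -(Pa y) /P Fs.
  by have := connect_const conn Ps Pa x (a h1); rewrite /P Mx ltxx.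
have h1C : h1 \in C by rewrite -fconnect_orbit connect0.
have Froot r : r \in root -> F r = M.
  move=> rr; apply/eqP; rewrite eq_le Fle /= leNgt; apply/negP=> rM.
  have := @minimal_no_region [set x | (M <= F x)%R] _ _ _.
  move=> H; have /setP/(_ (a h1)) : [set x | (M <= F x)%R] = set0.
    apply: H => [x|x xr|x]; rewrite ?inE ?Fphi // -?ltNge.
      by rewrite (root_const pre Fphi xr rr).
    move=> xM axM; apply: contraLR xM => nax; rewrite -ltNge.
    by have := Fout _ nax; rewrite aK; lra.
  by rewrite !inE lexx.
(* Turn counterclockwise from [y] to the first edge of the cycle. Its ingoing dart [z] cannot be the
   one met: [z] is the parent of some [h'] of the cycle, so either [a h'] is met before [z], or [y]
   lies strictly between [a h'] and [z], where no dart is ingoing. The edge is thus met at its other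
   dart, on the side of value [M - 1]. *)
have Z h y : h \in C -> fconnect s h y -> ing y -> y \notin C -> (F (a y) < M)%R.
  move=> hC hy iy yC; pose Q z := (z \in C) || (a z \in C).
  have ex : exists t, Q (iter t (finv s) y).
    move: hy; rewrite fcsym // -(fconnect_finv' s_inj) => /fconnect_iterP[t Et].
    by exists t; rewrite -Et /Q hC.
  have [t Qt tmin] := ex_minnP ex.
  have E0 i : (i <= t)%N -> F (a y) = F (a (iter i (finv s) y)).
    elim: i => [//|i IH] lt_i; rewrite iterS (pot_finv pre Fphi) (IH (ltnW lt_i)).
    have /norP[/negPf q1 /negPf q2] : ~~ Q (iter i (finv s) y).
      by apply: contraTN lt_i => /tmin; rewrite -leqNgt.
    by have := Fc (iter i (finv s) y); rewrite /c q1 q2; lra.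
  rewrite (E0 t) //; set z := iter t (finv s) y in Qt *.
  have Ez i : (i <= t)%N -> iter i s z = iter (t - i) (finv s) y by exact: iter_finvK.
  case zC : (z \in C); last first.
    move: Qt; rewrite /Q zC /= => azC; have := FC _ azC; rewrite aK.
    by have := Fc z; rewrite /c zC azC /=; lra.
  have [h' h'C Eh'] := C_pre zC.
  have [j [Ej _ Hj]] := prv_spec pre vin (a h'); rewrite -/(par h') Eh' in Ej.
  have t0 : (0 < t)%N.
    by rewrite lt0n; apply: contraNneq yC => t0; move: zC; rewrite /z t0.
  have Ea i : (i <= j.+1)%N -> iter i s z = iter (j.+1 - i) (finv s) (a h').
    by rewrite Ej; exact: iter_finvK.
  case: (leqP j.+1 t) => [le_jt|lt_tj].
    have := Ea _ (leqnn _); rewrite subnn Ez //= => Eh.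
    have := tmin (t - j.+1)%N; rewrite Eh /Q aK h'C orbT => /(_ isT); lia.
  have := Ea _ (ltnW lt_tj); rewrite Ez // subnn /= => Ey.
  have := Hj (j - t)%N; have -> : (j - t).+1 = (j.+1 - t)%N by lia.
  by rewrite -Ey iy => H; have lt_jt : (j.+1 - t <= j)%N by [lia]; case/negP: (H lt_jt).
pose B x := (exists2 h, h \in C & fconnect s h x) \/ (forall y, fconnect s x y -> (F y < M)%R).
have ltB x : (F x < M)%R -> B x.
  move=> xM; case: (boolP [exists z, fconnect s x z && ((z \in C) || (a z \in C))]).
    case/existsP=> z /andP[xz /orP[zC|azC]]; left.
      by exists z => //; rewrite fcsym.
    exists (par (a z)); first exact: C_par.
    rewrite /par aK; rewrite fcsym //; apply: connect_trans xz _; exact: fconnect_prv.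
  rewrite negb_exists => /forallP H; right=> y xy.
  suff [-> _] : F y = F x /\ fconnect s x y by [].
  apply: (fconnect_fwd (P := fun z => F z = F x /\ fconnect s x z) _ xy) => // z [Ez xz].
  have := H z; rewrite xz /= negb_or => /andP[/negPf q1 /negPf q2].
  split; last by rewrite -same_fconnect1_r.
  by have := Fc z; rewrite Fs /c q1 q2 Ez; lra.
have Bback x y : acc_rel x y -> B y -> B x.
  case/orP=> [/eqP->|/andP[iy /eqP ->]].
    case=> [[h hC hx]|H]; first by left; exists h => //; rewrite same_fconnect1_r.
    by right=> z; rewrite same_fconnect1 //; exact: H.
  case=> [[h hC hx]|H].
    case: (boolP (a x \in C)) => axC.
      left; exists (par (a x)); first exact: C_par.
      by rewrite fcsym // /par aK; exact: fconnect_prv.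
    by apply: ltB; have := Z _ _ hC hx iy axC; rewrite aK.
  by apply: ltB; rewrite -Fphi; apply: H; exact: fconnect1.
have [r rr rh] := acc h1.
have Br : B r.
  case/connectP: rh => p; elim: p r {rr} => [|y p IH] r /=.
    by move=> _ <-; left; exists h1.
  by case/andP=> ry pp lst; apply: Bback ry _; exact: IH.
case: Br => [[h hC hr]|/(_ r (connect0 _ _))]; last by rewrite Froot // ltxx.
have hp : fconnect s h (finv s r) by apply: connect_trans hr _; exact: fconnect_finv.
case: (boolP (finv s r \in C)) => pC.
  by have := C_root pC; rewrite -/(phiV r) root_phiV // rr.
by have := Z _ _ hC hp (root_finv rr) pC; rewrite (pot_finv pre Fphi) Froot // ltxx.
Qed.
End ParentCycle.

Lemma minimal_reaches_root : is_rooted_map O -> reaches_root O.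
Proof.
move=> planar h ih.
case: (boolP [exists n : 'I_(order par h), a (iter n par h) \in root]) => [/existsP[n]|H].
  by exists n.
have {}H n : a (iter n par h) \notin root.
  have /iter_findex <- := fconnect_iter par n h.
  have lt := findex_max (fconnect_iter par n h).
  by apply: contraNN H => H; apply/existsP; exists (Ordinal lt).
have [n [k E]] := periodic_point par h.
have [] := parent_cycle_root (ing_iter_par pre vin n ih) E => // m.
by rewrite -iterD.
Qed.

End Reach.

(** * Matching parentheses along a cyclic word *)

Section Matching.
Variables (X : finType) (psi : X -> X) (e : X -> int).

Definition height (x : X) (n : nat) : int := (\sum_(i < n) e (iter i psi x))%R.

(** The word read after [x], up to and including [y], is a Dyck word. Leaving [x] itself out makes
    such words concatenate. *)
Definition bal (x y : X) : Prop := exists n,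
  [/\ y = iter n psi x, height (psi x) n = 0%R
    & forall i, (i <= n)%N -> (0 <= height (psi x) i)%R].

(** Both ends are counted, whence [n.+1]. No bound is put on [n]: a pair may a priori wind several
    times around the cycle. *)
Definition mtc (h u : X) : Prop := e h = 1%R /\ exists n,
  [/\ u = iter n psi h, height h n.+1 = 0%R
    & forall i, (0 < i <= n)%N -> (0 < height h i)%R].

Lemma height0 x : height x 0 = 0%R.
Proof. by rewrite /height big_ord0. Qed.

Lemma heightD x m n : height x (m + n) = (height x m + height (iter m psi x) n)%R.
Proof.
rewrite /height big_split_ord /=; congr (_ + _)%R; apply: eq_bigr => i _.
by rewrite -iterD addnC.
Qed.

Lemma heightS x n : height x n.+1 = (height x n + e (iter n psi x))%R.
Proof. by rewrite /height big_ord_recr. Qed.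

Lemma heightSl x n : height x n.+1 = (e x + height (psi x) n)%R.
Proof. by rewrite -add1n heightD heightS height0 add0r. Qed.

Lemma bal_trans y x z : bal x y -> bal y z -> bal x z.
Proof.
case=> m [Ey m0 mp] [n [-> n0 np]]; exists (m + n); split.
- by rewrite Ey -iterD addnC.
- by rewrite heightD m0 add0r -iterSr iterS -Ey.
move=> i le_i; case: (leqP i m) => [/mp//|lt_m].
rewrite -(subnKC (ltnW lt_m)) heightD m0 add0r -iterSr iterS -Ey.
by apply: np; lia.
Qed.

Lemma bal_neutral x : e (psi x) = 0%R -> bal x (psi x).
Proof.
move=> e0; exists 1; split=> // [|[|[]]] //; by rewrite ?heightS ?height0 /= ?e0.
Qed.

Lemma bal_mtc x u : mtc (psi x) u -> bal x u.
Proof.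
case=> _ [n [-> n0 np]]; exists n.+1; split=> //; first by rewrite iterSr.
move=> i; rewrite leq_eqVlt => /orP[/eqP->|]; first by rewrite n0.
by case: i => [|i] lti; rewrite ?height0 // ltW // np.
Qed.

Lemma mtc_intro h x : e h = 1%R -> bal h x -> e (psi x) = (-1)%R -> mtc h (psi x).
Proof.
move=> eh [n [-> n0 np]] eu; split=> //; exists n.+1; split=> //.
  by rewrite heightSl heightS n0 -iterSr iterS eu eh.
by case=> // i le_i; rewrite heightSl eh; have := np i; lia.
Qed.

Lemma mtc_fun h u v : mtc h u -> mtc h v -> u = v.
Proof.
case=> eh [m [-> m0 mp]] [_ [n [-> n0 np]]].
case: (ltngtP m n) => [lt|lt|->//].
  by have := np m.+1; rewrite m0 lt => /(_ isT).
by have := mp n.+1; rewrite n0 lt => /(_ isT).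
Qed.

Hypothesis psi_inj : injective psi.

Lemma inj_iter n : injective (iter n psi).
Proof. by elim: n => [|n IH] x y //= /psi_inj /IH. Qed.

(** Of two pairs closed by the same [u], the longer one has height zero where the shorter one
    starts, and positivity inside a pair makes the two starts coincide. *)
Lemma mtc_inj h k u : mtc h u -> mtc k u -> h = k.
Proof.
case=> eh [m [-> m0 mp]] [ek [n [E n0 np]]].
wlog le_mn : h k m n eh ek m0 mp E n0 np / (m <= n)%N.
  move=> W; case: (leqP m n) => H; first exact: (W h k m n).
  by apply/esym; apply: (W k h n m) => //; exact: ltnW.
have Eh : h = iter (n - m) psi k.
  by move: E; rewrite -{1}(subnKC le_mn) iterD => /(@inj_iter m).
have d0 : height k (n - m) = 0%R.
  have := n0; rewrite (_ : n.+1 = n - m + m.+1)%N; last by lia.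
  by rewrite heightD -Eh m0 addr0.
case: (posnP (n - m)%N) Eh => [->//|pos] _.
by have := np (n - m)%N; rewrite d0 pos leq_subr => /(_ isT).
Qed.

Hypothesis e_val : forall x, [|| e x == 1%R, e x == (-1)%R | e x == 0%R].

Lemma e_ge x : (-1 <= e x)%R.
Proof. by case/or3P: (e_val x) => /eqP ->. Qed.
Lemma e_le x : (e x <= 1)%R.
Proof. by case/or3P: (e_val x) => /eqP ->. Qed.

Lemma mtc_close h u : mtc h u -> e u = (-1)%R.
Proof.
case=> eh [[|n] [-> n0 np]]; first by rewrite heightS height0 /= eh in n0.
have := np n.+1; rewrite heightS in n0; rewrite leqnn => /(_ isT) H.
by have := e_ge (iter n.+1 psi h); lia.
Qed.

(** Steps are at least -1, so the height cannot jump below zero: the first nonpositive value is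
    zero. *)
Lemma mtc_ex h n : e h = 1%R -> (height h n.+1 <= 0)%R -> exists u, mtc h u.
Proof.
move=> eh hn; have ex : exists n, (height h n.+1 <= 0)%R by exists n.
have [m m0 mmin] := ex_minnP ex.
have pos i : (0 < i <= m)%N -> (0 < height h i)%R.
  case: i => [//|i] /= lti; rewrite ltNge; apply/negP=> /mmin.
  by rewrite leqNgt lti.
exists (iter m psi h); split=> //; exists m; split=> //.
apply/eqP; rewrite eq_le m0 heightS /=.
case: m {m0 mmin} pos => [|m] pos; first by rewrite height0 /= eh.
by have := pos m.+1; have := e_ge (iter m.+1 psi h); rewrite leqnn => ? /(_ isT); lia.
Qed.

(** Going backwards from the closing step, the stretches ending there gain at most 1 at a time, so
    the first one of nonnegative height has height zero and starts with the matching opening. *)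
Lemma mtc_ex_back x n : e (iter n psi x) = (-1)%R -> (0 <= height x n.+1)%R ->
  exists h, mtc h (iter n psi x).
Proof.
set u := iter n psi x => eu hn.
pose g m := iter m (finv psi) u.
have gE m : iter m psi (g m) = u by rewrite /g iter_finv_iter.
have ex : exists m, (0 <= height (g m) m.+1)%R.
  by exists n; rewrite /g /u iter_finv_sub // subnn.
have [m m0 mmin] := ex_minnP ex.
have neg i : (i < m)%N -> (height (g i) i.+1 < 0)%R.
  by move=> lti; rewrite ltNge; apply/negP=> /mmin; rewrite leqNgt lti.
have gi i : (i <= m)%N -> iter i psi (g m) = g (m - i)%N by exact: iter_finvK.
case: m => [|m] in m0 mmin neg gi *; first by rewrite heightS height0 /= /g /= eu in m0.
have g1 : psi (g m.+1) = g m by rewrite -[LHS]/(iter 1 psi _) gi ?subn1.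
have := neg m (leqnn _); rewrite heightSl g1 in m0 => n0.
have e1 : e (g m.+1) = 1%R by have := e_le (g m.+1); lia.
have tot0 : height (g m.+1) m.+2 = 0%R by rewrite heightSl g1 e1; lia.
exists (g m.+1); split=> //; exists m.+1; split=> // i /andP[i0 le_i].
have := neg (m.+1 - i)%N; rewrite -gi // => H.
have := tot0; rewrite (_ : m.+2 = i + (m.+1 - i).+1)%N; last by lia.
rewrite heightD; have {}H := H _; have : (m.+1 - i < m.+1)%N by lia.
by move/H; lia.
Qed.

Hypothesis one_cycle : forall x y, fconnect psi x y.
Local Notation N := #|X|.
Definition total_height : int := (\sum_x e x)%R.

Lemma iter_full x : iter N psi x = x.
Proof.
have <- : order psi x = N by apply: eq_card => y; rewrite !inE one_cycle.
exact: iter_order.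
Qed.

Lemma height_full x : height x N = total_height.
Proof.
have oN : order psi x = N by apply: eq_card => y; rewrite !inE one_cycle.
have -> : height x N = (\sum_(y <- orbit psi x) e y)%R.
  rewrite /orbit oN /height; elim: N {oN} => [|n IH]; first by rewrite big_ord0 big_nil.
  by rewrite trajectSr big_rcons /= big_ord_recr /= IH.
rewrite big_uniq ?orbit_uniq //=; apply: eq_bigl => y.
by rewrite -fconnect_orbit one_cycle.
Qed.

Lemma height_period x n : height x (N + n) = (total_height + height x n)%R.
Proof. by rewrite heightD height_full iter_full. Qed.

Lemma card_pos (x : X) : (0 < N)%N.
Proof. by apply/card_gt0P; exists x. Qed.

Lemma mtc_open_total h : e h = 1%R -> (total_height <= 0)%R -> exists u, mtc h u.
Proof.
move=> eh t0; apply: (@mtc_ex _ N.-1) => //.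
by rewrite prednK ?(card_pos h) // height_full.
Qed.

Lemma mtc_close_total u : e u = (-1)%R -> (0 <= total_height)%R -> exists h, mtc h u.
Proof.
move=> eu t0; have E : u = iter N.-1 psi (psi u).
  by rewrite -iterSr prednK ?(card_pos u) // iter_full.
rewrite {1}E; apply: mtc_ex_back; rewrite -?E //.
by rewrite prednK ?(card_pos u) // height_full.
Qed.

Definition matched (h : X) : bool := [exists n : 'I_N, (height h n.+1 <= 0)%R].

Definition mt (h : X) : X := iter (find (fun n => height h n.+1 <= 0)%R (iota 0 N)) psi h.

Lemma mtcP h : e h = 1%R -> matched h -> mtc h (mt h).
Proof.
move=> eh /existsP[[n ltn] /= hn].
have hs : has (fun n => height h n.+1 <= 0)%R (iota 0 N).
  by apply/hasP; exists n; rewrite ?mem_iota.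
have [u mu] := mtc_ex eh hn; suff -> : mt h = u by [].
case: mu => _ [m [-> m0 mp]]; congr (iter _ psi h).
have lef : (find (fun n => height h n.+1 <= 0)%R (iota 0 N) < N)%N.
  by rewrite -[X in (_ < X)%N](size_iota 0) -has_find.
have := nth_find 0%N hs; rewrite nth_iota // add0n => hf.
set f := find _ _ in hf lef *.
apply/eqP; rewrite eqn_leq; apply/andP; split; rewrite leqNgt; apply/negP=> lt.
  have ltm : (m < N)%N by apply: ltn_trans lef.
  by have := before_find 0%N lt; rewrite nth_iota // add0n m0 lexx.
by have := mp f.+1; rewrite lt => /(_ isT); rewrite ltNge hf.
Qed.

(** When the total is nonnegative no pair winds around the whole cycle: one turn before its end its
    height would be nonpositive. *)
Lemma mtc_mt h u : mtc h u -> (0 <= total_height)%R -> matched h /\ mt h = u.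
Proof.
move=> mu t0; have eh : e h = 1%R by case: mu.
have mh : matched h.
  apply: contraT; rewrite negb_exists => /forallP H.
  have {}H n : (n < N)%N -> (0 < height h n.+1)%R.
    by move=> ltn; have := H (Ordinal ltn); rewrite -ltNge.
  case: mu => _ [n [_ n0 np]]; case: (ltnP n N) => [/H|le_n]; first by rewrite n0.
  have := height_period h (n.+1 - N)%N; rewrite subnKC ?n0; last by lia.
  case: (posnP (n.+1 - N)%N) => [|d0]; first by lia.
  have := np (n.+1 - N)%N; rewrite d0 => /(_ _) H2.
  have : (0 < height h (n.+1 - N))%R by apply: H2; have := card_pos h; lia.
  lia.
by split=> //; apply: mtc_fun mu; exact: mtcP.
Qed.

Lemma mtc_matched h u : mtc h u -> (total_height <= 0)%R -> mt h = u.
Proof.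
move=> mu t0; have eh : e h = 1%R by case: mu.
apply: mtc_fun mu; apply: mtcP => //; apply/existsP.
have lt : (N.-1 < N)%N by rewrite prednK ?(card_pos h).
by exists (Ordinal lt); rewrite /= prednK ?(card_pos h) // height_full.
Qed.

End Matching.

(** * The mobile of a biorientation *)

Section MobileContour.
Variable T : mob.
Definition contour (x : mD T) : mD T := ma T (ms T x).
Definition step (x : mD T) : int :=
  if ~~ mblack T x then 1%R else if ma T x == x then (-1)%R else 0%R.

Lemma step_val x : [|| step x == 1%R, step x == (-1)%R | step x == 0%R].
Proof. by rewrite /step; case: (mblack T x); case: (ma T x == x). Qed.

Lemma step_open x : (step x == 1%R) = ~~ mblack T x.
Proof. by rewrite /step; case: (mblack T x); case: (ma T x == x). Qed.

Lemma step_close x : (step x == (-1)%R) = mblack T x && (ma T x == x).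
Proof. by rewrite /step; case: (mblack T x); case: (ma T x == x). Qed.

Lemma step_neutral x : (step x == 0%R) = mblack T x && (ma T x != x).
Proof. by rewrite /step; case: (mblack T x); case: (ma T x == x). Qed.

Lemma card_set_sum (I : finType) (A : {set I}) (P : pred I) :
  #|[set x in A | P x]| = (\sum_(x in A) P x)%N.
Proof.
rewrite -sum1_card big_mkcond [RHS]big_mkcond; apply: eq_bigr => x _.
by rewrite inE; case: (x \in A) => //=; case: (P x).
Qed.

Hypothesis aK : involutive (ma T).
Hypothesis bud_black : forall x, ma T x = x -> mblack T x.

(** Group the white half-edges by edge: a black-white edge has one of them and a white-white edge
    two, which are the coefficients in the excess. *)
Lemma card_white : #|[set x | ~~ mblack T x]| =
  (#|[set e in medges T | [exists x in e, mblack T x] && [exists x in e, ~~ mblack T x]]|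
   + 2 * #|[set e in medges T | [forall x in e, ~~ mblack T x]]|)%N.
Proof.
rewrite !card_set_sum big_distrr -big_split /=.
have nb x : ~~ mblack T x -> ma T x != x by apply: contra => /eqP/bud_black.
rewrite -sum1_card (partition_big (fun x => [set x; ma T x]) (mem (medges T))) /=; last first.
  by move=> x; rewrite inE => /nb nx; apply/imsetP; exists x; rewrite ?inE.
apply: eq_bigr => E /imsetP[x]; rewrite inE eq_sym => nx ->.
rewrite (eq_bigl (fun y => y \in [set y in [set x; ma T x] | ~~ mblack T y])); last first.
  move=> y; rewrite !inE; case wy : (~~ mblack T y); rewrite ?andbF //= andbT.
  apply/eqP/orP => [E2|[]/eqP->] //; last by rewrite aK setUC.
  by have := set21 y (ma T y); rewrite E2 !inE => /orP.
rewrite sum1_card card_set_sum big_setU1 ?inE //= big_set1.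
have ex2 (P : pred (mD T)) : [exists y in [set x; ma T x], P y] = P x || P (ma T x).
  apply/existsP/orP => [[y /andP[/set2P[]-> Py]]|[] Py]; [by left|by right| |].
    by exists x; rewrite set21.
  by exists (ma T x); rewrite set22.
have fa2 (P : pred (mD T)) : [forall y in [set x; ma T x], P y] = P x && P (ma T x).
  apply/forallP/andP => [H|[p1 p2] y]; last by apply/implyP=> /set2P[]->.
  by have := H x; have := H (ma T x); rewrite set21 set22.
by rewrite !ex2 fa2; case: (mblack T x); case: (mblack T (ma T x)).
Qed.

Lemma excess_card : excess T = ((#|[set x | ~~ mblack T x]|)%:Z - (#|mbuds T|)%:Z)%R.
Proof. by rewrite card_white. Qed.

Lemma excess_total : excess T = total_height step.
Proof.
rewrite excess_card /total_height -!sum1_card !(big_morph Posz PoszD (erefl (Posz 0))).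
rewrite big_mkcond [X in (_ - X)%R]big_mkcond -sumrB; apply: eq_bigr => x _.
rewrite !inE /step; case bx : (mblack T x) => /=; first by case: ifP.
by rewrite ifN //; apply/negP=> /eqP/bud_black; rewrite bx.
Qed.

Hypothesis s_inj : injective (ms T).
Hypothesis black_s : forall x, mblack T (ms T x) = mblack T x.

Lemma card_orbits_bw : #|orbits (ms T)| = (#|white_vertices T| + #|black_vertices T|)%N.
Proof.
rewrite -(cardsID (black_vertices T)) addnC; congr (_ + _)%N; apply: eq_card => V; rewrite !inE.
  case: orbitsP => //= -[x ->]; rewrite ?andbT.
  apply/idP/existsP => [/existsP H|[y /andP[]]].
    by exists x; rewrite mem_orb connect0; apply/negP=> bx; case: H; exists x; rewrite mem_orb connect0.
  rewrite mem_orb => xy wy; apply/existsP=> -[z /andP[]]; rewrite mem_orb => xz bz.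
  by move: wy; rewrite -(fconnect_inv black_s xy) (fconnect_inv black_s xz) bz.
by rewrite andbA andbb.
Qed.

Lemma contour_inj : injective contour.
Proof. exact: inj_comp (can_inj aK) s_inj. Qed.

Lemma card_mobile_darts : #|mD T| = (2 * #|medges T| + #|mbuds T|)%N.
Proof. exact: (card_invol aK). Qed.

(** With buds counted as edges of a single dart, vertices and edges of a tree add up to the number
    of darts plus one, so Euler's inequality leaves at most one face. The contour is the face
    permutation conjugated by [ma T]. *)
Lemma tree_contour : (forall x y, connect (sa_rel (ms T) (ma T)) x y) ->
  #|orbits (ms T)| = (#|medges T| + 1)%N -> forall x y, fconnect contour x y.
Proof.
move=> conn tree x y; have X0 : (0 < #|mD T|)%N by apply/card_gt0P; exists x.
have := euler_ineq s_inj aK conn X0; rewrite (card_orbits_invol aK) tree.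
rewrite -[pairs _]/(medges T) -[fixeds _]/(mbuds T) card_mobile_darts => le_o.
pose p x := ms T (ma T x); have p_inj : injective p := inj_comp s_inj (can_inj aK).
have {}le_o : (#|orbits p| <= 1)%N by rewrite /p; lia.
have E u v : fconnect p u v.
  by apply/(orb_eqP p_inj); apply: (card_le1_eqP le_o); exact: orb_in.
suff H u v : fconnect p u v -> fconnect contour (ma T u) (ma T v).
  by rewrite -(aK x) -(aK y); apply: H; exact: E.
move=> uv; apply: (fconnect_fwd (P := fun z => fconnect contour (ma T u) (ma T z)) _ uv) => //.
move=> z uz; rewrite (_ : ma T (p z) = contour (ma T z)) -?same_fconnect1_r //.
exact: contour_inj.
Qed.

End MobileContour.

(** * The opening with a prescribed set of kept white half-edges *)

Section KMobile.
Variables (O : bio) (ing' K : pred (bD O)).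
Local Notation D := (bD O).
Local Notation s := (bs O).
Local Notation a := (ba O).
Local Notation ing := (bing O).
Local Notation w := (bw O).
Local Notation root := (broot O).
Local Notation phi := (@bphi O).
Local Notation par := (@par O).
Local Notation prv := (@prv O).
Local Notation phiV := (@phiV O).

(* [K] selects the white half-edges which are kept: all ingoing darts for
   [Phi_plus], the ingoing darts at inner vertices for [Phi_minus]; [ing'] is
   the orientation after the possible reversal of the root-face contour. *)
Definition keepK : pred (D + D) :=
  fun x => match x with inl h => K h | inr h => h \notin root end.

Definition KM : mob :=
  Mob (@tD O keepK) (@t_sigma O ing' keepK) (@t_alpha O ing' keepK)
      (@t_black O keepK) (@t_weight O ing' keepK).

Local Notation X := (mD KM).

(** The first five fields say that discarded ingoing darts lie on 1-way contour edges and are alone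
    at their vertex. The last four allow [ing'] to be replaced by [ing] and [K] wherever the opening
    looks at a kept half-edge. *)
Record kgood : Prop := KGood {
  kg_in : forall h, K h -> ing h;
  kg_out : forall h, ing h -> ~~ K h -> a h \in root /\ ~~ ing (a h);
  kg_sat : forall h k, K h -> ing k -> fconnect s h k -> K k;
  kg_alpha : forall h, K h -> ing (a h) -> K (a h);
  kg_uniq : forall p q, ing p -> ~~ K p -> ing q -> fconnect s p q -> q = p;
  kg_rev_vertex : forall h y, K h -> fconnect s h y -> ing' y = ing y;
  kg_rev_edge : forall h, K h -> ing' (a h) = ing (a h);
  kg_oneway : forall h, h \notin root ->
    ing' h && ~~ ing' (a h) = K h && ~~ ing (a h);
  kg_zeroway : forall h, h \notin root ->
    ~~ ing' h && ~~ ing' (a h) = ~~ ing h && ~~ ing (a h)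
}.

Hypothesis pre : premap O.
Hypothesis rin : root_in O.
Hypothesis vin : vertex_in O.
Hypothesis kg : kgood.

Let s_inj : injective s. Proof. by case: pre. Qed.
Let aK : involutive a. Proof. by case: pre. Qed.
Let a_neq x : a x != x. Proof. by case: pre. Qed.
Let phiVK := phiVK pre.
Let phiK := phiK pre.
Let root_phiV := root_phiV pre.

Local Notation nin := (nxt s ing).

Definition ksigma (x : D + D) : D + D :=
  match x with inl h => inl (nin h) | inr h => inr (phiV h) end.

(** Expressed with the original orientation: a 1-way edge whose ingoing dart is discarded is reduced
    to a bud. *)
Definition kalpha (x : D + D) : D + D :=
  match x with
  | inl h => if ing (a h) then inl (a h) else inr h
  | inr h => if K h && ~~ ing (a h) then inl h
             else if ~~ ing h && ~~ ing (a h) then inr (a h) else inr h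
  end.

Lemma rin_finv r : r \in root -> ing (finv s r).
Proof. exact: root_finv. Qed.

Lemma out_s x : ~~ ing x -> s x \notin root.
Proof. by apply: contra => /rin_finv; rewrite finv_f. Qed.

Lemma out_a h : ~~ ing (a h) -> h \notin root.
Proof. by apply: contra => /rin. Qed.

Lemma K_of_ing k : ing k -> a k \notin root -> K k.
Proof. by move=> ik ar; apply: contraR ar => nk; have [] := kg_out kg ik nk. Qed.

Lemma ing_nin h : ing h -> ing (nin h).
Proof. by move=> ih; have [j []] := nxt_spec s_inj (connect0 _ h) ih. Qed.

Lemma K_nin h : K h -> K (nin h).
Proof.
move=> Kh; have ih := kg_in kg Kh.
by apply: (kg_sat kg Kh (ing_nin ih)); apply: nxt_connect ih => //.
Qed.

Lemma val_sigma (x : X) : val (ms KM x) = ksigma (val x).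
Proof.
case: x => [[h|h] /= kx]; rewrite /ms /= /t_sigma /= insubdK //=.
- by congr inl; apply: eq_nxt => y; exact: kg_rev_vertex.
- rewrite -topredE /= (_ : next_in ing' h = nin h) ?K_nin //.
  by apply: eq_nxt => y; exact: kg_rev_vertex.
- by rewrite -topredE /= -/(phiV h) root_phiV.
Qed.

Lemma keep_alpha x : keepK x -> keepK (kalpha x).
Proof.
case: x => h /= kx; first by case: ifP => [/(kg_alpha kg kx)//|/negbT/out_a].
case: ifP => [/andP[]//|_]; case: ifP => // /andP[nh _] /=.
by apply: out_a; rewrite aK.
Qed.

Lemma val_alpha (x : X) : val (ma KM x) = kalpha (val x).
Proof.
suff E : raw_alpha ing' (val x) = kalpha (val x).
  by rewrite /ma /= /t_alpha insubdK ?E // -topredE /=; apply: keep_alpha; exact: valP.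
case: x => [[h|h] /= kx]; first by rewrite kg_rev_edge.
by rewrite kg_oneway // kg_zeroway.
Qed.

Lemma black_val (x : X) : mblack KM x = ~~ is_inl (val x).
Proof. by []. Qed.

Lemma inX v : keepK v -> exists x : X, val x = v.
Proof. by move=> kv; exists (Sub v kv); rewrite SubK. Qed.

Lemma val_l (x : X) h : val x = inl h -> K h.
Proof. by move=> E; have := valP x; rewrite E. Qed.

Lemma val_r (x : X) h : val x = inr h -> h \notin root.
Proof. by move=> E; have := valP x; rewrite E. Qed.

Lemma ksigma_inj : injective (ms KM).
Proof.
move=> x y /(congr1 val); rewrite !val_sigma => E; apply: val_inj.
case Ex : (val x) E => [h|h]; case Ey : (val y) => [k|k] //= [E].
  by congr inl; apply: nxt_inj E; rewrite ?(kg_in kg) ?(val_l Ex) ?(val_l Ey).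
by congr inr; apply: (can_inj phiVK).
Qed.

Lemma kalphaK : involutive (ma KM).
Proof.
move=> x; apply: val_inj; rewrite !val_alpha; case Ex : (val x) => [h|h] /=.
  have Kh := val_l Ex; have ih := kg_in kg Kh.
  by case: ifP => ia /=; rewrite ?aK ?ih // Kh ia.
have nr := val_r Ex.
case: ifP => [/andP[Kh na]|H] /=; first by rewrite (negPf na).
case: ifP => [/andP[nh na]|H2] /=; last by rewrite H H2.
rewrite aK (negPf nh) (negPf na) /=.
by case: ifP => [/andP[/(kg_in kg)]|_] //; rewrite (negPf na).
Qed.

Lemma kblack_sigma x : mblack KM (ms KM x) = mblack KM x.
Proof. by rewrite !black_val val_sigma; case: (val x). Qed.

Lemma kblack_bud x : ma KM x = x -> mblack KM x.
Proof.
move/(congr1 val); rewrite val_alpha black_val; case: (val x) => //= h.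
by case: ifP => // _ [] E; have := a_neq h; rewrite E eqxx.
Qed.

Lemma bud_val (x : X) h : val x = inr h ->
  (ma KM x == x) = ing (a h) || (ing h && ~~ K h).
Proof.
move=> Ex; have nr := val_r Ex; rewrite -(inj_eq val_inj) val_alpha Ex /=.
case Ea : (ing (a h)); rewrite /= ?andbF ?eqxx // !andbT.
case Kh : (K h); first by rewrite andbF.
case ih : (ing h) => /=; first by rewrite eqxx.
by apply/eqP=> -[E]; have := a_neq h; rewrite E eqxx.
Qed.

Local Notation psi := (@contour KM).
Local Notation e := (@step KM).

(** Identifies the children of [k]: they are the ingoing opposites of the darts from [k] excluded,
    clockwise, to the next ingoing dart included. *)
Lemma sec_prv k j i : ing k -> (forall i, i < j -> ~~ ing (iter i.+1 s k)) -> i <= j ->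
  prv (iter i.+1 s k) = k.
Proof.
move=> ik Hj lij; have E m : m <= i.+1 -> iter m (finv s) (iter i.+1 s k) = iter (i.+1 - m) s k.
  by move=> le_m; rewrite iter_finv_sub.
rewrite /prv (@nxt_uniq _ _ _ (finv_inj s_inj) _ i) ?E ?subnn // => m ltm.
rewrite E; last by lia.
have -> : i.+1 - m.+1 = (i - m.+1).+1 by lia.
by apply: Hj; lia.
Qed.

Lemma sec_root k j i : (forall i, i < j -> ~~ ing (iter i.+1 s k)) -> i <= j ->
  a k \notin root -> iter i.+1 s k \notin root.
Proof.
move=> Hj; case: i => [_|i lti _]; last by rewrite iterS; apply: out_s; exact: Hj.
by rewrite -(root_phi pre) /bphi aK.
Qed.

Hypothesis reach : reaches_root O.

Lemma deep_root n h : ing h -> (forall i, i < n -> a (iter i par h) \notin root) -> n < #|D|.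
Proof.
move=> ih H; have [m rm] := reach ih; rewrite ltnNge; apply/negP=> le_n.
have := findex_max (fconnect_iter par m h).
have le_o : order par h <= #|D| by apply: max_card.
move=> lt; have := H (findex par h (iter m par h)).
rewrite iter_findex ?fconnect_iter // rm => /(_ _)/negP; apply=> //; lia.
Qed.

(* The bud facing [a k] closes the parenthesis opened by the ingoing dart [k]:
   the parentheses directly inside are those of the darts [c] with [par c = k]. *)
Lemma match_bud k (x u : X) : K k -> a k \notin root ->
  val x = inl k -> val u = inr (a k) -> mtc psi e x u.
Proof.
suff H m : forall n k (x u : X), #|D| <= n + m -> 
    (forall i, i < n -> a (iter i par k) \notin root) ->
    K k -> a k \notin root -> val x = inl k -> val u = inr (a k) -> mtc psi e x u.
  by apply: (H #|D| 0).
elim: m => [|m IH] n {}k {}x {}u le_n dep Kk ak Ex Eu.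
  by have := deep_root (kg_in kg Kk) dep; lia.
have ik := kg_in kg Kk.
have child c (y v : X) : ing c -> a c \notin root -> par c = k ->
    val y = inl c -> val v = inr (a c) -> mtc psi e y v.
  move=> ic ac pc; apply: (IH n.+1) => //; first by lia.
    by case=> [|i] lti //; rewrite iterSr pc; exact: dep.
  exact: K_of_ing.
have [j [Eg ig Hj]] := nxt_spec s_inj (connect0 _ k) ik.
have nroot i : i <= j -> iter i.+1 s k \notin root by move=> lij; exact: sec_root Hj lij ak.
(* The contour sweeps the sector of [k] counterclockwise, from the next ingoing dart back to [s k];
   at each dart it meets a neutral half-edge or jumps over the pair of a child. *)
have loop i : i <= j -> exists2 y : X, val y = inr (iter (j - i).+1 s k) & bal psi e x y.
  elim: i => [_|i IHi lti].
    rewrite subn0; set g := iter _ _ _ in Eg *.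
    have ng : g \notin root by exact: nroot.
    have [y Ey] := @inX (inr g) ng; exists y => //.
    have Kg : K g by rewrite -Eg; exact: K_nin.
    have Ep : val (psi x) = if ing (a g) then inl (a g) else inr g.
      by rewrite val_alpha val_sigma Ex /= Eg.
    move: Ep; case: ifP => iag Ep.
      apply: bal_mtc; apply: (child (a g)) => //; rewrite ?aK //.
      by rewrite /par aK; apply: sec_prv ik Hj (leqnn j).
    have <- : psi x = y by apply: val_inj; rewrite Ep.
    apply: bal_neutral; apply/eqP; rewrite step_neutral black_val Ep /=.
    by rewrite (bud_val Ep) iag Kg andbF.
  have [y Ey By] := IHi (ltnW lti).
  have Ej : (j - i).+1 = (j - i.+1).+2 by lia.
  rewrite Ej iterS in Ey; set p := iter (j - i.+1).+1 s k in Ey *.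
  have np : p \notin root by apply: nroot; lia.
  have op : ~~ ing p by apply: Hj; lia.
  have [z Ez] := @inX (inr p) np; exists z => //.
  apply: bal_trans By _.
  have Ep : val (psi y) = if K (a p) then inl (a p) else
                          if ~~ ing (a p) then inr p else inr (a p).
    by rewrite val_alpha val_sigma Ey /= /phiV finv_f // aK op !andbT.
  have pp : prv p = k by apply: sec_prv ik Hj _; lia.
  case iap : (ing (a p)) Ep.
    have Kap : K (a p) by apply: K_of_ing; rewrite ?aK.
    rewrite Kap => Ep.
    apply: bal_mtc; apply: (child (a p)) => //; rewrite ?aK //.
    by rewrite /par aK.
  case: ifP => [/(kg_in kg)|_ Ep]; first by rewrite iap.
  have <- : psi y = z by apply: val_inj; rewrite Ep.
  apply: bal_neutral; apply/eqP; rewrite step_neutral black_val Ep /=.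
  by rewrite (bud_val Ep) iap (negPf op).
have [y Ey By] := loop j (leqnn j); rewrite subnn in Ey.
have nak := val_r Eu.
have Ep : psi y = u.
  by apply: val_inj; rewrite val_alpha val_sigma Ey /= /phiV finv_f // aK ik !andbF.
rewrite -Ep; apply: mtc_intro By _; apply/eqP; first by rewrite step_open black_val Ex.
by rewrite Ep step_close black_val Eu /= (bud_val Eu) aK ik.
Qed.

Lemma nin_fconnect h k : ing h -> ing k -> fconnect s h k -> fconnect nin h k.
Proof. exact: nxt_fconnect. Qed.

Lemma fconnect_nin h k : ing h -> fconnect nin h k -> fconnect s h k.
Proof.
move=> ih hk; suff [] : fconnect s h k /\ ing k by [].
apply: (fconnect_fwd (P := fun z => fconnect s h z /\ ing z) _ hk) => // z [hz iz].
split; last exact: ing_nin.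
by apply: connect_trans hz _; apply: nxt_connect iz.
Qed.

Lemma val_iter_l (x : X) h n : val x = inl h -> val (iter n (ms KM) x) = inl (iter n nin h).
Proof. by move=> Ex; elim: n => [//|n IH]; rewrite !iterS val_sigma IH. Qed.

Lemma val_iter_r (x : X) h n : val x = inr h -> val (iter n (ms KM) x) = inr (iter n phiV h).
Proof. by move=> Ex; elim: n => [//|n IH]; rewrite !iterS val_sigma IH. Qed.

(** * Connectedness of the opening *)

Section Connectivity.
Hypothesis conn : forall x y, connect (sa_rel s a) x y.

Local Notation kc := (connect (sa_rel (ms KM) (ma KM))).

(** Stated on [D + D], so that half-edges of the mobile can be named without carrying proofs that
    they are kept. *)
Definition lk (u v : D + D) : Prop := exists x y : X, [/\ val x = u, val y = v & kc x y].

Lemma lk_refl u : keepK u -> lk u u.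
Proof. by move=> /inX[x Ex]; exists x, x. Qed.

Lemma lk_sym u v : lk u v -> lk v u.
Proof.
case=> x [y [Ex Ey xy]]; exists y, x; split=> //.
by rewrite sa_connect_sym //; [exact: ksigma_inj|exact: kalphaK].
Qed.

Lemma lk_trans v u z : lk u v -> lk v z -> lk u z.
Proof.
case=> x [y [Ex Ey xy]] [x' [y' [Ex' Ey' xy']]]; exists x, y'; split=> //.
by apply: connect_trans xy _; rewrite (_ : y = x') //; apply: val_inj; rewrite Ey Ex'.
Qed.

Lemma kc_s x : kc x (ms KM x).
Proof. by apply: connect1; rewrite /sa_rel eqxx. Qed.
Lemma kc_a x : kc x (ma KM x).
Proof. by apply: connect1; rewrite /sa_rel eqxx orbT. Qed.

Lemma kc_iter f n x : (forall y, kc y (f y)) -> kc x (iter n f x).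
Proof. by move=> H; elim: n => [//|n IH]; apply: connect_trans IH (H _). Qed.

Lemma lk_face h : h \notin root -> lk (inr h) (inr (phi h)).
Proof.
move=> nh; apply: lk_sym; have [|x Ex] := @inX (inr (phi h)); first by rewrite /= root_phi.
by exists x, (ms KM x); rewrite val_sigma Ex /= phiK; split=> //; exact: kc_s.
Qed.

Lemma lk_vertex h k : K h -> K k -> fconnect s h k -> lk (inl h) (inl k).
Proof.
move=> Kh Kk /(nin_fconnect (kg_in kg Kh) (kg_in kg Kk)) /fconnect_iterP[n ->].
have [x Ex] := @inX (inl h) Kh; exists x, (iter n (ms KM) x).
by rewrite (val_iter_l _ Ex); split=> //; apply: kc_iter kc_s.
Qed.

(** The matching bud lies further along the contour, and the contour moves inside the mobile. *)
Lemma lk_match k : K k -> a k \notin root -> lk (inl k) (inr (a k)).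
Proof.
move=> Kk nr; have [x Ex] := @inX (inl k) Kk; have [u Eu] := @inX (inr (a k)) nr.
have [_ [n [En _ _]]] := match_bud Kk nr Ex Eu.
exists x, u; split=> //; rewrite En; apply: kc_iter => y.
exact: connect_trans (kc_s _) (kc_a _).
Qed.

Lemma lk_alpha u : keepK u -> lk u (kalpha u).
Proof.
by move=> /inX[x Ex]; exists x, (ma KM x); rewrite val_alpha Ex; split=> //; exact: kc_a.
Qed.

(** For a 2-way edge the link is indirect: the white half-edge of [k] is joined to that of [a k],
    whose matching bud sits at the corner [k]. *)
Lemma lk_edge k : K k -> k \notin root -> lk (inl k) (inr k).
Proof.
move=> Kk nr; have := @lk_alpha (inl k) Kk => /=; case: ifP => // ia.
move/lk_trans; apply; have Ka := kg_alpha kg Kk ia.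
by have := lk_match Ka; rewrite aK; apply.
Qed.

Lemma lk_out o : ~~ ing o -> o \notin root -> lk (inr o) (inr (a o)).
Proof.
move=> no nr; have nar : a o \notin root by apply: out_a; rewrite aK.
case ia : (ing (a o)).
  have Ka : K (a o) by apply: K_of_ing; rewrite ?aK.
  apply: lk_trans (lk_edge Ka nar); apply: lk_sym.
  by have := lk_match Ka; rewrite aK; apply.
have := @lk_alpha (inr o) nr; rewrite /= ia no /= andbT.
by case: ifP => // /(kg_in kg); rewrite (negPf no).
Qed.

(* The vertex or face of the mobile standing for the corner [x]. *)
Definition rep (x : D) : D + D :=
  if x \notin root then inr x else if K (a x) then inl (a x) else inr (a x).

Lemma rep_root x : x \in root -> ~~ K (a x) -> ing (a x) /\ ~~ ing x.
Proof.
move=> xr nK; have ia := rin xr; split=> //.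
by have [_] := kg_out kg ia nK; rewrite aK.
Qed.

Lemma keep_rep x : keepK (rep x).
Proof.
rewrite /rep; case: ifP => //= /negbFE xr; case: ifP => // /negbT nK /=.
by apply: out_a; rewrite aK; case: (rep_root xr nK).
Qed.

Lemma rep_a1 x : x \in root -> lk (rep x) (rep (a x)).
Proof.
move=> xr; rewrite /rep xr /= aK; case axr : (a x \in root) => /=.
  have ix : ing x by rewrite -(aK x); exact: rin.
  have Ka : K (a x) by apply: contraT => /(rep_root xr)[_]; rewrite ix.
  rewrite Ka; have Kx : K x by rewrite -(aK x); apply: kg_alpha => //; rewrite aK.
  by rewrite Kx; have := @lk_alpha (inl (a x)) Ka; rewrite /= aK ix.
case Ka : (K (a x)); first by apply: lk_edge; rewrite ?axr.
by apply: lk_refl; rewrite /= axr.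
Qed.

Lemma rep_a x : lk (rep x) (rep (a x)).
Proof.
case xr : (x \in root); first exact: rep_a1.
case axr : (a x \in root).
  by apply: lk_sym; rewrite -{2}(aK x); apply: rep_a1.
rewrite /rep xr axr /=.
case ix : (ing x); last by apply: lk_out; rewrite ?ix ?xr.
have Kx : K x by apply: K_of_ing; rewrite ?axr.
apply: lk_trans (lk_match Kx _); last by rewrite axr.
by apply: lk_sym; apply: lk_edge => //; rewrite xr.
Qed.

Lemma lk_sector j x : x \notin root -> (forall i, i < j -> ~~ ing (iter i s x)) ->
  lk (inr x) (inr (iter j s x)).
Proof.
elim: j x => [|j IH] x nx Hj; first exact: lk_refl.
have ox : ~~ ing x by exact: (Hj 0).
have nax : a x \notin root by apply: out_a; rewrite aK.
apply: lk_trans (lk_out ox nx) _; apply: lk_trans (lk_face nax) _.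
rewrite /bphi aK iterSr; apply: IH; first exact: out_s.
by move=> i lti; rewrite -iterSr; exact: Hj.
Qed.

(** Away from the root-face this is rotation around a black vertex. Between two consecutive root
    corners, the vertex shared by [p] and [r] is passed either along the 2-way edge of [r], or by
    sweeping outgoing darts up to the next ingoing dart [g], whose white half-edge is at the vertex
    of [p]. If [p] is discarded, [g] is [p] itself. *)
Lemma rep_phi x : lk (rep x) (rep (phi x)).
Proof.
case xr : (x \in root); last by rewrite /rep root_phi // xr /=; apply: lk_face; rewrite xr.
have rr : phi x \in root by rewrite root_phi.
set r := phi x in rr *; set p := a x; have ip : ing p by exact: rin.
have sp : s p = r by [].
case ir : (ing r).
  have Kar : K (a r) by apply: contraT => /(rep_root rr)[_]; rewrite ir.
  have Kr : K r by rewrite -(aK r); apply: kg_alpha => //; rewrite aK.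
  have Kp : K p by apply: kg_sat Kr ip _ => //; rewrite fcsym // -sp fconnect1.
  rewrite /rep xr rr -/p Kp Kar /=.
  apply: lk_trans (lk_vertex Kp Kr _) _; first by rewrite -sp fconnect1.
  by have := @lk_alpha (inl r) Kr; rewrite /= (rin rr).
have [j [Eg ig Hj]] := nxt_spec s_inj (connect0 _ p) ip; set g := nin p in Eg ig.
case: j => [|j] in Eg Hj *; first by rewrite Eg /= sp ir in ig.
have nsr : s r \notin root by apply: out_s; rewrite ir.
have Lg : lk (inr (s r)) (inr g).
  have -> : g = iter j s (s r) by rewrite Eg -sp -!iterSr.
  apply: lk_sector => // i lti; rewrite -sp -!iterSr; exact: Hj.
have nar : a r \notin root by apply: out_a; rewrite aK ir.
have Lr : lk (inr (a r)) (rep r) by apply: lk_sym; have := rep_a r; rewrite {2}/rep nar.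
have Lar : lk (inr (a r)) (inr g) by apply: lk_trans Lg; have := lk_face nar; rewrite /bphi aK.
apply: lk_trans Lr; apply: lk_sym; apply: lk_trans Lar _; apply: lk_sym.
have ng : g \notin root.
  by rewrite Eg iterS; apply: out_s; exact: (Hj j).
rewrite /rep xr -/p /=; case: ifP => [Kp|/negbT nKp].
  have Kg : K g by exact: K_nin.
  apply: lk_trans (lk_edge Kg ng); apply: lk_vertex => //.
  by apply: nxt_connect ip.
have gp : g = p by apply: (kg_uniq kg ip nKp ig); apply: nxt_connect ip.
by move: ng; rewrite gp => np; exact: lk_refl.
Qed.

Lemma rep_conn x y : lk (rep x) (rep y).
Proof.
apply: (connect_fwd (P := fun z => lk (rep x) (rep z)) _ (conn x y)); last first.
  exact: lk_refl (keep_rep x).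
move=> u v uv; move/lk_trans; apply; case/orP: uv => /eqP ->; last exact: rep_a.
by apply: lk_trans (rep_a u) _; have := rep_phi (a u); rewrite /bphi aK.
Qed.

Lemma kmobile_connected (x y : X) : kc x y.
Proof.
have to_rep u : keepK u -> exists d, lk u (rep d).
  case: u => [k|h] ku; last by exists h; rewrite /rep ifT //; exact: lk_refl.
  exists (a k); rewrite /rep; case: ifP => [nr|_]; first exact: lk_match.
  by rewrite aK (_ : K k) //; exact: lk_refl.
have [d Ld] := to_rep _ (valP x); have [d' Ld'] := to_rep _ (valP y).
have [x' [y' [Ex Ey xy]]] := lk_trans Ld (lk_trans (rep_conn d d') (lk_sym Ld')).
by rewrite -(val_inj Ex) -(val_inj Ey).
Qed.

End Connectivity.

(** * Correspondences of faces, vertices and edges; counting buds *)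

Section Correspondences.

Definition under (x : X) : D := match val x with inl h => h | inr h => h end.

Lemma val_cases (x : X) :
  (val x = inl (under x) /\ K (under x)) \/ (val x = inr (under x) /\ under x \notin root).
Proof.
rewrite /under; case Ex : (val x) => [h|h]; [left|right]; split=> //.
  exact: val_l Ex.
exact: val_r Ex.
Qed.

Lemma under_l (x : X) h : val x = inl h -> under x = h.
Proof. by rewrite /under => ->. Qed.
Lemma under_r (x : X) h : val x = inr h -> under x = h.
Proof. by rewrite /under => ->. Qed.

Lemma under_inj (x y : X) : mblack KM x = mblack KM y -> under x = under y -> x = y.
Proof.
rewrite !black_val => B E; apply: val_inj.
by case: (val_cases x) B => -[-> _]; case: (val_cases y) => -[-> _] //=; rewrite E.
Qed.

Lemma black_nbud (x : X) : ma KM x != x -> mblack KM x ->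
  ~~ ing (a (under x)) /\ (ing (under x) -> K (under x)).
Proof.
move=> nb; rewrite black_val; case: (val_cases x) => -[Ex _]; rewrite Ex //= => _.
move: nb; rewrite (bud_val Ex) negb_or => /andP[-> /=].
by rewrite negb_and => /orP[/negPf ->|/negbNE].
Qed.

Lemma white_nbud (x : X) : ~~ mblack KM x -> ma KM x != x.
Proof. by apply: contra => /eqP; exact: kblack_bud. Qed.

Lemma white_K (x : X) : ~~ mblack KM x -> K (under x).
Proof. by rewrite black_val; case: (val_cases x) => -[-> H]. Qed.

Definition liftF (b : bool) (A : {set D}) : {set X} :=
  [set x | (mblack KM x == b) && (under x \in A)].

Lemma phiV_iter n h : iter n phi (iter n phiV h) = h.
Proof. by elim: n h => [//|n IH] h; rewrite iterSr iterS phiVK IH. Qed.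
Lemma phi_iter n h : iter n phiV (iter n phi h) = h.
Proof. by elim: n h => [//|n IH] h; rewrite iterSr iterS phiK IH. Qed.

Lemma orb_black (x : X) : mblack KM x -> orb (ms KM) x = liftF true (orb phi (under x)).
Proof.
rewrite black_val; case: (val_cases x) => -[Ex nr]; rewrite Ex //= => _.
apply/setP=> y; rewrite !inE; apply/fconnect_iterP/andP => [[n Ey]|[]].
  have Ey' := val_iter_r n Ex; rewrite -Ey in Ey'; rewrite black_val Ey' (under_r Ey') eqxx.
  split=> //; rewrite fcsym; last exact: phi_inj.
  by apply/fconnect_iterP; exists n; rewrite phiV_iter.
rewrite black_val; case: (val_cases y) => -[Ey _]; rewrite Ey //= => _.
rewrite fcsym; last exact: phi_inj.
case/fconnect_iterP=> n En; exists n; apply: val_inj.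
by rewrite Ey (val_iter_r n Ex) En phi_iter.
Qed.

Lemma orb_white (x : X) : ~~ mblack KM x -> orb (ms KM) x = liftF false (orb s (under x)).
Proof.
rewrite black_val; case: (val_cases x) => -[Ex Kx]; rewrite Ex //= => _.
have ix := kg_in kg Kx.
apply/setP=> y; rewrite !inE; apply/fconnect_iterP/andP => [[n Ey]|[]].
  have Ey' := val_iter_l n Ex; rewrite -Ey in Ey'; rewrite black_val Ey' (under_l Ey').
  by split=> //; apply: fconnect_nin => //; exact: fconnect_iter.
rewrite black_val; case: (val_cases y) => -[Ey Ky]; rewrite Ey //= => _.
move=> /(nin_fconnect ix (kg_in kg Ky)) /fconnect_iterP[n En]; exists n; apply: val_inj.
by rewrite Ey (val_iter_l n Ex) En.
Qed.

Lemma under_liftF b (A : {set D}) : (forall h, h \in A -> if b then h \notin root else K h) ->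
  under @: liftF b A = A.
Proof.
move=> H; apply/setP=> h; apply/imsetP/idP => [[x]|hA]; first by rewrite inE => /andP[_ ?] ->.
have [x Ex] : exists x : X, val x = if b then inr h else inl h.
  by apply: inX; case: b H => /(_ _ hA).
exists x; last by rewrite /under Ex; case: (b).
by rewrite inE black_val /under Ex; case: (b).
Qed.

Lemma under_inj_in b A : {in liftF b A &, injective under}.
Proof.
move=> x y; rewrite !inE => /andP[/eqP bx _] /andP[/eqP by_ _]; apply: under_inj.
by rewrite bx by_.
Qed.

Lemma root_orbit : root \in orbits phi.
Proof. by case: pre => _ _ _ [r ->]; exact: orb_in. Qed.

Lemma inner_faceP (A : {set D}) : reflect (exists2 h, h \notin root & A = orb phi h) (A \in inner_faces O).
Proof.
rewrite !inE; apply: (iffP andP) => [[nA /orbitsP[h E]]|[h nh ->]].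
  exists h => //; apply: contra nA => hr.
  by rewrite E -(orb_mem (phi_inj pre) root_orbit hr).
split; last exact: orb_in.
by apply: contraNneq nh => <-; rewrite mem_orb connect0.
Qed.

Lemma face_notin (A : {set D}) h : A \in inner_faces O -> h \in A -> h \notin root.
Proof.
move=> /setDP[Ao]; rewrite inE => nA hA; apply: contra nA => hr; apply/eqP.
by rewrite (orb_mem (phi_inj pre) Ao hA) -(orb_mem (phi_inj pre) root_orbit hr).
Qed.

Lemma corresp_faces : corresp (inner_faces O) (black_vertices KM)
  (fun f => #|f|) (fun v => #|v|).
Proof.
exists (liftF true); split.
- move=> A B Af Bf E.
  by rewrite -(under_liftF (b := true) (A := A)) ?E ?under_liftF // => h; exact: face_notin.
- apply/setP=> V; apply/imsetP/setIdP => [[A /inner_faceP[h nh ->] ->]|[/orbitsP[x ->]]].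
    have [x Ex] := @inX (inr h) nh; have bx : mblack KM x by rewrite black_val Ex.
    rewrite -(under_r Ex) -orb_black //; split; first exact: orb_in.
    by apply/existsP; exists x; rewrite mem_orb connect0.
  case/existsP=> y /andP[]; rewrite mem_orb => xy by_.
  have bx : mblack KM x by rewrite (fconnect_inv kblack_sigma xy).
  exists (orb phi (under x)); last by rewrite orb_black.
  apply/inner_faceP; exists (under x) => //.
  by move: bx; rewrite black_val; case: (val_cases x) => -[-> H].
- move=> A Af; rewrite -[in RHS](under_liftF (b := true) (A := A)); last first.
    by move=> h; exact: face_notin.
  by rewrite card_in_imset //; exact: under_inj_in.
Qed.

Definition Kvertices : {set {set D}} := [set v in orbits s | [exists k in v, K k]].

Lemma Kvertex_in (A : {set D}) h : A \in Kvertices -> h \in A -> ing h -> K h.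
Proof.
rewrite inE => /andP[Ao /existsP[k /andP[kA Kk]]] hA ih; apply: (kg_sat kg Kk ih).
by rewrite -mem_orb -(orb_mem s_inj Ao kA).
Qed.

Lemma liftV_eq (A : {set D}) : A \in Kvertices -> under @: liftF false A = [set h in A | K h].
Proof.
move=> Av; rewrite -[RHS](under_liftF (b := false)); last by move=> h; rewrite inE => /andP[].
suff -> : liftF false A = liftF false [set h in A | K h] by [].
apply/setP=> x; rewrite !inE.
by case B : (mblack KM x) => //=; rewrite white_K ?andbT //; exact: negbT.
Qed.

Lemma corresp_vertices : corresp Kvertices (white_vertices KM)
  (@bvertex_weight O) (mvertex_weight (T := KM)).
Proof.
have KV A : A \in Kvertices -> exists2 k, K k & A = orb s k.
  by rewrite inE => /andP[Ao /existsP[k /andP[kA Kk]]]; exists k => //; exact: orb_mem.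
exists (liftF false); split.
- move=> A B Av Bv E; have [k Kk EA] := KV _ Av.
  have : k \in [set h in B | K h].
    by rewrite -liftV_eq // -E liftV_eq // inE Kk EA mem_orb connect0.
  rewrite inE EA => /andP[kB _]; apply/esym; apply: orb_mem kB => //.
  by move: Bv; rewrite inE => /andP[].
- apply/setP=> V; apply/imsetP/setIdP => [[A /KV[k Kk ->] ->]|[/orbitsP[x ->]]].
    have [x Ex] := @inX (inl k) Kk; have wx : ~~ mblack KM x by rewrite black_val Ex.
    rewrite -(under_l Ex) -orb_white //; split; first exact: orb_in.
    by apply/existsP; exists x; rewrite mem_orb connect0.
  case/existsP=> y /andP[]; rewrite mem_orb => xy wy.
  have wx : ~~ mblack KM x by rewrite (fconnect_inv kblack_sigma xy).
  exists (orb s (under x)); last by rewrite orb_white.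
  rewrite inE orb_in /=; apply/existsP; exists (under x).
  by rewrite mem_orb connect0 white_K.
move=> A Av; rewrite /bvertex_weight /mvertex_weight.
rewrite (eq_bigl (fun x => x \in liftF false A)); last first.
  move=> x /=; rewrite inE; case B : (mblack KM x) => //=.
  by rewrite white_nbud ?andbT //; exact: negbT.
rewrite (eq_bigr (fun x => w (under x))); last first.
  move=> x; rewrite inE => /andP[/eqP B _]; have nb := white_nbud (negbT B).
  rewrite /mw /= /t_weight -[t_alpha _ _]/(ma KM x) (negPf nb).
  by move: B; rewrite black_val; case: (val_cases x) => -[Ex _]; rewrite Ex.
rewrite -(big_imset w (under_inj_in (b := false) (A := A))) /= liftV_eq //.
apply: eq_bigl => h; rewrite inE; case hA : (h \in A) => //=.
by apply/idP/idP=> [/(kg_in kg)|/(Kvertex_in Av hA)].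
Qed.

(** The edges that survive in the opening: those with a kept ingoing dart and the 0-way edges. *)
Definition Kedges : {set {set D}} :=
  [set e in bedges O | [exists h in e, K h] || [forall h in e, ~~ ing h]].

Definition liftE (A : {set D}) : {set X} := [set x | (under x \in A) && (ma KM x != x)].

Lemma under_alpha (x : X) : (under (ma KM x) == under x) || (under (ma KM x) == a (under x)).
Proof.
rewrite {1 3}/under val_alpha; case: (val_cases x) => -[-> _] /=; first by case: ifP; rewrite eqxx ?orbT.
by case: ifP => _; [|case: ifP => _]; rewrite eqxx ?orbT.
Qed.

Lemma pair_mem x y z : (y \in [set x; a x]) -> (z \in [set x; a x]) = (z \in [set y; a y]).
Proof. by rewrite !inE => /orP[] /eqP ->; rewrite ?aK //; rewrite orbC. Qed.

Lemma same_edge_l (x y : X) : ~~ mblack KM x -> ma KM y != y ->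
  under y \in [set under x; a (under x)] -> y = x \/ y = ma KM x.
Proof.
move=> wx nb; have Kx := white_K wx; set h := under x in Kx *.
have ih := kg_in kg Kx.
have Ex : val x = inl h by move: wx; rewrite black_val /h; case: (val_cases x) => -[->].
have Eax : val (ma KM x) = if ing (a h) then inl (a h) else inr h by rewrite val_alpha Ex.
rewrite !inE; case By : (mblack KM y).
  have [na nK] := black_nbud nb By; have Ey : val y = inr (under y).
    by move: By; rewrite black_val; case: (val_cases y) => -[->].
  case/orP=> /eqP E; rewrite E ?aK in na; last by rewrite ih in na.
  by right; apply: val_inj; rewrite Eax (negPf na) Ey E.
have Ky := white_K (negbT By); have Ey : val y = inl (under y).
  by move: By; rewrite black_val; case: (val_cases y) => -[->].
case/orP=> /eqP E; [left|right]; apply: val_inj; first by rewrite Ey Ex E.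
by rewrite Eax Ey E (kg_in kg) // -E.
Qed.

Lemma same_edge (x : X) : ma KM x != x -> liftE [set under x; a (under x)] = [set x; ma KM x].
Proof.
move=> nb; have nba : ma KM (ma KM x) != ma KM x by rewrite kalphaK eq_sym.
apply/setP=> y; rewrite inE; apply/andP/idP => [[yA nby]|]; last first.
  by case/set2P=> ->; split=> //; rewrite !inE ?eqxx //; exact: under_alpha.
rewrite !inE; case Bx : (mblack KM x); last first.
  by case: (same_edge_l (negbT Bx) nby yA) => ->; rewrite eqxx ?orbT.
case Bax : (mblack KM (ma KM x)); last first.
  have yA' : under y \in [set under (ma KM x); a (under (ma KM x))].
    by rewrite -(@pair_mem (under x)) // !inE under_alpha.
  by case: (same_edge_l (negbT Bax) nby yA') => ->; rewrite ?kalphaK eqxx ?orbT.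
case By : (mblack KM y); last first.
  have xA : under x \in [set under y; a (under y)] by rewrite -(pair_mem _ yA) !inE eqxx.
  by case: (same_edge_l (negbT By) nb xA) => ->; rewrite ?kalphaK eqxx ?orbT.
have [na nK] := black_nbud nb Bx; have [nay nKy] := black_nbud nby By.
have Ex : val x = inr (under x) by move: Bx; rewrite black_val; case: (val_cases x) => -[->].
have Ey : val y = inr (under y) by move: By; rewrite black_val; case: (val_cases y) => -[->].
move: yA; rewrite !inE => /orP[] /eqP E.
  by apply/orP; left; rewrite -(inj_eq val_inj) Ex Ey E.
apply/orP; right; rewrite -(inj_eq val_inj) val_alpha Ex Ey E /=.
by move: nay; rewrite E aK => nx; rewrite na nx andbT ifN //; apply: contra nx; exact: kg_in.
Qed.

Lemma KedgeP (A : {set D}) : A \in Kedges -> exists2 x : X, ma KM x != x & A = [set under x; a (under x)].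
Proof.
rewrite inE => /andP[/imsetP[h _ E]].
have sub k : k \in A -> A = [set k; a k].
  by move=> kA; apply/setP=> z; rewrite -(@pair_mem h) -?E.
case/orP=> [/existsP[k /andP[kA Kk]]|/forallP H].
  have [x Ex] := @inX (inl k) Kk; exists x; last by rewrite (under_l Ex); exact: sub.
  by apply: white_nbud; rewrite black_val Ex.
have nh : ~~ ing h by have := H h; rewrite E !inE eqxx.
have nah : ~~ ing (a h) by have := H (a h); rewrite E !inE eqxx orbT.
have [x Ex] := @inX (inr h) (out_a nah); exists x; last by rewrite (under_r Ex) E.
by rewrite (bud_val Ex) (negPf nah) (negPf nh).
Qed.

Lemma corresp_edges : corresp Kedges (medges KM) (@bedge_weight O) (medge_weight (T := KM)).
Proof.
exists liftE; split.
- move=> A B /KedgeP[x nx ->] /KedgeP[y ny ->]; rewrite !same_edge // => E.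
  have : x \in [set y; ma KM y] by rewrite -E !inE eqxx.
  rewrite -same_edge // inE => /andP[H _].
  by apply/setP=> z; rewrite (pair_mem _ H).
- apply/setP=> V; apply/imsetP/imsetP => [[A /KedgeP[x nx ->] ->]|[x]].
    by exists x; rewrite ?inE // same_edge.
  rewrite inE => nx ->; exists [set under x; a (under x)]; last by rewrite same_edge.
  rewrite inE; apply/andP; split; first by apply/imsetP; exists (under x).
  case Bx : (mblack KM x); last first.
    by apply/orP; left; apply/existsP; exists (under x); rewrite !inE eqxx white_K ?Bx.
  have [na nK] := black_nbud nx Bx; case ix : (ing (under x)).
    by apply/orP; left; apply/existsP; exists (under x); rewrite !inE eqxx nK.
  apply/orP; right; apply/forallP=> z; apply/implyP; rewrite !inE => /orP[] /eqP -> //.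
  by rewrite ix.
- move=> A /KedgeP[x nx ->]; rewrite same_edge // /medge_weight /bedge_weight.
  have nax : ma KM (ma KM x) != ma KM x by rewrite kalphaK eq_sym.
  rewrite !big_setU1 ?inE 1?eq_sym ?nx ?a_neq //= !big_set1.
  rewrite /t_weight -![t_alpha _ _]/(ma KM _) (negPf nx) (negPf nax).
  rewrite val_alpha; case: (val_cases x) => -[Ex _]; rewrite Ex /=.
    by case: ifP.
  have := nx; rewrite (bud_val Ex) negb_or => /andP[na nK].
  rewrite (negPf na) /=; case Kx : (K (under x)) => /=; first by rewrite addnC.
  have nix : ~~ ing (under x) by move: nK; rewrite Kx andbT.
  by rewrite nix /= aK addnC.
Qed.

Lemma corresp_card (T1 T2 : finType) (A : {set {set T1}}) (B : {set {set T2}}) m1 m2 :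
  corresp A B m1 m2 -> #|A| = #|B|.
Proof. by case=> f [fi <- _]; rewrite card_in_imset. Qed.

Lemma kmobile_Nmobile : is_Nbio O -> (forall x y, connect (sa_rel s a) x y) ->
  (#|Kvertices| + #|inner_faces O| = #|Kedges| + 1)%N -> is_Nmobile KM.
Proof.
move=> wO conn tree; split; split.
- exact: ksigma_inj.
- exact: kalphaK.
- exact: kblack_sigma.
- exact: kblack_bud.
- exact: kmobile_connected.
- rewrite card_orbits_bw; [|exact: kblack_sigma].
  rewrite -(corresp_card corresp_vertices) -(corresp_card corresp_faces).
  by rewrite -(corresp_card corresp_edges).
- move=> x nb; rewrite /mw /= /t_weight -[t_alpha _ _]/(ma KM x) (negPf nb).
  case Bx : (mblack KM x).
    have [na nK] := black_nbud nb Bx; split; last by rewrite -[t_black x]/(mblack KM x) Bx.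
    move=> _.
    move: Bx; rewrite black_val; case: (val_cases x) => -[Ex _]; rewrite Ex //= => _.
    by case: (wO (a (under x))) => _; apply.
  have Kx := white_K (negbT Bx); split; first by rewrite -[t_black x]/(mblack KM x) Bx.
  move=> _.
  move: Bx; rewrite black_val; case: (val_cases x) => -[Ex _]; rewrite Ex //= => _.
  by case: (wO (under x)) => + _; apply; exact: kg_in Kx.
- move=> x /eqP bx; rewrite /mw /= /t_weight -[t_alpha _ _]/(ma KM x) bx.
  by [].
Qed.

Lemma kmobile_white : #|[set x | ~~ mblack KM x]| = #|[set h | K h]|.
Proof.
have -> : [set x | ~~ mblack KM x] = liftF false [set h | K h].
  apply/setP=> x; rewrite !inE; case Bx : (mblack KM x) => //=.
  by rewrite white_K //; exact: negbT.
rewrite -(card_in_imset (under_inj_in (b := false) (A := [set h | K h]))).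
by rewrite under_liftF // => h; rewrite inE.
Qed.

Definition bud_corners : {set D} :=
  [set h | (h \notin root) && (ing (a h) || ing h && ~~ K h)].

Lemma kmobile_buds : #|mbuds KM| = #|bud_corners|.
Proof.
have -> : mbuds KM = liftF true bud_corners.
  apply/setP=> x; rewrite !inE; case Bx : (mblack KM x); last first.
    by rewrite (negPf (white_nbud (negbT Bx))).
  move: Bx; rewrite black_val; case: (val_cases x) => -[Ex nr]; rewrite Ex //= => _.
  by rewrite (bud_val Ex) nr.
rewrite -(card_in_imset (under_inj_in (b := true) (A := bud_corners))).
by rewrite under_liftF // => h; rewrite inE => /andP[].
Qed.

Lemma kmobile_excess : excess KM = (#|[set h | K h]|%:Z - #|bud_corners|%:Z)%R.
Proof.
by rewrite excess_card ?kmobile_white ?kmobile_buds //; [exact: kalphaK|exact: kblack_bud].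
Qed.

End Correspondences.
End KMobile.

(** * The instances for Phi_+ and Phi_- *)

Section Instances.
Variable O : bio.
Local Notation D := (bD O).
Local Notation s := (bs O).
Local Notation a := (ba O).
Local Notation ing := (bing O).
Local Notation root := (broot O).
Local Notation phi := (@bphi O).
Local Notation phiV := (@phiV O).

Definition Kminus : pred D := fun h => @ing_rev O h && ~~ @outer_vertex O h.

Lemma Phi_plusE : Phi_plus O = KM ing ing.
Proof. by []. Qed.

Lemma Phi_minusE : Phi_minus O = KM (@ing_rev O) Kminus.
Proof. by []. Qed.

Section Premap.
Hypothesis pre : premap O.
Hypothesis rin : root_in O.
Hypothesis vin : vertex_in O.
Let s_inj : injective s. Proof. by case: pre. Qed.
Let aK : involutive a. Proof. by case: pre. Qed.
Let a_inj : injective a := can_inj aK.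

Lemma kgood_plus : kgood ing ing.
Proof. by split=> // [h -> //|p q -> //]. Qed.

Lemma Kvertices_plus : Kvertices ing = bvertices O.
Proof.
apply/setP=> v; rewrite !inE; case: orbitsP => //= -[x ->]; apply/existsP.
by have [y xy iy] := vin x; exists y; rewrite mem_orb xy.
Qed.

Lemma Kedges_plus : Kedges ing = bedges O.
Proof.
apply/setP=> e; rewrite !inE; case: (e \in bedges O) => //=.
rewrite -[[exists _ in _, _]]negbK negb_exists_in orNb //.
Qed.

Lemma card_ing_a : #|[set h | ing (a h)]| = #|[set h | ing h]|.
Proof.
rewrite -(card_imset (mem [set h | ing (a h)]) a_inj); apply: eq_card => h.
apply/imsetP/idP => [[k kk ->]|hh]; first by move: kk; rewrite !inE.
by exists (a h); rewrite ?aK // inE aK; move: hh; rewrite inE.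
Qed.

(** Every ingoing dart [a h] yields a bud at the corner [h], except at the root corners, whose buds
    are deleted. The excess is therefore the number of root corners. *)
Lemma card_bud_plus : (#|bud_corners ing| + #|root| = #|[set h | ing h]|)%N.
Proof.
rewrite -card_ing_a -(cardsID root [set h | ing (a h)]) addnC; congr (_ + _)%N.
  apply: eq_card => h; rewrite !inE; case hr : (h \in root); rewrite ?andbF //=.
  by rewrite rin.
by apply: eq_card => h; rewrite !inE andbN orbF.
Qed.

Lemma excess_plus : excess (Phi_plus O) = Posz (outer_degree O).
Proof.
rewrite Phi_plusE (kmobile_excess pre rin kgood_plus) -card_bud_plus /outer_degree; lia.
Qed.

Lemma card_inner_faces : #|orbits phi| = #|inner_faces O|.+1.
Proof. by rewrite (cardsD1 root) root_orbit. Qed.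

Section Admissible.
Hypothesis adm : admissible O.

Let adm_simple x y : x \in root -> y \in root -> fconnect s x y -> x = y.
Proof. by case: adm => H _ _ _; exact: H. Qed.
Let adm_a x : x \in root -> a x \notin root.
Proof. by case: adm => _ H _ _; exact: H. Qed.
Let adm_out x : x \in root -> ~~ ing x.
Proof.
move=> xr; case: adm => _ _ _ /(_ x (or_introl xr)); have := rin xr.
by case=> + []; [move=> -> [_ []]|move=> _ [_ []]].
Qed.

(** The dart preceding a root corner [y] is ingoing and belongs to a contour edge; indegree 1 makes
    it the only ingoing dart at that vertex. *)
Lemma outer_ing h y : ing h -> y \in root -> fconnect s h y -> a h \in root.
Proof.
move=> ih yr hy; case: adm => _ _ /(_ y yr)/eqP/cards1P[z Ez] _.
have zh : h = z by apply/eqP; rewrite -in_set1 -Ez inE ih fcsym // hy.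
have : finv s y = z.
  by apply/eqP; rewrite -in_set1 -Ez inE fconnect_finv (root_finv pre rin yr).
by rewrite -zh => <-; rewrite -/(phiV y) root_phiV.
Qed.

Lemma outer_vertexP h : reflect (exists2 y, y \in root & fconnect s h y) (@outer_vertex O h).
Proof. exact: (iffP exists_inP). Qed.

Lemma outer_a h : a h \in root -> @outer_vertex O h.
Proof.
move=> ar; apply/outer_vertexP; exists (s h); last exact: fconnect1.
by move: ar; rewrite -(root_phi pre) /bphi aK.
Qed.

Lemma outer_root h : h \in root -> @outer_vertex O h.
Proof. by move=> hr; apply/outer_vertexP; exists h. Qed.

Lemma inner_rev h : ~~ @outer_vertex O h -> @ing_rev O h = ing h.
Proof.
move=> nv; rewrite /ing_rev; case: ifP => // /orP[/outer_root|/outer_a] H; by rewrite H in nv.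
Qed.

Lemma KminusE h : Kminus h = ing h && ~~ @outer_vertex O h.
Proof. by rewrite /Kminus; case: (boolP (outer_vertex h)) => [|/inner_rev->]; rewrite ?andbF. Qed.

Lemma ing_outer h : ing h -> @outer_vertex O h = (a h \in root).
Proof.
move=> ih; apply/idP/idP => [/outer_vertexP[y yr hy]|]; last exact: outer_a.
exact: outer_ing hy.
Qed.

Lemma KminusE2 h : Kminus h = ing h && (a h \notin root).
Proof. by rewrite KminusE; case ih : (ing h) => //=; rewrite ing_outer. Qed.

Lemma outer_vertex_conn h k : fconnect s h k -> @outer_vertex O h = @outer_vertex O k.
Proof.
move=> hk; apply/outer_vertexP/outer_vertexP => -[y yr H]; exists y => //.
  by rewrite -(same_connect (fconnect_sym s_inj) hk).
by rewrite (same_connect (fconnect_sym s_inj) hk).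
Qed.

Lemma ing_not_root h : ing h -> h \notin root.
Proof. by move=> ih; apply/negP=> /adm_out; rewrite ih. Qed.

(** The reversal only affects darts at outer vertices, where the single ingoing dart comes from the
    contour. A contour edge has exactly one ingoing dart, so it is 1-way before and after the
    reversal. *)
Lemma kgood_minus : kgood (@ing_rev O) Kminus.
Proof.
have Kin h : Kminus h -> ing h by rewrite KminusE => /andP[].
have inner_e h : h \notin root -> a h \notin root -> @ing_rev O h = ing h.
  by move=> h1 h2; rewrite /ing_rev (negPf h1) (negPf h2).
split=> //.
- move=> h ih; rewrite KminusE2 ih /= negbK => ar; split=> //.
  exact: adm_out.
- move=> h k; rewrite !KminusE => /andP[_ nv] -> hk /=.
  by rewrite -(outer_vertex_conn hk).
- move=> h; rewrite !KminusE2 aK => /andP[ih ar] -> /=; exact: ing_not_root.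
- move=> p q ip; rewrite KminusE ip /= negbK => /outer_vertexP[y yr py] iq pq.
  case: adm => _ _ /(_ y yr)/eqP/cards1P[z Ez] _.
  have H u : ing u -> fconnect s p u -> u = z.
    move=> iu pu; apply/eqP; rewrite -in_set1 -Ez inE iu andbT.
    by rewrite -(same_connect (fconnect_sym s_inj) py).
  by rewrite (H q iq pq) (H p ip (connect0 _ _)).
- move=> h y; rewrite KminusE => /andP[ih nv] hy; apply: inner_rev.
  by rewrite -(outer_vertex_conn hy).
- move=> h; rewrite KminusE2 => /andP[ih ar]; apply: inner_e => //.
  by rewrite aK; exact: ing_not_root.
- move=> h nr; rewrite KminusE2; case ar : (a h \in root).
    have ih : ing h by rewrite -(aK h); exact: rin.
    by rewrite /ing_rev ar orbT ih andbF.
  by rewrite !inner_e ?aK ?ar // andbT.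
- move=> h nr; case ar : (a h \in root).
    have ih : ing h by rewrite -(aK h); exact: rin.
    by rewrite /ing_rev aK ar orbT /= ih (negPf (adm_out ar)).
  by rewrite !inner_e ?aK ?ar.
Qed.

Lemma Kvertices_minus : Kvertices Kminus = inner_vertices O.
Proof.
apply/setP=> v; rewrite !inE; case: orbitsP => //= -[x ->].
apply/existsP/idP => [[k /andP[]]|dis].
  rewrite mem_orb KminusE => xk /andP[_ nv]; apply/pred0P=> y /=; apply/negP=> /andP[].
  rewrite mem_orb => xy yr; case/negP: nv; apply/outer_vertexP; exists y => //.
  by rewrite -(same_connect (fconnect_sym s_inj) xk).
have [y xy iy] := vin x; exists y; rewrite mem_orb xy KminusE iy /=.
apply/outer_vertexP=> -[z zr yz]; have /pred0P/(_ z) := dis.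
by rewrite /= mem_orb zr (connect_trans xy yz).
Qed.

Lemma Kedges_minus : Kedges Kminus = inner_edges O.
Proof.
apply/setP=> e; rewrite !inE; case ee : (e \in bedges O) => //=.
have sub k : k \in e -> e = [set k; a k].
  by case/imsetP: ee => h _ -> kA; apply/setP=> z; rewrite (pair_mem pre _ kA).
apply/idP/idP.
  case/orP=> [/existsP[k /andP[/sub ->]]|/forallP H].
    rewrite KminusE2 => /andP[ik ar]; apply/pred0P=> y /=; apply/negP=> /andP[/set2P[]->].
      by rewrite (negPf (ing_not_root ik)).
    by rewrite (negPf ar).
  apply/pred0P=> y /=; apply/negP=> /andP[ye yr].
  by have := H (a y); rewrite (sub _ ye) set22 rin.
move=> dis; case: (boolP [exists k in e, ing k]) => [/exists_inP[k ke ik]|H].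
  apply/orP; left; apply/existsP; exists k; rewrite ke KminusE2 ik /=; apply/negP=> ar.
  by have /pred0P/(_ (a k)) := dis; rewrite /= ar (sub _ ke) set22.
by apply/orP; right; rewrite negb_exists_in in H.
Qed.

Lemma card_inner_vertices : (#|inner_vertices O| + #|root| = #|orbits s|)%N.
Proof.
have -> : #|root| = #|orbits s :\: inner_vertices O|.
  rewrite -(card_in_imset (f := orb s)); last first.
    by move=> x y xr yr /(orb_eqP s_inj) xy; exact: adm_simple.
  apply: eq_card => v; rewrite !inE; apply/imsetP/idP => [[x xr ->]|].
    rewrite orb_in /= andbT; apply/negP=> /pred0P/(_ x).
    by rewrite /= mem_orb connect0 xr.
  case: orbitsP => //= -[x ->]; rewrite andbT => /pred0Pn[y /= /andP[]].
  rewrite mem_orb => xy yr; exists y => //; exact/(orb_eqP s_inj).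
rewrite -(cardsID (inner_vertices O) (orbits s)); congr (_ + _)%N.
by apply: eq_card => v; rewrite !inE; case: (v \in orbits s).
Qed.

Lemma card_inner_edges : (#|inner_edges O| + #|root| = #|bedges O|)%N.
Proof.
have -> : #|root| = #|bedges O :\: inner_edges O|.
  rewrite -(card_in_imset (f := fun x => [set x; a x])); last first.
    move=> x y xr yr E; have := set21 x (a x); rewrite E => /set2P[//|Ex].
    by have := adm_a yr; rewrite -Ex xr.
  apply: eq_card => e; rewrite !inE; apply/imsetP/idP => [[x xr ->]|].
    have -> : [set x; a x] \in bedges O by apply/imsetP; exists x.
    rewrite andbT; apply/negP=> /pred0P/(_ x).
    by rewrite /= set21 xr.
  case ee : (e \in bedges O) => //=; rewrite andbT => /pred0Pn[y /= /andP[ye yr]].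
  exists y => //; case/imsetP: ee ye => h _ -> kA; apply/setP=> z.
  by rewrite (pair_mem pre _ kA).
rewrite -(cardsID (inner_edges O) (bedges O)); congr (_ + _)%N.
by apply: eq_card => v; rewrite !inE; case: (v \in bedges O).
Qed.

Lemma card_aroot : #|a @: root| = #|root|.
Proof. exact: card_imset. Qed.

Lemma mem_aroot h : (h \in a @: root) = (a h \in root).
Proof. by rewrite -{1}(aK h) (mem_imset _ _ a_inj). Qed.

Lemma card_Kminus : (#|[set h | Kminus h]| + #|root| = #|[set h | ing h]|)%N.
Proof.
rewrite -card_aroot -[RHS](cardsID (a @: root)) addnC; congr (_ + _)%N; apply: eq_card => h.
  rewrite !inE mem_aroot; case ar : (a h \in root); rewrite ?andbF //= andbT.
  by rewrite -(aK h) rin.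
by rewrite !inE mem_aroot KminusE2 andbC.
Qed.

(** The buds created on the inner side of the contour edges make up for those deleted at the root
    corners. *)
Lemma card_bud_minus : #|bud_corners Kminus| = #|[set h | ing h]|.
Proof.
rewrite -card_ing_a -(cardsID (a @: root)) -[RHS](cardsID root).
have H h : a h \in root -> ing h && ~~ ing (a h) && (h \notin root).
  move=> ar; have ih : ing h by rewrite -(aK h); exact: rin.
  by rewrite ih adm_out // ing_not_root.
congr (_ + _)%N; last first.
  apply: eq_card => h; rewrite !inE mem_aroot KminusE2.
  case ar : (a h \in root) => /=; first by have /andP[/andP[_ /negPf->]] := H _ ar; rewrite andbF.
  by rewrite andbT andbN orbF.
have -> : #|[set h | ing (a h)] :&: root| = #|a @: root|.
  rewrite card_aroot; apply: eq_card => h; rewrite !inE andbC.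
  by case hr : (h \in root) => //=; rewrite rin.
apply: eq_card => h; rewrite !inE mem_aroot KminusE2 andbC.
case ar : (a h \in root) => //=.
by have /andP[/andP[-> _] ->] := H _ ar; rewrite orbT.
Qed.

Lemma excess_minus : excess (Phi_minus O) = (- Posz (outer_degree O))%R.
Proof.
rewrite Phi_minusE (kmobile_excess pre rin kgood_minus) card_bud_minus -card_Kminus.
rewrite /outer_degree; lia.
Qed.

End Admissible.
End Premap.

Section Rooted.
Hypothesis wO : is_Nbio O.
Hypothesis OB : inB O.

Let planar : is_rooted_map O. Proof. by case: OB. Qed.
Lemma inB_pre : premap O. Proof. exact: rooted_premap planar. Qed.
Lemma inB_rin : root_in O. Proof. by case: OB => _ /clockwise_root_in. Qed.
Lemma inB_conn : forall x y, connect (sa_rel s a) x y. Proof. exact: rooted_conn planar. Qed.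
Lemma inB_vin : vertex_in O.
Proof. by case: OB => _ _ acc; exact: accessible_vertex_in inB_pre inB_rin acc. Qed.
Lemma inB_reach : reaches_root O.
Proof.
case: OB => _ [mini _] acc.
exact: (minimal_reaches_root inB_pre inB_conn mini inB_rin acc planar).
Qed.

Let euler : (#|orbits s| + #|orbits phi| = #|bedges O| + 2)%N.
Proof. by case: planar => _ []. Qed.

Lemma mobile_plus : is_Nmobile (Phi_plus O).
Proof.
apply: (kmobile_Nmobile inB_pre inB_rin kgood_plus inB_reach wO inB_conn).
rewrite Kvertices_plus ?Kedges_plus; last exact: inB_vin.
by have := euler; rewrite card_inner_faces /bvertices; [lia|exact: inB_pre].
Qed.

Lemma mobile_minus : admissible O -> is_Nmobile (Phi_minus O).
Proof.
move=> adm; have kg := kgood_minus inB_pre inB_rin adm.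
apply: (kmobile_Nmobile inB_pre inB_rin kg inB_reach wO inB_conn).
rewrite (Kvertices_minus inB_pre inB_vin) (Kedges_minus inB_pre inB_rin adm).
have := euler; rewrite (card_inner_faces inB_pre).
have := card_inner_vertices inB_pre adm; have := card_inner_edges inB_pre adm.
lia.
Qed.

Lemma outer_degree_gt0 : (0 < outer_degree O)%N.
Proof. by have [r rr] := root_ex inB_pre; apply/card_gt0P; exists r. Qed.

Theorem Phi_plus_mobile :
  [/\ is_Nmobile (Phi_plus O), (0 < excess (Phi_plus O))%R &
      excess (Phi_plus O) = Posz (outer_degree O)] /\
  [/\ corresp (inner_faces O) (black_vertices (Phi_plus O)) (fun f => #|f|) (fun v => #|v|),
      corresp (bvertices O) (white_vertices (Phi_plus O))
              (@bvertex_weight O) (mvertex_weight (T:=Phi_plus O))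
    & corresp (bedges O) (medges (Phi_plus O))
              (@bedge_weight O) (medge_weight (T:=Phi_plus O))].
Proof.
have ex := excess_plus inB_pre inB_rin; split; split=> //.
- exact: mobile_plus.
- by rewrite ex ltz_nat outer_degree_gt0.
- exact: (corresp_faces inB_pre kgood_plus).
- rewrite -(Kvertices_plus inB_vin); exact: (corresp_vertices inB_pre inB_rin kgood_plus).
- rewrite -Kedges_plus; exact: (corresp_edges inB_pre inB_rin kgood_plus).
Qed.

Theorem Phi_minus_mobile : admissible O ->
  [/\ is_Nmobile (Phi_minus O), (excess (Phi_minus O) < 0)%R &
      excess (Phi_minus O) = (- Posz (outer_degree O))%R] /\
  [/\ corresp (inner_faces O) (black_vertices (Phi_minus O)) (fun f => #|f|) (fun v => #|v|),
      corresp (inner_vertices O) (white_vertices (Phi_minus O))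
              (@bvertex_weight O) (mvertex_weight (T:=Phi_minus O))
    & corresp (inner_edges O) (medges (Phi_minus O))
              (@bedge_weight O) (medge_weight (T:=Phi_minus O))].
Proof.
move=> adm; have kg := kgood_minus inB_pre inB_rin adm.
have ex := excess_minus inB_pre inB_rin adm; split; split=> //.
- exact: mobile_minus.
- by rewrite ex oppr_lt0 ltz_nat outer_degree_gt0.
- exact: (corresp_faces inB_pre kg).
- rewrite -(Kvertices_minus inB_pre inB_vin).
  exact: (corresp_vertices inB_pre inB_rin kg).
- rewrite -(Kedges_minus inB_pre inB_rin adm); exact: (corresp_edges inB_pre inB_rin kg).
Qed.
End Rooted.
End Instances.

(** * Reconstructing the biorientation from its mobile *)

(** [kc_case] excludes that unmatched white half-edges and unmatched buds coexist: either no ingoing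
    dart is discarded, or no kept dart is opposite to a root corner. *)
Record kcontext (O : bio) (ing' K : pred (bD O)) : Prop := KContext {
  kc_pre : premap O;
  kc_rin : root_in O;
  kc_vin : vertex_in O;
  kc_good : kgood ing' K;
  kc_reach : reaches_root O;
  kc_case : (forall h, bing O h -> K h) \/ (forall h, K h -> ba O h \notin broot O);
  kc_Nbio : is_Nbio O;
  kc_one : forall h, bing O h -> ~~ K h -> bw O h = 1
}.

Section ContextFacts.
Variables (O : bio) (ing' K : pred (bD O)).
Hypothesis kc : kcontext ing' K.
Local Notation s := (bs O).
Local Notation a := (ba O).
Local Notation ing := (bing O).
Local Notation root := (broot O).
Local Notation T := (KM ing' K).
Local Notation mtch := (mtc (@contour T) (@step T)).
Let pre := kc_pre kc.
Let rin := kc_rin kc.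
Let kg := kc_good kc.
Let reach := kc_reach kc.

Lemma ctx_aK : involutive a. Proof. by case: pre. Qed.
Lemma ctx_sinj : injective s. Proof. by case: pre. Qed.
Let aK := ctx_aK.

Lemma ctx_contour_inj : injective (@contour T).
Proof. by apply: contour_inj; [exact: kalphaK|exact: ksigma_inj]. Qed.

Lemma ctx_alpha (x : mD T) : val (ma T x) = kalpha K (val x).
Proof. exact: val_alpha. Qed.

Lemma ctx_sigma (x : mD T) : val (ms T x) = ksigma (val x).
Proof. exact: val_sigma. Qed.

Lemma ctx_match k (x u : mD T) : K k -> a k \notin root ->
  val x = inl k -> val u = inr (a k) -> mtch x u.
Proof. exact: match_bud. Qed.

Lemma white_val (x : mD T) : ~~ mblack T x -> val x = inl (under x) /\ K (under x).
Proof. by rewrite black_val; case: (val_cases x) => -[-> //]. Qed.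

Lemma black_valr (x : mD T) : mblack T x -> val x = inr (under x) /\ under x \notin root.
Proof. by rewrite black_val; case: (val_cases x) => -[-> //]. Qed.

(** Suppose [a k] is a root corner. The bud closing [k] cannot face an ingoing dart, being already
    matched with it; it would thus come from a discarded dart, which [kc_case] excludes in the
    presence of such a [k]. *)
Lemma ctx_match_inv (x u : mD T) : mtch x u ->
  exists k, [/\ K k, a k \notin root, val x = inl k & val u = inr (a k)].
Proof.
move=> mxu; have [/eqP] := mxu; rewrite step_open => /white_val[Ex Kx] _.
exists (under x); set k := under x in Ex Kx *.
case ar : (a k \in root); last first.
  have [v Ev] := @inX O ing' K (inr (a k)) (negbT ar).
  have mxv : mtch x v by apply: ctx_match Ev; rewrite ?ar.
  by rewrite (mtc_fun mxu mxv).
have /eqP := mtc_close (@step_val T) mxu.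
rewrite step_close => /andP[/black_valr[Eu nr] bu]; set h := under u in Eu nr.
move: bu; rewrite (bud_val pre rin kg Eu); case iah : (ing (a h)) => /=.
  have Kah : K (a h) by apply: (K_of_ing kg); rewrite ?aK.
  have [y Ey] := @inX O ing' K (inl (a h)) Kah.
  have myu : mtch y u by apply: (ctx_match (k := a h)) => //; rewrite aK.
  have E := mtc_inj ctx_contour_inj mxu myu.
  move: Ey; rewrite -E Ex => -[Ek]; move: ar; rewrite Ek aK => hr.
  by rewrite hr in nr.
case: (kc_case kc) => [H /andP[/H ->//]|/(_ _ Kx)]; by rewrite ar.
Qed.

Lemma ctx_unmatched (x u : mD T) h : ing h -> ~~ K h -> val u = inr h -> ~ mtch x u.
Proof.
move=> ih nK Eu /ctx_match_inv[k [Kk _ _ Eu']]; move: Eu'; rewrite Eu => -[Eh].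
have [_] := kg_out kg ih nK; rewrite Eh aK; by rewrite (kg_in kg Kk).
Qed.

End ContextFacts.

Section IsoMatching.
Variables (T1 T2 : mob) (f : mD T1 -> mD T2).
Hypothesis fi : injective f.
Hypothesis fs : forall x, f (ms T1 x) = ms T2 (f x).
Hypothesis fa : forall x, f (ma T1 x) = ma T2 (f x).
Hypothesis fb : forall x, mblack T2 (f x) = mblack T1 x.

Lemma iso_contour x : f (contour x) = contour (f x).
Proof. by rewrite /contour fa fs. Qed.

Lemma iso_step x : step (f x) = step x.
Proof. by rewrite /step fb -fa (inj_eq fi). Qed.

Lemma iso_contour_iter n x : f (iter n (@contour T1) x) = iter n (@contour T2) (f x).
Proof. by elim: n => [//|n IH]; rewrite !iterS iso_contour IH. Qed.

Lemma iso_height x n : height (@contour T2) (@step T2) (f x) n = height (@contour T1) (@step T1) x n.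
Proof. by apply: eq_bigr => i _; rewrite -iso_contour_iter iso_step. Qed.

Lemma iso_mtc x u : mtc (@contour T2) (@step T2) (f x) (f u) <-> mtc (@contour T1) (@step T1) x u.
Proof.
split=> -[ex [n [Eu n0 np]]].
  split; first by rewrite -iso_step.
  exists n; split; first by apply: fi; rewrite iso_contour_iter.
    by rewrite -iso_height.
  by move=> i /np; rewrite iso_height.
split; first by rewrite iso_step.
exists n; split; first by rewrite Eu iso_contour_iter.
  by rewrite iso_height.
by move=> i /np; rewrite iso_height.
Qed.
End IsoMatching.

Section Reconstruction.
Variables (O1 O2 : bio) (ing1' K1 : pred (bD O1)) (ing2' K2 : pred (bD O2)).
Hypotheses (c1 : kcontext ing1' K1) (c2 : kcontext ing2' K2).
Local Notation T1 := (KM ing1' K1).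
Local Notation T2 := (KM ing2' K2).
Variable f : mD T1 -> mD T2.
Hypothesis f_bij : bijective f.
Hypothesis fs : forall x, f (ms T1 x) = ms T2 (f x).
Hypothesis fa : forall x, f (ma T1 x) = ma T2 (f x).
Hypothesis fb : forall x, mblack T2 (f x) = mblack T1 x.
Hypothesis fw : forall x, mw T2 (f x) = mw T1 x.
Variable d2 : bD O2.
Let fi := bij_inj f_bij.

Local Notation a1 := (ba O1).
Local Notation a2 := (ba O2).
Local Notation s1 := (bs O1).
Local Notation s2 := (bs O2).
Local Notation ing1 := (bing O1).
Local Notation ing2 := (bing O2).
Local Notation root1 := (broot O1).
Local Notation root2 := (broot O2).
Let a1K := ctx_aK c1.
Let a2K := ctx_aK c2.
Let kg1 := kc_good c1.
Let kg2 := kc_good c2.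
Let s1i := ctx_sinj c1.
Let s2i := ctx_sinj c2.

(** White half-edges take precedence over corners, so that the two darts of an edge with a kept dart
    are sent by the same half-edge; the agreement with corners is then a matter of matching. One of
    the four half-edges always exists, so the default [d2] is never returned. *)
Definition recon (h : bD O1) : bD O2 :=
  if insub (inl h) is Some x then under (f x) else
  if insub (inl (a1 h)) is Some x then a2 (under (f x)) else
  if insub (inr h) is Some x then under (f x) else
  if insub (inr (a1 h)) is Some x then a2 (under (f x)) else d2.
Local Notation g := recon.

Let f_white (x : mD T1) k : val x = inl k -> ~~ mblack T2 (f x).
Proof. by move=> Ex; rewrite fb black_val Ex. Qed.
Let f_black (x : mD T1) k : val x = inr k -> mblack T2 (f x).
Proof. by move=> Ex; rewrite fb black_val Ex. Qed.

Lemma recon_l (x : mD T1) k : val x = inl k -> val (f x) = inl (g k).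
Proof.
move=> Ex; rewrite /g -Ex valK.
by case: (white_val (f_white Ex)).
Qed.

Lemma recon_K k : K1 k -> K2 (g k).
Proof.
move=> Kk; have [x Ex] := @inX O1 ing1' K1 (inl k) Kk.
exact: val_l (recon_l Ex).
Qed.

Lemma insub_l (h : bD O1) : ~~ K1 h -> insub (inl h : bD O1 + bD O1) = None :> option (mD T1).
Proof. by move=> nK; rewrite insubN. Qed.

Lemma recon_r (x : mD T1) h : ~~ K1 h -> ~~ K1 (a1 h) -> val x = inr h -> val (f x) = inr (g h).
Proof.
move=> n1 n2 Ex; rewrite /g insub_l // insub_l // -Ex valK.
by case: (black_valr (f_black Ex)).
Qed.

Lemma recon_a1 h : K1 h \/ (~~ K1 h /\ ~~ K1 (a1 h)) /\ h \notin root1 -> g (a1 h) = a2 (g h).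
Proof.
case=> [Kh|[[n1 n2] nr]].
  have [x Ex] := @inX O1 ing1' K1 (inl h) Kh; have Efx := recon_l Ex.
  have Eax : val (ma T1 x) = kalpha K1 (inl h) by rewrite (ctx_alpha c1) Ex.
  move: Eax => /=; case ia : (ing1 (a1 h)) => Eax.
    have := recon_l Eax; rewrite fa (ctx_alpha c2) Efx /=.
    by case: ifP => // _ [].
  have nKa : ~~ K1 (a1 h) by apply/negP=> /(kg_in kg1); rewrite ia.
  rewrite {1}/g insub_l // a1K -Ex valK (_ : under (f x) = g h) //.
  exact: under_l Efx.
have [x Ex] := @inX O1 ing1' K1 (inr h) nr; have Efx := recon_r n1 n2 Ex.
case ih : (ing1 h).
  have [ar na] := kg_out kg1 ih n1.
  rewrite {1}/g insub_l // a1K insub_l // insubN ?ar //=; last by rewrite negbK.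
  by rewrite -Ex valK (under_r Efx).
case ia : (ing1 (a1 h)).
  by have [] := kg_out kg1 ia n2; rewrite a1K (negPf nr).
have Eax : val (ma T1 x) = inr (a1 h) by rewrite (ctx_alpha c1) Ex /= ih ia (negPf n1).
have nr' := val_r Eax.
have := recon_r n2 _ Eax; rewrite a1K => /(_ n1).
rewrite fa (ctx_alpha c2) Efx /=.
case: ifP => // _; case: ifP => [_ [] //|_] E.
have : ma T2 (f x) = f x.
  apply: val_inj; rewrite -fa (recon_r n2 _ Eax) ?a1K // Efx E //.
rewrite -fa => /fi /(congr1 val); rewrite Eax Ex => -[E2].
by case: (kc_pre c1) => _ _ /(_ h); rewrite E2 eqxx.
Qed.

Lemma recon_a h : g (a1 h) = a2 (g h).
Proof.
case K1h : (K1 h); first by apply: recon_a1; left.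
have swap : K1 (a1 h) \/ (~~ K1 (a1 h) /\ ~~ K1 (a1 (a1 h))) /\ a1 h \notin root1 -> g (a1 h) = a2 (g h).
  by move/recon_a1; rewrite a1K => ->; rewrite a2K.
case K1a : (K1 (a1 h)); first by apply: swap; left.
case nr : (h \in root1); last by apply: recon_a1; right; rewrite K1h K1a nr.
apply: swap; right; rewrite a1K K1h K1a; split=> //.
have [_ nh] := kg_out kg1 (kc_rin c1 nr) (negbT K1a).
by apply: (out_a (kc_rin c1)).
Qed.

(** The corner opposite to a kept dart carries the bud matched with it, and isomorphisms preserve
    matching. At the other corners the black half-edge belongs to the edge itself, or is the one
    that defines [recon]. *)
Lemma recon_corner (x : mD T1) h : val x = inr h -> val (f x) = inr (g h).
Proof.
move=> Ex; have nr := val_r Ex.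
case Ka : (K1 (a1 h)).
  have [y Ey] := @inX O1 ing1' K1 (inl (a1 h)) Ka.
  have myx : mtc (@contour T1) (@step T1) y x.
    by apply: (ctx_match c1 (k := a1 h)) => //; rewrite a1K.
  have /(ctx_match_inv c2)[k [_ _ Ey' ->]] := (iso_mtc fi fs fa fb y x).2 myx.
  move: Ey'; rewrite (recon_l Ey) => -[<-].
  by rewrite recon_a a2K.
case Kh : (K1 h); last by apply: recon_r; rewrite ?Kh ?Ka.
have [y Ey] := @inX O1 ing1' K1 (inl h) Kh.
have na : ing1 (a1 h) = false.
  by apply/negP=> /(kg_alpha kg1 Kh); rewrite Ka.
have -> : x = ma T1 y by apply: val_inj; rewrite (ctx_alpha c1) Ey Ex /= na.
have : mblack T2 (f (ma T1 y)) by rewrite fb black_val (ctx_alpha c1) Ey /= na.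
rewrite fa black_val (ctx_alpha c2) (recon_l Ey) /=; by case: ifP.
Qed.

Lemma recon_notroot h : h \notin root1 -> g h \notin root2.
Proof.
move=> nr; have [x Ex] := @inX O1 ing1' K1 (inr h) nr; exact: val_r (recon_corner Ex).
Qed.

(* An ingoing dart outside [K1] is opposite to the root-face: its bud is
   unmatched, and so is the image of this bud. *)
Lemma recon_nK h : ing1 h -> ~~ K1 h ->
  [/\ ing2 (g h), ~~ K2 (g h), a2 (g h) \in root2 & ~~ ing2 (a2 (g h))].
Proof.
move=> ih nK; have [ar na] := kg_out kg1 ih nK.
have nr : h \notin root1 by apply: (out_a (kc_rin c1)).
have [x Ex] := @inX O1 ing1' K1 (inr h) nr; have Efx := recon_corner Ex.
have ngr := recon_notroot nr.
have bx : ma T1 x == x by rewrite (bud_val (kc_pre c1) (kc_rin c1) kg1 Ex) ih nK orbT.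
have : ma T2 (f x) == f x by rewrite -fa (eqP bx).
rewrite (bud_val (kc_pre c2) (kc_rin c2) kg2 Efx); case ia : (ing2 (a2 (g h))) => /=.
  have Ka : K2 (a2 (g h)) by apply: (K_of_ing kg2); rewrite ?a2K.
  have [y Ey] := @inX O2 ing2' K2 (inl (a2 (g h))) Ka.
  have myx : mtc (@contour T2) (@step T2) y (f x).
    by apply: (ctx_match c2 (k := a2 (g h))); rewrite ?a2K.
  case: f_bij => f' fK f'K; move: myx; rewrite -(f'K y) => /(iso_mtc fi fs fa fb).
  by move/(ctx_unmatched c1 ih nK Ex).
by case/andP=> i2 nK2; have [] := kg_out kg2 i2 nK2.
Qed.

Lemma recon_ing h : ing2 (g h) = ing1 h.
Proof.
case K1h : (K1 h); first by rewrite (kg_in kg1 K1h) (kg_in kg2 (recon_K K1h)).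
case ih : (ing1 h); first by have [] := recon_nK ih (negbT K1h).
case ia : (ing1 (a1 h)).
  case Ka : (K1 (a1 h)); last first.
    by have [_ _ _] := recon_nK ia (negbT Ka); rewrite recon_a a2K => /negPf.
  have [x Ex] := @inX O1 ing1' K1 (inl (a1 h)) Ka.
  have : mblack T2 (f (ma T1 x)) by rewrite fb black_val (ctx_alpha c1) Ex /= a1K ih.
  by rewrite fa black_val (ctx_alpha c2) (recon_l Ex) /= recon_a a2K; case: ifP.
have nr : h \notin root1 by apply: (out_a (kc_rin c1)); rewrite ia.
have [x Ex] := @inX O1 ing1' K1 (inr h) nr; have Efx := recon_corner Ex.
apply/negP=> ig.
have nb : ~~ (ma T1 x == x) by rewrite (bud_val (kc_pre c1) (kc_rin c1) kg1 Ex) ia ih.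
have : ~~ (ma T2 (f x) == f x) by rewrite -fa (inj_eq fi).
rewrite (bud_val (kc_pre c2) (kc_rin c2) kg2 Efx) ig /= negb_or negbK => /andP[na Kg].
have : mblack T2 (f (ma T1 x)) by rewrite fb black_val (ctx_alpha c1) Ex /= K1h ih ia.
by rewrite fa black_val (ctx_alpha c2) Efx /= Kg na.
Qed.

Lemma recon_KE h : K2 (g h) = K1 h.
Proof.
case K1h : (K1 h); first exact: recon_K.
case ih : (ing1 h); first by have [_ /negPf] := recon_nK ih (negbT K1h).
by apply/negP=> /(kg_in kg2); rewrite recon_ing ih.
Qed.

(** A root corner opposite to a kept dart is recognized by an unmatched white half-edge; were the
    image corner not in the root-face, the image half-edge would be matched. *)
Lemma recon_root h : (g h \in root2) = (h \in root1).
Proof.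
case hr : (h \in root1); last by apply/negbTE/recon_notroot; rewrite hr.
have ia := kc_rin c1 hr.
case Ka : (K1 (a1 h)); last first.
  by have [_ _] := recon_nK ia (negbT Ka); rewrite recon_a a2K.
apply: contraT => ngr; have [x Ex] := @inX O1 ing1' K1 (inl (a1 h)) Ka.
have Efx := recon_l Ex; have Ka2 := recon_K Ka.
have [u Eu] := @inX O2 ing2' K2 (inr (g h)) ngr.
have mxu : mtc (@contour T2) (@step T2) (f x) u.
  by apply: (ctx_match c2 Ka2) => //; rewrite recon_a a2K.
case: f_bij => f' fK f'K; move: mxu; rewrite -(f'K u) => /(iso_mtc fi fs fa fb).
case/(ctx_match_inv c1)=> k [Kk nk Ex' _]; move: Ex'; rewrite Ex => -[Ek].
by rewrite -Ek a1K hr in nk.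
Qed.

Lemma recon_inj : injective g.
Proof.
have inj0 h k : h \notin root1 -> k \notin root1 -> g h = g k -> h = k.
  move=> nh nk E; have [x Ex] := @inX O1 ing1' K1 (inr h) nh; have [y Ey] := @inX O1 ing1' K1 (inr k) nk.
  have : f x = f y by apply: val_inj; rewrite (recon_corner Ex) (recon_corner Ey) E.
  by move/fi=> Exy; move: Ey; rewrite -Exy Ex => -[].
move=> h k E; case hr : (h \in root1); last first.
  by apply: inj0 => //; rewrite ?hr // -recon_root -E recon_root hr.
have kr : k \in root1 by rewrite -recon_root -E recon_root.
have Ea : g (a1 h) = g (a1 k) by rewrite !recon_a E.
apply: (can_inj a1K); case Ka : (K1 (a1 h)).
  have Ka' : K1 (a1 k) by rewrite -recon_KE -Ea recon_KE.
  have [x Ex] := @inX O1 ing1' K1 (inl (a1 h)) Ka; have [y Ey] := @inX O1 ing1' K1 (inl (a1 k)) Ka'.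
  have : f x = f y by apply: val_inj; rewrite (recon_l Ex) (recon_l Ey) Ea.
  by move/fi=> Exy; move: Ey; rewrite -Exy Ex => -[].
have Ka' : K1 (a1 k) = false by rewrite -recon_KE -Ea recon_KE.
have [_ nh] := kg_out kg1 (kc_rin c1 hr) (negbT Ka).
have [_ nk] := kg_out kg1 (kc_rin c1 kr) (negbT Ka').
by apply: inj0 => //; apply: (out_a (kc_rin c1)).
Qed.

Lemma recon_finv0 x : x \notin root1 -> g (finv s1 x) = finv s2 (g x).
Proof.
move=> nr; have [y Ey] := @inX O1 ing1' K1 (inr x) nr; have Efy := recon_corner Ey.
have Em : val (ms T1 y) = inr (phiV x) by rewrite (ctx_sigma c1) Ey.
have := recon_corner Em; rewrite fs (ctx_sigma c2) Efy /= /phiV recon_a => -[].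
by move/(can_inj a2K).
Qed.

Lemma recon_nin p : ing1 p -> nxt s2 ing2 (g p) = g (nxt s1 ing1 p).
Proof.
move=> ip; case Kp : (K1 p).
  have [x Ex] := @inX O1 ing1' K1 (inl p) Kp; have Em : val (ms T1 x) = inl (nxt s1 ing1 p).
    by rewrite (ctx_sigma c1) Ex.
  by have := recon_l Em; rewrite fs (ctx_sigma c2) (recon_l Ex) /= => -[].
have n1 := ing_nin (kc_pre c1) ip.
rewrite (kg_uniq kg1 ip (negbT Kp) n1); last by apply: nxt_connect ip.
have ig : ing2 (g p) by rewrite recon_ing.
apply: (kg_uniq kg2 ig); first by rewrite recon_KE Kp.
  exact: (ing_nin (kc_pre c2) ig).
by apply: nxt_connect ig.
Qed.

(** Root corners carry no black half-edge, so rotation there is recovered from the ingoing darts: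
    beyond the corner the sweep meets only outgoing darts, whose successors are not root corners and
    where [recon_finv0] applies. *)
Lemma recon_finv x : g (finv s1 x) = finv s2 (g x).
Proof.
case xr : (x \in root1); last by apply: recon_finv0; rewrite xr.
have ip := root_finv (kc_pre c1) (kc_rin c1) xr; set p := finv s1 x in ip *.
have iq : ing2 (finv s2 (g x)).
  by apply: (root_finv (kc_pre c2) (kc_rin c2)); rewrite recon_root.
have [j [Ej ij Hj]] := nxt_spec s1i (connect0 _ p) ip.
have spx : s1 p = x by rewrite /p f_finv.
have E i : i <= j -> g (iter i s1 x) = iter i s2 (g x).
  elim: i => [//|i IH] lti; rewrite !iterS -IH; last exact: ltnW.
  set z := iter i s1 x; have nz : s1 z \notin root1.
    by apply: (out_s (kc_pre c1) (kc_rin c1)); have := Hj i lti; rewrite iterSr spx.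
  by have := recon_finv0 nz; rewrite finv_f // => ->; rewrite f_finv.
(* Two ingoing darts with the same next ingoing dart are equal. *)
apply/esym; apply: (nxt_inj (P := ing2) s2i) => //; first by rewrite recon_ing.
rewrite recon_nin // Ej iterSr spx E //.
have Eq i : iter i.+1 s2 (finv s2 (g x)) = iter i s2 (g x) by rewrite iterSr f_finv.
rewrite -Eq; apply: nxt_uniq => //.
  by rewrite Eq -E // recon_ing -[x]spx -iterSr -Ej.
by move=> i lti; rewrite Eq -E ?(ltnW lti) // recon_ing -[x]spx -iterSr; exact: Hj.
Qed.

Lemma recon_s x : g (s1 x) = s2 (g x).
Proof. by have := recon_finv (s1 x); rewrite finv_f // => ->; rewrite f_finv. Qed.

Lemma recon_w h : bw O2 (g h) = bw O1 h.
Proof.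
case ih : (ing1 h); last first.
  have [_ ->] := kc_Nbio c1 h; rewrite ?ih //.
  by have [_ ->] := kc_Nbio c2 (g h); rewrite ?recon_ing ?ih.
case Kh : (K1 h); last first.
  rewrite (kc_one c1 ih) ?Kh // (kc_one c2) ?recon_ing // recon_KE Kh //.
have [x Ex] := @inX O1 ing1' K1 (inl h) Kh; have Efx := recon_l Ex.
have wx : ~~ mblack T1 x by rewrite black_val Ex.
have nb := white_nbud (kc_pre c1) (kc_rin c1) kg1 wx.
have wfx : ~~ mblack T2 (f x) by rewrite fb.
have nb2 := white_nbud (kc_pre c2) (kc_rin c2) kg2 wfx.
have := fw x; rewrite /mw /= /t_weight -[t_alpha ing1' x]/(ma T1 x).
by rewrite -[t_alpha ing2' _]/(ma T2 (f x)) (negPf nb) (negPf nb2) Ex Efx.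
Qed.

End Reconstruction.

(** * Isomorphisms *)

Lemma iso_mob_sym T1 T2 : iso_mob T1 T2 -> iso_mob T2 T1.
Proof.
case=> f [fb fs fa fi fw]; have [g fK gK] := fb.
exists g; split.
- by exists f.
- by move=> x; apply: (bij_inj fb); rewrite fs !gK.
- by move=> x; apply: (bij_inj fb); rewrite fa !gK.
- by move=> x; rewrite -fi gK.
- by move=> x; rewrite -fw gK.
Qed.

Section Functoriality.
Variables (O1 O2 : bio) (ing1' K1 : pred (bD O1)) (ing2' K2 : pred (bD O2)).
Hypotheses (c1 : kcontext ing1' K1) (c2 : kcontext ing2' K2).
Local Notation T1 := (KM ing1' K1).
Local Notation T2 := (KM ing2' K2).

Section Forward.
Variables (f : bD O1 -> bD O2) (f' : bD O2 -> bD O1).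
Hypotheses (fK : cancel f f') (f'K : cancel f' f).
Hypothesis fs : forall x, f (bs O1 x) = bs O2 (f x).
Hypothesis fa : forall x, f (ba O1 x) = ba O2 (f x).
Hypothesis fi : forall x, bing O2 (f x) = bing O1 x.
Hypothesis fw : forall x, bw O2 (f x) = bw O1 x.
Hypothesis fr : forall x, (f x \in broot O2) = (x \in broot O1).
Hypothesis fk : forall x, K2 (f x) = K1 x.

Definition fD (D1 D2 : Type) (f : D1 -> D2) (v : D1 + D1) : D2 + D2 :=
  match v with inl h => inl (f h) | inr h => inr (f h) end.

Lemma fD_keep v : keepK K2 (fD f v) = keepK K1 v.
Proof. by case: v => h /=; rewrite ?fk ?fr. Qed.

Lemma fD_keep' v : keepK K1 (fD f' v) = keepK K2 v.
Proof. by rewrite -fD_keep; case: v => h /=; rewrite f'K. Qed.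

Definition fX (x : mD T1) : mD T2 := Sub (fD f (val x)) (etrans (fD_keep (val x)) (valP x)).
Definition fX' (x : mD T2) : mD T1 := Sub (fD f' (val x)) (etrans (fD_keep' (val x)) (valP x)).

Lemma val_fX x : val (fX x) = fD f (val x).
Proof. by rewrite SubK. Qed.

Lemma fX_bij : bijective fX.
Proof.
by exists fX' => x; apply: val_inj; rewrite !SubK; case: (val x) => h /=; rewrite ?fK ?f'K.
Qed.

Lemma f_iter n x : f (iter n (bs O1) x) = iter n (bs O2) (f x).
Proof. by elim: n => [//|n IH]; rewrite !iterS fs IH. Qed.

Lemma f_nin h : bing O1 h -> nxt (bs O2) (bing O2) (f h) = f (nxt (bs O1) (bing O1) h).
Proof.
move=> ih; have [j [Ej ij Hj]] := nxt_spec (ctx_sinj c1) (connect0 _ h) ih.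
rewrite Ej f_iter; apply: nxt_uniq; first exact: (ctx_sinj c2).
  by rewrite -f_iter fi -Ej.
by move=> i lti; rewrite -f_iter fi; exact: Hj.
Qed.

Lemma fX_s x : fX (ms T1 x) = ms T2 (fX x).
Proof.
apply: val_inj; rewrite val_fX (ctx_sigma c1) (ctx_sigma c2) val_fX.
case Ex : (val x) => [h|h] /=; first by rewrite f_nin ?(kg_in (kc_good c1)) ?(val_l Ex).
by congr inr; rewrite /phiV fa; congr ba; apply: (ctx_sinj c2); rewrite -fs !f_finv //;
  [exact: (ctx_sinj c2)|exact: (ctx_sinj c1)].
Qed.

Lemma fX_a x : fX (ma T1 x) = ma T2 (fX x).
Proof.
apply: val_inj; rewrite val_fX (ctx_alpha c1) (ctx_alpha c2) val_fX.
case: (val x) => h /=; rewrite -!fa !fi ?fk; first by case: ifP.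
by case: ifP => // _; case: ifP.
Qed.

Lemma KM_forward : iso_mob T1 T2.
Proof.
exists fX; split=> [|||x|x].
- exact: fX_bij.
- exact: fX_s.
- exact: fX_a.
- by rewrite !black_val val_fX; case: (val x).
rewrite /mw /= /t_weight -[t_alpha ing2' _]/(ma T2 (fX x)) -[t_alpha ing1' _]/(ma T1 x).
rewrite -fX_a (inj_eq (bij_inj fX_bij)) val_fX; case: ifP => // _.
by case: (val x) => h /=; rewrite -?fa fw.
Qed.

End Forward.

(** Applied in both directions, this turns the injective map [recon] into a bijection. *)
Lemma KM_iso_card : iso_mob T1 T2 -> #|bD O1| <= #|bD O2|.
Proof.
case=> f [fb fs fa fi _]; have [d2 _] := root_ex (kc_pre c2).
exact: leq_card (recon_inj c1 c2 fb fs fa fi (d2 := d2)).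
Qed.

End Functoriality.

Lemma KM_backward (O1 O2 : bio) (ing1' K1 : pred (bD O1)) (ing2' K2 : pred (bD O2)) :
  kcontext ing1' K1 -> kcontext ing2' K2 ->
  iso_mob (KM ing1' K1) (KM ing2' K2) -> iso_bio O1 O2.
Proof.
move=> c1 c2 iso12; have le := KM_iso_card c2 c1 (iso_mob_sym iso12).
case: iso12 => f [fb fs fa fi fw]; have [d2 _] := root_ex (kc_pre c2).
have gi := recon_inj c1 c2 fb fs fa fi (d2 := d2).
have gb : bijective (recon f d2) by apply: inj_card_bij.
exists (recon f d2); split; split=> //.
- exact: (recon_s c1 c2 fb fs fa fi).
- exact: (recon_a c1 c2 fb fa fi).
- exact: (recon_ing c1 c2 fb fs fa fi).
- exact: (recon_w c1 c2 fb fs fa fi fw).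
apply/setP=> y; have [g' gK g'K] := gb; rewrite -(g'K y) mem_imset //.
by rewrite (recon_root c1 c2 fb fs fa fi).
Qed.

Lemma kcontext_plus O : is_Nbio O -> inB O -> kcontext (bing O) (bing O).
Proof.
move=> wO OB; split=> //.
- exact: inB_pre.
- exact: inB_rin.
- exact: inB_vin.
- exact: kgood_plus.
- exact: inB_reach.
- by left.
- by move=> h ->.
Qed.

Lemma kcontext_minus O : is_Nbio O -> inBtilde O -> kcontext (@ing_rev O) (@Kminus O).
Proof.
move=> wO [OB adm]; have pre := inB_pre OB; have rin := inB_rin OB; split=> //.
- exact: inB_vin.
- exact: kgood_minus.
- exact: inB_reach.
- by right=> h; rewrite KminusE2 // => /andP[].
move=> h ih; rewrite KminusE2 // ih /= negbK => ar.
case: adm => _ _ _ /(_ h (or_intror ar)); rewrite ih.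
by case=> [[_ [_ []]]|[_ []]].
Qed.

Lemma iso_rootE O1 O2 (f : bD O1 -> bD O2) : injective f -> f @: broot O1 = broot O2 ->
  forall x, (f x \in broot O2) = (x \in broot O1).
Proof. by move=> fi <- x; rewrite mem_imset. Qed.

Theorem Phi_plus_iso O1 O2 : is_Nbio O1 -> inB O1 -> is_Nbio O2 -> inB O2 ->
  (iso_bio O1 O2 <-> iso_mob (Phi_plus O1) (Phi_plus O2)).
Proof.
move=> w1 B1 w2 B2; have c1 := kcontext_plus w1 B1; have c2 := kcontext_plus w2 B2.
split; last exact: (KM_backward c1 c2).
case=> f [[fb fs fa fi] [fw fr]]; have [f' fK f'K] := fb.
exact: (KM_forward c1 c2 fK f'K fs fa fi fw (iso_rootE (bij_inj fb) fr) fi).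
Qed.

Theorem Phi_minus_iso O1 O2 : is_Nbio O1 -> inBtilde O1 -> is_Nbio O2 -> inBtilde O2 ->
  (iso_bio O1 O2 <-> iso_mob (Phi_minus O1) (Phi_minus O2)).
Proof.
move=> w1 B1 w2 B2; have c1 := kcontext_minus w1 B1; have c2 := kcontext_minus w2 B2.
split; last exact: (KM_backward c1 c2).
case=> f [[fb fs fa fi] [fw fr]]; have [f' fK f'K] := fb.
have fr' := iso_rootE (bij_inj fb) fr.
apply: (KM_forward c1 c2 fK f'K fs fa fi fw fr').
case: B1 B2 => B1 adm1 [B2 adm2] x.
have p1 := inB_pre B1; have p2 := inB_pre B2.
have r1 := inB_rin B1; have r2 := inB_rin B2.
by rewrite !KminusE2 // fi -fa fr'.
Qed.

(** * The closure of a mobile of positive excess *)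

Lemma inj_surj_bij (T1 T2 : finType) (f : T1 -> T2) :
  injective f -> (forall y, exists x, f x = y) -> bijective f.
Proof.
move=> fi fs; apply: inj_card_bij => //; rewrite -(card_codom fi).
by apply/subset_leq_card/subsetP=> y _; have [x <-] := fs y; exact: codom_f.
Qed.

Section IsoCount.
Variables (T1 T2 : mob).

Lemma iso_card_orbits : iso_mob T1 T2 -> #|orbits (ms T1)| = #|orbits (ms T2)|.
Proof.
case=> f [fb fs _ _ _]; have fi := bij_inj fb.
have E x : f @: orb (ms T1) x = orb (ms T2) (f x).
  have It n : f (iter n (ms T1) x) = iter n (ms T2) (f x).
    by elim: n => [//|n IH]; rewrite !iterS fs IH.
  apply/setP=> y; rewrite mem_orb; apply/imsetP/fconnect_iterP => [[z]|[n ->]].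
    by rewrite mem_orb => /fconnect_iterP[n ->] ->; exists n.
  by exists (iter n (ms T1) x); rewrite ?mem_orb ?fconnect_iter.
rewrite -(card_imset _ (imset_inj fi)); apply: eq_card => A.
apply/imsetP/orbitsP => [[B /orbitsP[x ->] ->]|[y ->]]; first by exists (f x); rewrite E.
have [g fK gK] := fb; exists (orb (ms T1) (g y)); first exact: orb_in.
by rewrite E gK.
Qed.

Lemma iso_card_medges : iso_mob T1 T2 -> #|medges T1| = #|medges T2|.
Proof.
case=> f [fb _ fa _ _]; have fi := bij_inj fb.
rewrite -(card_imset _ (imset_inj fi)); apply: eq_card => A.
apply/imsetP/imsetP => [[B /imsetP[x]]|[y]]; rewrite inE => nx ->.
  by move=> ->; exists (f x); rewrite ?inE -?fa ?(inj_eq fi) // imsetU1 imset_set1.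
have [g fK gK] := fb; exists [set g y; ma T1 (g y)].
  by apply/imsetP; exists (g y); rewrite ?inE // -(inj_eq fi) fa gK.
by rewrite imsetU1 imset_set1 fa gK.
Qed.
End IsoCount.

Section Closure.
Variable T : mob.
Local Notation X := (mD T).
Local Notation black := (mblack T).
Local Notation psi := (@contour T).
Local Notation e := (@step T).
Local Notation ht := (height psi e).
Local Notation mtch := (mtc psi e).
Local Notation mate := (mt psi e).
Local Notation N := #|X|.

Definition unmatched (x : X) : bool := ~~ black x && ~~ matched psi e x.

Definition cdart : finType := {x : X | ma T x != x}.

Hypothesis aK : involutive (ma T).

Lemma cdart_alpha (z : cdart) : ma T (ma T (val z)) != ma T (val z).
Proof. by rewrite aK eq_sym; exact: (valP z). Qed.

Definition calpha (z : cdart) : cdart := Sub (ma T (val z)) (cdart_alpha z).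

(* [slot z] is the dart of the mobile carrying, in the opening of the closure,
   the black half-edge at the corner [calpha z]; unmatched white darts stand
   for the corners of the root-face. *)
Definition slot (z : cdart) : X :=
  if ~~ black (val z) && matched psi e (val z) then mate (val z) else val z.

Definition unslot (d : cdart) (x : X) : cdart := odflt d [pick z | slot z == x].

(** The face permutation of the closure, transported by [slot (calpha z)]: an inner face runs around
    a black vertex against [ms T], and the unmatched darts in contour order form the root-face. The
    vertices of the closure are then forced, through [csigma]. *)
Definition turn (x : X) : X := if black x then finv (ms T) x else nxt psi unmatched x.

Definition csigma (z : cdart) : cdart := calpha (unslot z (turn (slot z))).

Definition mobile_closure : bio :=
  Bio cdart csigma calpha (fun z => ~~ black (val z)) (fun z => mw T (val z))
      [set z | unmatched (val (calpha z))].

Hypothesis s_inj : injective (ms T).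
Hypothesis black_s : forall x, black (ms T x) = black x.
Hypothesis bud_black : forall x, ma T x = x -> black x.
Hypothesis conn : forall x y, connect (sa_rel (ms T) (ma T)) x y.
Hypothesis tree : #|orbits (ms T)| = (#|medges T| + 1)%N.
Hypothesis pos : (0 < excess T)%R.
Local Notation ing z := (~~ black (val z)).
Local Notation root := [set z : cdart | unmatched (val (calpha z))].

Let one_cycle x y : fconnect psi x y.
Proof. exact: tree_contour. Qed.

Let tot : (0 < total_height e)%R.
Proof. by rewrite -excess_total. Qed.

Let tot0 : (0 <= total_height e)%R. Proof. exact: ltW. Qed.

Let psi_inj : injective psi. Proof. exact: contour_inj. Qed.

Let white_nb x : ~~ black x -> ma T x != x.
Proof. by apply: contra => /eqP/bud_black. Qed.

Lemma calphaK : involutive calpha.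
Proof. by move=> z; apply: val_inj; rewrite !SubK aK. Qed.

Lemma calpha_neq z : calpha z != z.
Proof. by rewrite -(inj_eq val_inj) SubK; exact: (valP z). Qed.

Lemma unmatchedP x : reflect (e x = 1%R /\ forall n, (0 < ht x n.+1)%R) (unmatched x).
Proof.
apply: (iffP andP) => [[wx nm]|[ex H]].
  have ex : e x = 1%R by apply/eqP; rewrite step_open.
  split=> // n; rewrite ltNge; apply/negP=> /(mtc_ex (@step_val T) ex)[u mu].
  by have [mx _] := mtc_mt psi_inj (@step_val T) one_cycle mu tot0; rewrite mx in nm.
split; first by rewrite -step_open ex.
by apply/existsPn=> n; rewrite -ltNge.
Qed.

Lemma mate_mtc x : ~~ black x -> matched psi e x -> mtch x (mate x).
Proof. by move=> wx; apply: (mtcP (@step_val T)); apply/eqP; rewrite step_open. Qed.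

Lemma mtc_mate x u : mtch x u -> [/\ ~~ black x, matched psi e x & mate x = u].
Proof.
move=> mu; have [mx Eu] := mtc_mt psi_inj (@step_val T) one_cycle mu tot0.
by split=> //; case: mu => /eqP; rewrite step_open.
Qed.

Lemma mtc_bud x u : mtch x u -> black u /\ ma T u = u.
Proof. by move=> /(mtc_close (@step_val T))/eqP; rewrite step_close => /andP[-> /eqP]. Qed.

Variant slot_spec (z : cdart) : X -> Type :=
 | SlotBlack of black (val z) : slot_spec z (val z)
 | SlotMatched of ~~ black (val z) & mtch (val z) (slot z) : slot_spec z (slot z)
 | SlotUnmatched of unmatched (val z) : slot_spec z (val z).

Lemma slotP z : slot_spec z (slot z).
Proof.
case bz : (black (val z)).
  by have -> : slot z = val z; [rewrite /slot bz|exact: SlotBlack].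
case mz : (matched psi e (val z)).
  by apply: SlotMatched; rewrite ?bz // /slot bz mz; apply: mate_mtc; rewrite ?bz.
have -> : slot z = val z by rewrite /slot bz mz.
by apply: SlotUnmatched; rewrite /unmatched bz mz.
Qed.

Lemma unmatched_white x : unmatched x -> ~~ black x.
Proof. by case/andP. Qed.

Lemma slot_black z : black (slot z) = ~~ unmatched (val z).
Proof.
case: (slotP z) => [bz|wz mz|uz].
- by rewrite /unmatched bz.
- have [-> _] := mtc_bud mz; have [_ mx _] := mtc_mate mz.
  by rewrite /unmatched mx andbF.
- by rewrite uz (negPf (unmatched_white uz)).
Qed.

Lemma slot_unmatched z : unmatched (val z) -> slot z = val z.
Proof. by rewrite /slot => /andP[-> /negPf ->]. Qed.

Lemma slot_inj : injective slot.
Proof.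
have nb (z : cdart) u : mtch (val z) u -> forall z' : cdart, u <> val z'.
  by move=> /mtc_bud[_ bu] z' E; have := valP z'; rewrite -E bu eqxx.
move=> y z; case: (slotP y) => [by_|wy my|uy]; case: (slotP z) => [bz|wz mz|uz] E;
  try exact: val_inj.
- by case: (nb _ _ mz y).
- by case: (nb _ _ my z).
- by apply: val_inj; rewrite E in my; exact: (mtc_inj psi_inj my mz).
- by case: (nb _ _ my z).
- by case: (nb _ _ mz y).
Qed.

Definition slotted (x : X) : bool := black x || unmatched x.

(** Every bud is the mate of a white half-edge because the total height is nonnegative; any other
    slotted half-edge is its own slot. *)
Lemma slot_onto x : slotted x -> exists z, slot z = x.
Proof.
have slot_val (nb : ma T x != x) : black x || unmatched x -> exists z, slot z = x.
  move=> H; exists (Sub x nb); rewrite /slot SubK.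
  by case/orP: H => [->//|/andP[-> /negPf->]].
move=> sx; case bx : (ma T x == x); last by apply: slot_val; rewrite ?bx.
have ex : e x = (-1)%R by apply/eqP; rewrite step_close bx bud_black //; exact/eqP.
have [h mh] := mtc_close_total psi_inj (@step_val T) one_cycle ex tot0.
have [wh mth Eh] := mtc_mate mh.
by exists (Sub h (white_nb wh)); rewrite /slot SubK wh mth.
Qed.

Lemma slotted_slot z : slotted (slot z).
Proof.
rewrite /slotted; case uz : (unmatched (val z)); last by rewrite slot_black uz.
by rewrite (slot_unmatched uz) uz orbT.
Qed.

Lemma unslotK d x : slotted x -> slot (unslot d x) = x.
Proof.
move=> /slot_onto[z Ez]; rewrite /unslot; case: pickP => [y /eqP //|/(_ z)].
by rewrite Ez eqxx.
Qed.

Lemma black_finv x : black (finv (ms T) x) = black x.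
Proof. by rewrite -[in RHS](f_finv s_inj x) black_s. Qed.

Lemma unmatched_nxt x : unmatched x -> unmatched (nxt psi unmatched x).
Proof. by move=> ux; have [j []] := nxt_spec psi_inj (connect0 _ x) ux. Qed.

Lemma turn_slotted x : slotted x -> slotted (turn x).
Proof.
rewrite /slotted /turn; case bx : (black x) => /= H; first by rewrite black_finv bx.
by rewrite unmatched_nxt ?orbT.
Qed.

Lemma turn_black x : slotted x -> black (turn x) = black x.
Proof.
rewrite /slotted /turn; case bx : (black x) => /= H; first by rewrite black_finv.
by apply/negbTE/unmatched_white/unmatched_nxt.
Qed.

Lemma turn_inj x y : slotted x -> slotted y -> turn x = turn y -> x = y.
Proof.
move=> sx sy E; have B : black x = black y by rewrite -turn_black // E turn_black.
move: sx sy E; rewrite /slotted /turn B; case: (black y) => /= [_ _|].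
  by move/(finv_inj s_inj).
by move=> ux uy; apply: nxt_inj.
Qed.

Lemma slot_csigma z : slot (calpha (csigma z)) = turn (slot z).
Proof. by rewrite /csigma calphaK unslotK // turn_slotted // slotted_slot. Qed.

Lemma csigma_inj : injective csigma.
Proof.
move=> y z E; apply: slot_inj; apply: turn_inj; rewrite ?slotted_slot //.
by rewrite -!slot_csigma E.
Qed.

Lemma slot_finv z : black (slot (calpha z)) -> slot (finv csigma z) = ms T (slot (calpha z)).
Proof.
have := slot_csigma (finv csigma z); rewrite f_finv; last exact: csigma_inj.
move=> ->; rewrite turn_black ?slotted_slot // => b.
by rewrite /turn b f_finv.
Qed.

Lemma slot_finv_root z : unmatched (val (calpha z)) ->
  unmatched (val (finv csigma z)) /\
  nxt psi unmatched (val (finv csigma z)) = val (calpha z).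
Proof.
move=> uz; have := slot_csigma (finv csigma z); rewrite f_finv; last exact: csigma_inj.
rewrite slot_unmatched // => E.
have B : black (slot (finv csigma z)) = false.
  by rewrite -turn_black ?slotted_slot // -E; apply/negbTE/unmatched_white.
have uu : unmatched (val (finv csigma z)) by move: B; rewrite slot_black => /negbFE.
by move: E; rewrite /turn B slot_unmatched.
Qed.

(** The relation [bal b], with the length kept explicit since it measures the progress of the
    walk. *)
Definition flat (b : X) (i : nat) : Prop :=
  ht (psi b) i = 0%R /\ forall t, t <= i -> (0 <= ht (psi b) t)%R.

(** A flat stretch cannot contain a full turn of the contour, whose total is positive. *)
Lemma flat_lt b i : flat b i -> i < N.
Proof.
case=> h0 hp; rewrite ltnNge; apply/negP=> le_i.
have := height_period e psi_inj one_cycle (psi b) (i - N); rewrite subnKC // h0.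
by have := hp (i - N); rewrite leq_subr => /(_ isT); have := tot; lia.
Qed.

Lemma flat0 b : flat b 0.
Proof. by split=> [|[]//]; rewrite height0. Qed.

Lemma flat_neutral b i : flat b i -> e (iter i.+1 psi b) = 0%R -> flat b i.+1.
Proof.
case=> h0 hp e0; have E : ht (psi b) i.+1 = 0%R by rewrite heightS h0 -iterSr e0.
by split=> // t; rewrite leq_eqVlt => /orP[/eqP->|/hp//]; rewrite E.
Qed.

Lemma flat_match b i n : flat b i ->
  ht (iter i.+1 psi b) n.+1 = 0%R -> (forall t, 0 < t <= n -> (0 < ht (iter i.+1 psi b) t)%R) ->
  flat b (i + n.+1).
Proof.
case=> h0 hp n0 np; split; first by rewrite heightD h0 -iterSr n0.
move=> t le_t; case: (leqP t i) => [/hp//|lt_i].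
rewrite -(subnKC (ltnW lt_i)) heightD h0 -iterSr add0r.
case: (ltngtP (t - i) n.+1) => [lt|lt|->]; [|lia|by rewrite n0].
by apply/ltW/np; lia.
Qed.

(* Turning counterclockwise around a vertex of the closure amounts to following
   the contour of the mobile and jumping over matched pairs, until an enclosing
   pair is closed or the next unmatched dart is reached. *)
Definition lands (b : X) (z : cdart) : Prop := exists t j : nat,
  let p := iter t.+1 (finv csigma) (calpha z) in
  [/\ ing p, (forall t', t' < t -> ~~ ing (iter t'.+1 (finv csigma) (calpha z))),
      flat b j &
      mtch (val p) (iter j.+1 psi b) \/
      [/\ unmatched (val p), unmatched (iter j.+1 psi b)
        & nxt psi unmatched (val p) = iter j.+1 psi b]].

Lemma lands_step b z : let p := finv csigma (calpha z) in
  ~~ ing p -> lands b (calpha p) -> lands b z.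
Proof.
move=> /= np [t [j []]]; rewrite calphaK => ip Hp fl H.
exists t.+1, j; rewrite iterSr; split=> //.
by case=> [//|t'] lt; rewrite iterSr; exact: Hp.
Qed.

(** After a flat stretch the contour may meet a neutral half-edge, an opening whose whole pair is
    jumped over, or an unmatched dart, which ends the walk. *)
Lemma enter b i (q : cdart) : val q = iter i.+1 psi b -> flat b i ->
  (exists2 i', i < i' & [/\ slot q = iter i' psi b, black (slot q) & flat b i'])
  \/ lands b q.
Proof.
move=> Eq fl; case: (slotP q) => [bq|wq mq|uq].
- left; exists i.+1 => //; split=> //.
  by apply: flat_neutral => //; apply/eqP; rewrite -Eq step_neutral bq (valP q).
- left; have [bs _] := mtc_bud mq; case: mq => _ [n [En n0 np]].
  rewrite Eq in En n0 np; exists (i + n.+1); first by lia.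
  by split; [rewrite En -iterD; congr (iter _ psi b); lia| |exact: flat_match].
right; exists 0, i; rewrite /=; have [] := @slot_finv_root (calpha q).
  by rewrite calphaK.
rewrite calphaK => up Ep; split=> //; first exact: unmatched_white.
by right; rewrite -iterS -Eq.
Qed.

(** Each outgoing dart passed around the vertex moves the contour forward along a longer flat
    stretch; [flat_lt] bounds its length, so the walk must end. *)
Lemma walk b i z : slot z = iter i psi b -> black (slot z) -> flat b i -> lands b z.
Proof.
move: {2}(N - i) (leqnn (N - i)) => m; elim: m i z => [|m IH] i z le_m Ez bz fl.
  by have := flat_lt fl; lia.
have Ep : slot (finv csigma (calpha z)) = ms T (slot z).
  by rewrite slot_finv calphaK.
set p := finv csigma (calpha z) in Ep *.
case: (slotP p) Ep => [bp|wp mp|up] Ep.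
- apply: lands_step; first by rewrite bp.
  have Eq : val (calpha p) = iter i.+1 psi b by rewrite SubK Ep Ez.
  case: (enter Eq fl) => [[i' lt_i [E1 b1 f1]]|//].
  by apply: (IH i') => //; lia.
- exists 0, i; split=> //=; left.
  suff -> : psi (iter i psi b) = slot p by [].
  by rewrite -Ez /contour -Ep; have [_] := mtc_bud mp.
by have := unmatched_white up; rewrite Ep black_s bz.
Qed.

Lemma lands_prv b z : lands b z -> exists j,
  let p := nxt (finv csigma) (fun u => ing u) (calpha z) in
  [/\ ing p, fconnect csigma (calpha z) p, flat b j & 
      mtch (val p) (iter j.+1 psi b) \/
      [/\ unmatched (val p), unmatched (iter j.+1 psi b)
        & nxt psi unmatched (val p) = iter j.+1 psi b]].
Proof.
case=> t [j [ip Hp fl H]]; exists j.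
rewrite (nxt_uniq (j := t) (finv_inj csigma_inj)) //; split=> //.
by rewrite -(fconnect_finv' csigma_inj) fconnect_iter.
Qed.

Local Notation nu := (nxt psi unmatched).
Local Notation cphi := (@bphi mobile_closure).

Lemma unmatched_ex : exists k, unmatched k.
Proof.
apply/existsP; apply: contraT => /existsPn nu; move: pos; rewrite excess_card //.
have all_matched x : ~~ black x -> mtch x (mate x).
  by move=> wx; apply: mate_mtc => //; have := nu x; rewrite /unmatched wx negbK.
have : #|[set x | ~~ black x]| <= #|mbuds T|; last by lia.
rewrite -(card_in_imset (f := mate)); last first.
  move=> x y; rewrite !inE => /all_matched mx /all_matched my E.
  by rewrite E in mx; exact: (mtc_inj psi_inj mx my).
apply/subset_leq_card/subsetP=> u /imsetP[x]; rewrite inE => /all_matched mx ->.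
by rewrite inE; apply/eqP; case: (mtc_bud mx).
Qed.

Lemma root_csigma z : z \in root ->
  cphi z \in root /\ val (calpha (cphi z)) = nu (val (calpha z)).
Proof.
rewrite !inE => uz; have := slot_csigma (calpha z); rewrite (slot_unmatched uz) => E.
have bE : black (slot (calpha (cphi z))) = false.
  rewrite E /turn (negPf (unmatched_white uz)).
  exact/negbTE/unmatched_white/unmatched_nxt.
have uz' : unmatched (val (calpha (cphi z))) by exact: negbFE (etrans (esym (slot_black _)) bE).
split=> //; move: E; rewrite /turn (negPf (unmatched_white uz)) => <-.
by rewrite -[csigma _]/(cphi z) slot_unmatched.
Qed.

Lemma root_iter z n : z \in root ->
  iter n cphi z \in root /\ val (calpha (iter n cphi z)) = iter n nu (val (calpha z)).
Proof.
move=> zr; elim: n => [//|n [rn En]]; rewrite !iterS.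
by have [-> ->] := root_csigma rn; rewrite En.
Qed.

Lemma closure_premap : premap mobile_closure.
Proof.
split; [exact: csigma_inj|exact: calphaK|exact: calpha_neq|].
have [k uk] := unmatched_ex; exists (calpha (Sub k (white_nb (unmatched_white uk)))).
set r := calpha _; have rr : r \in root by rewrite inE calphaK SubK.
have Er : val (calpha r) = k by rewrite calphaK SubK.
apply/setP=> y; rewrite [in RHS]inE; apply/idP/idP => [|/fconnect_iterP[n ->]]; last first.
  by case: (root_iter n rr).
rewrite inE => uy.
have := nxt_fconnect psi_inj uk uy (one_cycle _ _).
case/fconnect_iterP=> n En; apply/fconnect_iterP; exists n.
have [_ E2] := root_iter n rr; apply: (can_inj calphaK); apply: val_inj.
by rewrite En E2 Er.
Qed.

Lemma closure_root_in : root_in mobile_closure.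
Proof. by move=> r; rewrite inE => /unmatched_white. Qed.

Lemma closure_vertex_in : vertex_in mobile_closure.
Proof.
move=> x; case ux : (unmatched (val (calpha x))).
  have [up _] := slot_finv_root ux; exists (finv csigma x).
    exact: fconnect_finv.
  exact: unmatched_white.
have L : lands (slot (calpha x)) (calpha x).
  by apply: (@walk _ 0) => //; [rewrite slot_black ux|exact: flat0].
have [j []] := lands_prv L; rewrite calphaK => ip cp _ _.
by exists (nxt (finv csigma) (fun u => ing u) x).
Qed.

(** The walk from [h] follows a flat stretch. If it ends at a closing bud, both [h] and the dart
    found are matched with it. If it ends at an unmatched dart [q], then [h] is unmatched too, and
    no unmatched dart lies between [h] and [q]. In either case the dart found is [h]. *)
Lemma closure_prv (h : cdart) (g : cdart) : ing h -> val g = ms T (val h) ->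
  nxt (finv csigma) (fun u => ing u) g = h.
Proof.
move=> ih Eg; have eh : e (val h) = 1%R by apply/eqP; rewrite step_open.
have L : lands (val h) (calpha g).
  have Eq : val (calpha g) = iter 1 psi (val h) by rewrite SubK Eg.
  case: (enter Eq (flat0 _)) => [[i _ [Ei bi fi]]|//].
  exact: walk Ei bi fi.
have [j []] := lands_prv L; rewrite calphaK; set p := nxt _ _ g => ip _ fl H.
have [h0 hp] := fl.
case: H => [mp|[up uq Ep]].
  have mh : mtch (val h) (iter j.+1 psi (val h)).
    rewrite iterS; apply: mtc_intro => //; last by have := mtc_close (@step_val T) mp.
    by exists j.
  by apply: val_inj; exact: (mtc_inj psi_inj mp mh).
set q := iter j.+1 psi (val h) in uq Ep; have [eq hq] := unmatchedP _ uq.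
have uh : unmatched (val h).
  apply/unmatchedP; split=> // n; rewrite heightSl eh.
  case: (leqP n j) => [/hp|lt]; first by lia.
  have -> : n = j + (n - j.+1).+1 by lia.
  by rewrite heightD h0 add0r -iterSr; have := hq (n - j.+1); rewrite /q; lia.
apply: val_inj; apply: (nxt_inj psi_inj up uh); rewrite Ep; apply/esym.
apply: nxt_uniq => // t lt; apply/negP=> /unmatchedP[_ ht1].
have := ht1 (j - t.+1); rewrite (_ : (j - t.+1).+1 = j - t); last by lia.
have := h0; rewrite -{1}(subnKC (ltnW lt)) heightD -iterSr.
have := hp t (ltnW lt); lia.
Qed.

Lemma closure_nin (h g : cdart) : ing h -> val g = ms T (val h) ->
  nxt csigma (fun u => ing u) h = g.
Proof.
move=> ih Eg; have E := closure_prv ih Eg; rewrite -E.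
by apply: (nxtK_finv csigma_inj (P := fun u : cdart => ing u)); rewrite Eg black_s.
Qed.

(** A closing step reached from [u] by a flat stretch belongs to a pair enclosing that of [h]: an
    opening inside the stretch, or inside the pair from [h] to [u], would contradict the sign of the
    heights. *)
Lemma match_length h u j p n n' : e h = 1%R ->
  u = iter n psi h -> ht h n.+1 = 0%R -> (forall i, 0 < i <= n -> (0 < ht h i)%R) ->
  flat u j -> iter j.+1 psi u = iter n' psi p -> ht p n'.+1 = 0%R ->
  (forall i, 0 < i <= n' -> (0 < ht p i)%R) -> e (iter j.+1 psi u) = (-1)%R -> n < n'.
Proof.
move=> eh Eu n0 np [j0 jp] Ep p0 pp e1; rewrite ltnNge; apply/negP=> le_n.
case: (leqP n' j) => le_j.
  have E : p = iter (j - n') psi (psi u).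
    apply: (inj_iter psi_inj (n := n')); rewrite -iterD -Ep -iterSr; congr (iter _ psi u); lia.
  have : ht (psi u) (j - n' + n'.+1) = ht (psi u) j.+1 by congr ht; lia.
  rewrite heightD -E p0 addr0 heightS j0 -iterSr e1.
  by have := jp (j - n'); rewrite leq_subr => /(_ isT) H ?; lia.
set k := (n + j.+1 - n')%N.
have E : p = iter k psi h.
  apply: (inj_iter psi_inj (n := n')); rewrite -iterD -Ep Eu -iterD.
  congr (iter _ psi h); rewrite /k; lia.
have : ht h (k + (n.+1 - k)) = ht h n.+1 by congr ht; rewrite /k; lia.
rewrite heightD -E n0.
have := np k; have := pp (n.+1 - k)%N; rewrite /k => H1 H2.
have {}H1 := H1 _; have {}H2 := H2 _.
have : (0 < ht p (n.+1 - (n + j.+1 - n')))%R by apply: H1; lia.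
have : (0 < ht h (n + j.+1 - n'))%R by apply: H2; lia.
lia.
Qed.

(** Passing to a parent strictly lengthens the matched pair, and a pair is shorter than the contour;
    hence the chain meets an unmatched dart, whose opposite is a root corner. *)
Lemma closure_reach : reaches_root mobile_closure.
Proof.
have unm0 (h : cdart) : unmatched (val h) -> calpha h \in root by rewrite inE calphaK.
suff H m : forall (h : cdart) n, N <= n + m -> e (val h) = 1%R -> ht (val h) n.+1 = 0%R ->
    (forall i, 0 < i <= n -> (0 < ht (val h) i)%R) ->
    exists k, calpha (iter k (@par mobile_closure) h) \in root.
  move=> h /= ih; case uh : (unmatched (val h)); first by exists 0; exact: unm0.
  have mh : mtch (val h) (mate (val h)).
    by apply: mate_mtc => //; move: uh; rewrite /unmatched ih => /negbFE.
  case: mh => eh [n [_ n0 np]]; exact: (H N h n (leq_addl _ _)).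
elim: m => [|m IH] h n le_n eh n0 np.
  have := height_period e psi_inj one_cycle (val h) (n.+1 - N)%N; rewrite subnKC ?n0; last by lia.
  have N0 : 0 < N by apply: (card_pos (val h)).
  case: (posnP (n.+1 - N)%N) => [->|d0]; first by rewrite height0; have := tot; lia.
  have := np (n.+1 - N)%N; rewrite d0 => /(_ _) H1.
  have : (0 < ht (val h) (n.+1 - N))%R by apply: H1; lia.
  by have := tot; lia.
have mh : mtch (val h) (iter n psi (val h)) by split=> //; exists n.
have [wh mth Emate] := mtc_mate mh.
have Es : slot h = iter n psi (val h) by rewrite /slot wh mth.
have [bs _] := mtc_bud mh.
have L : lands (slot h) h.
  by apply: (@walk _ 0) => //; [rewrite Es|exact: flat0].
have [j []] := lands_prv L; set p := nxt _ _ _ => ip _ fl H.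
have Ep : @par mobile_closure h = p by [].
case: H => [mp|[up _ _]]; last by exists 1; rewrite /= Ep; exact: unm0.
have ej := mtc_close (@step_val T) mp; case: mp => ep [n' [En' p0 pp]].
have lt := match_length eh Es n0 np fl En' p0 pp ej.
have [k Hk] := IH p n' ltac:(lia) ep p0 pp.
by exists k.+1; rewrite iterSr Ep.
Qed.

Let cpre := closure_premap.
Let crin := closure_root_in.
Let cvin := closure_vertex_in.
Let ckg := kgood_plus mobile_closure.
Local Notation P := (Phi_plus mobile_closure).

Local Notation keep := (keepK (bing mobile_closure)).

Definition unfold (v : cdart + cdart) : X :=
  match v with inl h => val h | inr h => slot (calpha h) end.

Lemma unfold_black v : keep v -> black (unfold v) = ~~ is_inl v.
Proof. by case: v => h /=; [move/negPf|rewrite inE slot_black]. Qed.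

Lemma unfold_s v : keep v -> unfold (ksigma (O := mobile_closure) v) = ms T (unfold v).
Proof.
case: v => h kh.
  have nb : ma T (ms T (val h)) != ms T (val h) by apply: white_nb; rewrite black_s.
  by rewrite /= (closure_nin (g := Sub (ms T (val h)) nb) kh).
rewrite /ksigma /phiV /unfold -[ba mobile_closure]/calpha calphaK.
by apply: slot_finv; rewrite slot_black; move: kh; rewrite /keepK inE.
Qed.

Lemma slot_bud z : ~~ black (val z) -> ~~ unmatched (val z) -> ma T (slot z) = slot z.
Proof.
move=> wz; case: (slotP z) => [|_ /mtc_bud[_ ->]|->] //; by rewrite (negPf wz).
Qed.

Lemma val_calpha z : val (calpha z) = ma T (val z).
Proof. by rewrite SubK. Qed.

Lemma slot_calpha z : black (val (calpha z)) -> slot (calpha z) = ma T (val z).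
Proof. by rewrite /slot => ->; rewrite val_calpha. Qed.

Lemma unfold_a v : keep v -> unfold (kalpha (O := mobile_closure) (bing mobile_closure) v) = ma T (unfold v).
Proof.
pose ka := kalpha (O := mobile_closure) (bing mobile_closure).
case: v => h kh; rewrite -/ka.
  case bah : (black (val (calpha h))).
    have -> : ka (inl h) = inr h by rewrite /ka /= bah.
    by rewrite /unfold slot_calpha.
  have -> : ka (inl h) = inl (calpha h) by rewrite /ka /= bah.
  by rewrite /unfold val_calpha.
have nr : ~~ unmatched (val (calpha h)) by move: kh; rewrite /keepK inE.
case bah : (black (val (calpha h))); last first.
  have -> : ka (inr h) = inr h by rewrite /ka /= bah !andbF.
  by rewrite /unfold slot_bud ?bah.
case bh : (black (val h)).
  have -> : ka (inr h) = inr (calpha h) by rewrite /ka /= bah bh.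
  by rewrite /unfold calphaK slot_calpha // aK /slot bh.
have -> : ka (inr h) = inl h by rewrite /ka /= bah bh.
by rewrite /unfold slot_calpha // aK.
Qed.

Lemma unfold_inj v v' : keep v -> keep v' -> unfold v = unfold v' -> v = v'.
Proof.
move=> kv kv' E; have := unfold_black kv; rewrite E unfold_black //.
case: v v' {kv kv'} E => h [k|k] //= E _; first by congr inl; exact: val_inj.
by congr inr; apply: (can_inj calphaK); exact: slot_inj.
Qed.

Lemma unfold_onto y : exists2 v, keep v & unfold v = y.
Proof.
case by_ : (black y).
  have [z Ez] := @slot_onto y ltac:(by rewrite /slotted by_).
  exists (inr (calpha z)); last by rewrite /unfold calphaK.
  change (calpha z \notin root).
  by rewrite inE calphaK -slot_black Ez by_.
by exists (inl (Sub y (white_nb (negbT by_)))); rewrite /= ?by_.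
Qed.

Hypothesis w_edge : forall x, ma T x != x -> (black x -> mw T x = 0) /\ (~~ black x -> 0 < mw T x).
Hypothesis w_bud : forall x, ma T x = x -> mw T x = 0.

Lemma closure_Nbio : is_Nbio mobile_closure.
Proof.
move=> z; have [wb ww] := w_edge (valP z).
by split; [exact: ww|rewrite /= negbK; exact: wb].
Qed.

Lemma unfold_w v : ma T (unfold v) != unfold v ->
  mw T (unfold v) = @raw_weight mobile_closure v.
Proof.
case: v => h //=; case: slotP => // wz mz.
by have [_ ->] := mtc_bud mz; rewrite eqxx.
Qed.

Lemma closure_iso : iso_mob P T.
Proof.
pose F (x : mD P) := unfold (val x).
have Fi : injective F.
  by move=> x y /(unfold_inj (valP x) (valP y)); exact: val_inj.
have Fa x : F (ma P x) = ma T (F x).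
  by rewrite /F (val_alpha cpre crin ckg) unfold_a //; exact: valP.
exists F; split=> // [|x|x|x].
- apply: inj_surj_bij => // y; have [v kv Ev] := unfold_onto y.
  by have [x Ex] := inX (bing mobile_closure) kv; exists x; rewrite /F Ex.
- by rewrite /F (val_sigma cpre ckg) unfold_s //; exact: valP.
- by rewrite /F unfold_black //; exact: valP.
rewrite [RHS]/mw /= /t_weight -[t_alpha _ _]/(ma P x).
by rewrite -(inj_eq Fi) Fa; case: ifP => [/eqP/w_bud //|/negbT nb]; exact: unfold_w.
Qed.

(** Connectedness comes from accessibility, the root-face being a single orbit. Euler's relation is
    the tree relation of [T], carried back by [closure_iso] and by the correspondences for the
    opening of the closure. *)
Lemma closure_rooted : is_rooted_map mobile_closure.
Proof.
have acc := reaches_root_accessible cpre cvin closure_reach.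
split; split=> //.
- by have [r _] := root_ex cpre; apply/card_gt0P; exists r.
- exact: csigma_inj.
- exact: calphaK.
- exact: calpha_neq.
- have csym : connect_sym (sa_rel (bs mobile_closure) (ba mobile_closure)).
    by apply: sa_connect_sym; [exact: csigma_inj|exact: calphaK].
  have sub1 x y : connect (acc_rel (O := mobile_closure)) x y -> connect (sa_rel (bs mobile_closure) (ba mobile_closure)) x y.
    apply: connect_sub => u v uv; apply: connect1; rewrite /sa_rel.
    by case/orP: uv => [->//|/andP[_ ->]]; rewrite orbT.
  have rr r r' : r \in broot mobile_closure -> r' \in broot mobile_closure ->
      connect (sa_rel (bs mobile_closure) (ba mobile_closure)) r r'.
    have [_ _ _ [r0 E]] := cpre; rewrite E !inE => r1 r2.
    have : fconnect cphi r r'.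
      by apply: connect_trans r2; rewrite fcsym //; exact: phi_inj cpre.
    apply: connect_sub => u v /eqP <-.
    apply: connect_trans (_ : connect _ (ba mobile_closure u) _); apply: connect1; rewrite /sa_rel eqxx ?orbT //.
  move=> x y; have [r1 r1r c1] := acc x; have [r2 r2r c2] := acc y.
  apply: connect_trans (sub1 _ _ c2); apply: connect_trans (rr _ _ r1r r2r).
  by rewrite csym; exact: sub1.
- have := iso_card_orbits closure_iso; rewrite tree -(iso_card_medges closure_iso).
  rewrite card_orbits_bw; last exact: kblack_sigma cpre ckg.
  rewrite -(corresp_card (corresp_vertices cpre crin ckg)) -(corresp_card (corresp_faces cpre ckg)).
  rewrite -(corresp_card (corresp_edges cpre crin ckg)) (Kvertices_plus cvin) Kedges_plus.
  by rewrite (card_inner_faces cpre) /bvertices; lia.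
- by case: cpre.
Qed.

Lemma closure_inB : inB mobile_closure.
Proof.
split; [exact: closure_rooted| |exact: reaches_root_accessible cpre cvin closure_reach].
split; first exact: reaches_root_minimal cpre cvin closure_rooted closure_reach.
move=> h hr na; split; last exact: (out_a crin na).
case: hr => [hr|/crin]; last by rewrite (_ : ba mobile_closure (ba mobile_closure h) = h) //; exact: calphaK.
by have := crin hr; rewrite (negPf na).
Qed.

End Closure.

Theorem Phi_plus_onto (T : mob) : is_Nmobile T -> (0 < excess T)%R ->
  exists2 O : bio, is_Nbio O /\ inB O & iso_mob (Phi_plus O) T.
Proof.
case=> -[si aK bs bb] [conn tree we wb] pos.
exists (mobile_closure aK); first split.
- exact: closure_Nbio.
- exact: closure_inB.
- exact: closure_iso.
Qed.

(** * Mobiles of negative excess *)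

Lemma mtc_transport (X X' : finType) (psi : X -> X) (psi' : X' -> X') e e' (j : X -> X') h n :
  e h = 1%R -> height psi e h n.+1 = 0%R ->
  (forall i, 0 < i <= n -> (0 < height psi e h i)%R) ->
  (forall i, i < n -> psi' (j (iter i psi h)) = j (iter i.+1 psi h)) ->
  (forall i, i <= n -> e' (j (iter i psi h)) = e (iter i psi h)) ->
  mtc psi' e' (j h) (j (iter n psi h)).
Proof.
move=> eh n0 np Hp He.
have It i : i <= n -> iter i psi' (j h) = j (iter i psi h).
  by elim: i => [//|i IH] lt; rewrite iterS IH ?Hp // ltnW.
have Hh i : i <= n.+1 -> height psi' e' (j h) i = height psi e h i.
  by move=> le_i; apply: eq_bigr => k _; rewrite It ?He //; have := ltn_ord k; lia.
split; first by rewrite -eh; exact: (He 0).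
exists n; split; rewrite ?It ?Hh // => i /andP[i0 le_i].
by rewrite Hh ?np ?i0 // ltnW.
Qed.

Section Leaves.
Variable T : mob.
Local Notation X := (mD T).
Local Notation black := (mblack T).
Local Notation psi := (@contour T).
Local Notation e := (@step T).
Local Notation mtch := (mtc psi e).
Local Notation mate := (mt psi e).

(** For a negative excess every white half-edge has a mate, so a bud that is no mate is an unmatched
    one. *)
Definition free_bud (x : X) : bool :=
  (ma T x == x) && [forall h, ~~ black h ==> (mate h != x)].

Local Notation L := {x : X | free_bud x}.

Definition leaf_sigma (y : X + L) : X + L :=
  match y with inl x => inl (ms T x) | inr u => inr u end.
Definition leaf_alpha (y : X + L) : X + L :=
  match y with
  | inl x => if insub x is Some u then inr u else inl (ma T x)
  | inr u => inl (val u)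
  end.
Definition leaf_black (y : X + L) : bool := if y is inl x then black x else false.
(** The leaves become the outer vertices of the closure, and 1 is the weight that admissibility
    prescribes for the ingoing half of an outer edge. *)
Definition leaf_weight (y : X + L) : nat := if y is inl x then mw T x else 1.

(* A white leaf is attached to each unmatched bud. *)
Definition leafy : mob := Mob (X + L)%type leaf_sigma leaf_alpha leaf_black leaf_weight.

Hypothesis s_inj : injective (ms T).
Hypothesis aK : involutive (ma T).
Hypothesis black_s : forall x, black (ms T x) = black x.
Hypothesis bud_black : forall x, ma T x = x -> black x.
Hypothesis conn : forall x y, connect (sa_rel (ms T) (ma T)) x y.
Hypothesis tree : #|orbits (ms T)| = (#|medges T| + 1)%N.
Hypothesis w_edge : forall x, ma T x != x -> (black x -> mw T x = 0) /\ (~~ black x -> 0 < mw T x).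
Hypothesis w_bud : forall x, ma T x = x -> mw T x = 0.
Hypothesis neg : (excess T < 0)%R.

Local Notation psi' := (@contour leafy).
Local Notation e' := (@step leafy).

Let one_cycle x y : fconnect psi x y.
Proof. exact: tree_contour. Qed.
Let psi_inj : injective psi. Proof. exact: contour_inj. Qed.
Let tot : (total_height e <= 0)%R.
Proof. by rewrite -excess_total // ltW. Qed.

Lemma free_fix x : free_bud x -> ma T x = x.
Proof. by case/andP=> /eqP. Qed.

Lemma leafy_alpha_free x (fx : free_bud x) : ma leafy (inl x) = inr (Sub x fx).
Proof. by rewrite /= insubT. Qed.

Lemma leafy_alpha_nfree x : ~~ free_bud x -> ma leafy (inl x) = inl (ma T x).
Proof. by move=> nf; rewrite /= insubN. Qed.

Lemma leafy_alpha_leaf (u : L) : ma leafy (inl (val u)) = inr u.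
Proof. by rewrite /= valK. Qed.

Lemma free_alpha x : free_bud (ma T x) = free_bud x.
Proof.
apply/idP/idP => fx; first by rewrite -(aK x) (free_fix fx).
by rewrite (free_fix fx).
Qed.

Lemma leafy_aK : involutive (ma leafy).
Proof.
case=> [x|u]; last exact: leafy_alpha_leaf.
case fx : (free_bud x); first by rewrite leafy_alpha_free.
by rewrite !leafy_alpha_nfree ?free_alpha ?fx ?aK.
Qed.

Lemma leafy_s_inj : injective (ms leafy).
Proof. by case=> [x|u] [y|v] //= E; case: E => [/s_inj ->]. Qed.

Lemma leafy_black_s y : mblack leafy (ms leafy y) = mblack leafy y.
Proof. by case: y => //= x; rewrite black_s. Qed.

Lemma leafy_bud x : ma leafy (inl x) = inl x -> ~~ free_bud x /\ ma T x = x.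
Proof.
case fx : (free_bud x); first by rewrite leafy_alpha_free.
by rewrite leafy_alpha_nfree ?fx // => -[].
Qed.

Lemma leafy_bud_black y : ma leafy y = y -> mblack leafy y.
Proof. by case: y => [x /leafy_bud[_ /bud_black]|u]. Qed.

Lemma leafy_conn x y : connect (sa_rel (ms leafy) (ma leafy)) x y.
Proof.
have csym := sa_connect_sym leafy_s_inj leafy_aK.
have ll (a b : X) : connect (sa_rel (ms leafy) (ma leafy)) (inl a) (inl b).
  apply: (connect_fwd (P := fun z => connect _ (inl a) (inl z)) _ (conn a b)) => // u v uv au.
  apply: connect_trans au _; case/orP: uv => /eqP ->.
    by apply: connect1; rewrite /sa_rel eqxx.
  case fu : (free_bud u); first by rewrite (free_fix fu).
  by apply: connect1; rewrite /sa_rel leafy_alpha_nfree ?fu ?eqxx ?orbT.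
have lr z : exists a : X, connect (sa_rel (ms leafy) (ma leafy)) (inl a) z.
  case: z => [a|u]; first by exists a.
  by exists (val u); apply: connect1; rewrite /sa_rel leafy_alpha_leaf eqxx orbT.
have [a1 c1] := lr x; have [a2 c2] := lr y.
by apply: connect_trans c2; apply: connect_trans (ll a1 a2); rewrite csym.
Qed.

Lemma white_mtc h : ~~ black h -> mtch h (mate h).
Proof.
move=> wh; have eh : e h = 1%R by apply/eqP; rewrite step_open.
have [u mu] := mtc_open_total (@step_val T) one_cycle eh tot.
by rewrite (mtc_matched (@step_val T) one_cycle mu tot).
Qed.

Lemma matched_not_free h u : mtch h u -> ~~ free_bud u.
Proof.
move=> mu; have wh : ~~ black h by case: mu => /eqP; rewrite step_open.
rewrite negb_and negb_forall; apply/orP; right; apply/existsP; exists h.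
by rewrite wh (mtc_fun mu (white_mtc wh)) eqxx.
Qed.

Lemma not_free_matched u : ma T u = u -> ~~ free_bud u -> exists2 h, ~~ black h & mate h = u.
Proof.
move=> bu; rewrite /free_bud bu eqxx negb_forall /= => /existsP[h].
by rewrite negb_imply negbK => /andP[wh /eqP]; exists h.
Qed.

Lemma leafy_step x : ~~ free_bud x -> e' (inl x) = e x.
Proof. by move=> nf; rewrite /step leafy_alpha_nfree. Qed.

Lemma white_not_free x : ~~ black x -> ~~ free_bud x.
Proof. by apply: contra => /free_fix/bud_black. Qed.

(** A free bud inside a matched pair would be matched from within, the height after it being
    nonnegative. The contour along the pair is therefore left untouched by the added leaves. *)
Lemma leafy_mtc h u : mtch h u -> mtc psi' e' (inl h) (inl u).
Proof.
move=> mu; have := mu; case=> eh [n [-> n0 np]].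
have nfree i : 0 < i <= n -> ~~ free_bud (iter i psi h).
  case/andP=> i0 le_i; case fb : (free_bud (iter i psi h)) => //.
  have ei : e (iter i psi h) = (-1)%R.
    by apply/eqP; rewrite step_close bud_black ?(free_fix fb) //=.
  have hi : (0 <= height psi e h i.+1)%R.
    case: (ltngtP i n) le_i => // [lt _|-> _]; last by rewrite n0.
    by apply/ltW/np; rewrite ltnS.
  have [k mk] := mtc_ex_back psi_inj (@step_val T) ei hi.
  by have := matched_not_free mk; rewrite fb.
apply: (@mtc_transport X (mD leafy) psi psi' e e') => // i le_i.
  rewrite iterS; set z := iter i psi h.
  have nf : ~~ free_bud (psi z) by exact: (nfree i.+1).
  rewrite -[psi' _]/(ma leafy (inl (ms T z))) leafy_alpha_nfree //.
  by rewrite -free_alpha.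
apply: leafy_step; case: i le_i => [_|i le_i]; last exact: nfree.
by apply: white_not_free; rewrite -step_open eh.
Qed.

Let psi'_inj : injective psi'.
Proof. apply: contour_inj; [exact: leafy_aK|exact: leafy_s_inj]. Qed.

(** The buds that remain after adding the leaves are matched in [T] already, and matching is
    injective. *)
Lemma leaf_unmatched (u : L) v : ~ mtc psi' e' (inr u) v.
Proof.
move=> muv; have /eqP := mtc_close (@step_val leafy) muv; rewrite step_close.
case: v muv => [x|w] //= muv /andP[_ /eqP /leafy_bud[nf bx]].
have [h wh Eh] := not_free_matched bx nf.
have mh := leafy_mtc (white_mtc wh); rewrite Eh in mh.
by have := mtc_inj psi'_inj mh muv.
Qed.

Lemma card_free : (#|mbuds T| = #|[set x | ~~ black x]| + #|[set x | free_bud x]|)%N.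
Proof.
rewrite -(card_in_imset (f := mate) (D := [set x | ~~ black x])); last first.
  move=> x y; rewrite !inE => /white_mtc mx /white_mtc my E.
  by rewrite E in mx; exact: (mtc_inj psi_inj mx my).
rewrite -(cardsID [set x | free_bud x] (mbuds T)) addnC; congr (_ + _)%N; apply: eq_card => x.
  rewrite !inE; apply/andP/imsetP => [[nf /eqP bx]|[h]].
    by have [h wh <-] := not_free_matched bx nf; exists h; rewrite ?inE.
  rewrite inE => /white_mtc mh ->; split; first exact: matched_not_free mh.
  by have /eqP := mtc_close (@step_val T) mh; rewrite step_close => /andP[].
by rewrite !inE; case fx : (free_bud x); rewrite ?andbF // (free_fix fx) eqxx.
Qed.

Lemma excess_T : excess T = (- #|[set x | free_bud x]|%:Z)%R.
Proof. by rewrite excess_card // card_free; lia. Qed.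

(** Each free bud loses its step -1 and gains a leaf of step 1. Since the excess of [T] is minus the
    number of free buds, it changes sign. *)
Lemma leafy_excess : (0 < excess leafy)%R.
Proof.
suff -> : excess leafy = (- excess T)%R by have := neg; lia.
rewrite (excess_total leafy_aK leafy_bud_black) /total_height big_sumType /=.
have free_step x : e' (inl x) = (e x + (free_bud x)%:R)%R.
  case fx : (free_bud x); last by rewrite leafy_step ?fx ?addr0.
  rewrite /step leafy_alpha_free (free_fix fx) eqxx.
  by rewrite -[mblack leafy _]/(black x) bud_black ?(free_fix fx).
under eq_bigr do rewrite free_step.
rewrite big_split /= -[X in (X + _ + _)%R]/(total_height e) -(excess_total aK bud_black).
rewrite [X in (_ + X)%R](eq_bigr (fun=> 1%R)) // -natr_sum sumr_const.
rewrite card_sig (_ : #|free_bud| = #|[set x | free_bud x]|); last first.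
  by apply: eq_card => x; rewrite inE.
have -> : (\sum_x free_bud x)%N = #|[set x | free_bud x]|.
  by rewrite -sum1dep_card [RHS]big_mkcond; apply: eq_bigr => x _; case: (free_bud x).
by rewrite excess_T !natz; lia.
Qed.

(** A leaf adds one vertex and turns one bud into an edge. *)
Lemma leafy_tree : #|orbits (ms leafy)| = (#|medges leafy| + 1)%N.
Proof.
have cF : #|{: L}| = #|[set x | free_bud x]|.
  by rewrite card_sig; apply: eq_card => x; rewrite inE.
have cb : #|mbuds T| = (#|mbuds leafy| + #|{: L}|)%N.
  rewrite -(cardsID [set x | free_bud x] (mbuds T)) addnC cF; congr (_ + _)%N.
    rewrite -(card_imset _ (@inl_inj X L)); apply: eq_card => y.
    apply/imsetP/idP => [[x]|].
      by rewrite !inE => /andP[nf bx] ->; rewrite leafy_alpha_nfree // (eqP bx).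
    rewrite inE; case: y => [x /eqP/leafy_bud[nf bx]|u //].
    by exists x; rewrite // !inE nf bx eqxx.
  apply: eq_card => x; rewrite !inE.
  by case fx : (free_bud x); rewrite ?andbF // (free_fix fx) eqxx.
have cX : #|mD leafy| = (#|X| + #|{: L}|)%N by exact: card_sum.
have c2 := card_mobile_darts leafy_aK; have c1 := card_mobile_darts aK.
suff -> : #|orbits (ms leafy)| = (#|orbits (ms T)| + #|{: L}|)%N by rewrite tree; lia.
pose inlS (A : {set X}) : {set mD leafy} := [set inl x | x in A].
pose inrS (u : L) : {set mD leafy} := [set inr u].
have inlS_inj : injective inlS by apply: imset_inj; exact: inl_inj.
have inrS_inj : injective inrS by move=> u v /set1_inj[].
rewrite -cardsT -(card_imset _ inlS_inj) -(card_imset _ inrS_inj) -[LHS]addn0.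
rewrite -cardsUI; congr (_ + _)%N.
  apply: eq_card => V; rewrite inE; apply/orbitsP/orP => [[[x|u] ->]|[]].
  - left; apply/imsetP; exists (orb (ms T) x); first exact: orb_in.
    have It n : iter n (ms leafy) (inl x) = inl (iter n (ms T) x).
      by elim: n => [//|n IH]; rewrite !iterS IH.
    apply/setP=> y; rewrite mem_orb; apply/fconnect_iterP/imsetP => [[n ->]|[z]].
      by exists (iter n (ms T) x); rewrite ?It // mem_orb fconnect_iter.
    by rewrite mem_orb => /fconnect_iterP[n ->] ->; exists n.
  - right; apply/imsetP; exists u => //; apply/setP=> y; rewrite mem_orb inE.
    apply/fconnect_iterP/eqP => [[n ->]|->]; last by exists 0.
    by elim: n => [//|n IH]; rewrite iterS IH.
  - case/imsetP=> A /orbitsP[x ->] ->; exists (inl x).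
    have It n : iter n (ms leafy) (inl x) = inl (iter n (ms T) x).
      by elim: n => [//|n IH]; rewrite !iterS IH.
    apply/esym/setP=> y; rewrite mem_orb; apply/fconnect_iterP/imsetP => [[n ->]|[z]].
      by exists (iter n (ms T) x); rewrite ?It // mem_orb fconnect_iter.
    by rewrite mem_orb => /fconnect_iterP[n ->] ->; exists n.
  - case/imsetP=> u _ ->; exists (inr u); apply/esym/setP=> y; rewrite mem_orb inE.
    apply/fconnect_iterP/eqP => [[n ->]|->]; last by exists 0.
    by elim: n => [//|n IH]; rewrite iterS IH.
apply/esym/eqP; rewrite cards_eq0; apply/eqP/setP=> V; rewrite !inE; apply/negP=> /andP[].
by case/imsetP=> A _ -> /imsetP[u _ /setP/(_ (inr u))]; rewrite inE eqxx => /imsetP[].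
Qed.

Lemma leafy_unmatched y : unmatched y = ~~ is_inl (y : mD leafy).
Proof.
have tot' : (0 <= total_height e')%R.
  by rewrite -(excess_total leafy_aK leafy_bud_black) ltW ?leafy_excess.
have cyc := tree_contour leafy_aK leafy_s_inj leafy_conn leafy_tree.
case: y => [x|u] /=.
  apply/negbTE/negP=> /andP[wx]; apply/negP; rewrite negbK.
  have mx := leafy_mtc (white_mtc wx).
  by have [] := mtc_mt psi'_inj (@step_val leafy) cyc mx tot'.
rewrite /unmatched /=; apply/negP=> mu.
by have := leaf_unmatched (mtcP (@step_val leafy) (erefl : e' (inr u) = 1%R) mu).
Qed.

Lemma leafy_w_edge y : ma leafy y != y ->
  (mblack leafy y -> mw leafy y = 0) /\ (~~ mblack leafy y -> 0 < mw leafy y).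
Proof.
case: y => [x|u]; last by [].
case fx : (free_bud x); first by rewrite /= bud_black ?w_bud //; exact: free_fix.
by rewrite leafy_alpha_nfree ?fx // => /w_edge.
Qed.

Lemma leafy_w_bud y : ma leafy y = y -> mw leafy y = 0.
Proof. by case: y => [x /leafy_bud[_ /w_bud]|]. Qed.

Ltac leafy_hyp := first [exact: leafy_aK|exact: leafy_s_inj|exact: leafy_black_s
  |exact: leafy_bud_black|exact: leafy_conn|exact: leafy_tree|exact: leafy_excess
  |exact: leafy_w_edge|exact: leafy_w_bud|idtac].

Let O := mobile_closure leafy_aK.
Local Notation D := (bD O).
Let pre : premap O. Proof. apply: closure_premap; leafy_hyp. Qed.
Let rin : root_in O. Proof. exact: closure_root_in. Qed.
Let OB : inB O. Proof. apply: closure_inB; leafy_hyp. Qed.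
Let wO : is_Nbio O. Proof. apply: closure_Nbio; leafy_hyp. Qed.
Let baK : involutive (ba O). Proof. by case: pre. Qed.
Let bs_inj : injective (bs O). Proof. by case: pre. Qed.

Lemma leafy_rootE (z : D) : (z \in broot O) = ~~ is_inl (val (ba O z)).
Proof. by rewrite inE leafy_unmatched. Qed.

Lemma leafy_ing (z : D) : bing O z = ~~ leaf_black (val z).
Proof. by []. Qed.

Lemma leafy_root_out (z : D) : z \in broot O ->
  exists2 u : L, val (ba O z) = inr u & val z = inl (val u).
Proof.
rewrite leafy_rootE; case E : (val (ba O z)) => [x|u] // _; exists u => //.
by rewrite -(baK z); apply: etrans (val_calpha leafy_aK (ba O z)) _; rewrite E.
Qed.

(** A leaf is fixed by the rotation of the mobile, so around its vertex of the closure it is its own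
    next ingoing dart. This is the source of the indegree 1 and of the simplicity of the contour. *)
Lemma leaf_alone (p q : D) u : val p = inr u -> bing O q -> fconnect (bs O) p q -> q = p.
Proof.
move=> Ep iq pq; have ip : bing O p by rewrite leafy_ing Ep.
have np : nxt (bs O) (bing O) p = p.
  by apply: closure_nin; leafy_hyp; rewrite ?Ep.
have /fconnect_iterP[n ->] := nxt_fconnect bs_inj ip iq pq.
by elim: n => [//|n IH]; rewrite iterS IH.
Qed.

Lemma leafy_finv_root (z : D) : z \in broot O -> exists u, val (finv (bs O) z) = inr u.
Proof.
rewrite inE => uz.
have [] : unmatched (val (finv (bs O) z)) /\ nxt psi' (@unmatched leafy) (val (finv (bs O) z)) = val (ba O z).
  by apply: slot_finv_root uz; leafy_hyp.
rewrite leafy_unmatched.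
by case: (val (finv (bs O) z)) => // u _ _; exists u.
Qed.

Lemma leafy_admissible : admissible O.
Proof.
have alone x y : x \in broot O -> bing O y -> fconnect (bs O) x y -> y = finv (bs O) x.
  move=> xr iy xy; have [u Eu] := leafy_finv_root xr; apply: (leaf_alone Eu) => //.
  by apply: connect_trans xy; rewrite fcsym // fconnect_finv.
split.
- move=> x y xr yr xy; apply: (finv_inj bs_inj); apply/esym; apply: alone => //.
    by exact: (root_finv pre rin yr).
  by apply: connect_trans xy _; exact: fconnect_finv.
- by move=> x /leafy_root_out[u _ Ex]; rewrite leafy_rootE baK Ex.
- move=> x xr; apply/eqP/cards1P; exists (finv (bs O) x); apply/setP=> y; rewrite !inE.
  apply/andP/eqP => [[xy iy]|->]; first exact: alone.
  by rewrite fconnect_finv (root_finv pre rin xr).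
have H (x : D) : x \in broot O ->
    [/\ bing O (ba O x), ~~ bing O x, bw O (ba O x) = 1 & bw O x = 0].
  move=> /leafy_root_out[u Ea Ex].
  have bu := free_fix (valP u); split.
  - by rewrite leafy_ing Ea.
  - by rewrite leafy_ing Ex negbK /= bud_black.
  - by rewrite [bw O _]/(leaf_weight (val (ba O x))) Ea.
  - by rewrite [bw O _]/(leaf_weight (val x)) Ex /= w_bud.
move=> x [/H[i1 i2 w1 w2]|/H[]]; first by right.
by rewrite baK => i1 i2 w1 w2; left.
Qed.

Let kg := kgood_minus pre rin leafy_admissible.
Local Notation keep1 := (keepK (bing O)).
Local Notation keepm := (keepK (@Kminus O)).

Let keepm_1 (v : D + D) : keepm v -> keep1 v.
Proof. by case: v => h //= /(kg_in kg). Qed.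

Let unf (v : D + D) : X + L := @unfold leafy leafy_aK v.

Definition prune (v : D + D) : X := match unf v with inl x => x | inr u => val u end.

Let leafy_Kminus (h : D) : @Kminus O h = bing O h && is_inl (val h).
Proof. by rewrite (KminusE2 pre rin leafy_admissible) leafy_rootE baK negbK. Qed.

Lemma unf_inl (v : D + D) : keepm v -> unf v = inl (prune v).
Proof.
move=> kv; rewrite /prune; case E : (unf v) => [//|u]; exfalso; move: kv E.
case: v => h kv.
  have := leafy_Kminus h; rewrite (kv : @Kminus O h = true) => /esym/andP[_].
  by rewrite /unf /unfold; case: (val h).
have : mblack leafy (unf (inr h)) = ~~ is_inl (inr h : D + D).
  by apply: unfold_black; leafy_hyp; exact: keepm_1.
by move=> /[swap] ->.
Qed.

(** Discarding the leaves changes the involution only at the black half-edges that carried one;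
    these become buds again, as they are in [T]. *)
Lemma prune_alpha (v : D + D) : keepm v -> unf (kalpha (@Kminus O) v) = inl (ma T (prune v)).
Proof.
move=> kv; have kav := keep_alpha pre rin kg kv.
have same : kalpha (@Kminus O) v = kalpha (bing O) v ->
    unf (kalpha (@Kminus O) v) = inl (ma T (prune v)).
  move=> E; have E2 : unf (kalpha (@Kminus O) v) = ma leafy (unf v).
    by rewrite E; exact: (unfold_a (keepm_1 kv)).
  rewrite (unf_inl kv) in E2; case fx : (free_bud (prune v)).
    by move: E2; rewrite leafy_alpha_free (unf_inl kav).
  by rewrite E2 leafy_alpha_nfree ?fx.
case: v kv kav same => h kv kav same; first exact: same.
case ih : (bing O h); last by apply: same; rewrite /kalpha leafy_Kminus ih.
case lh : (is_inl (val h)); first by apply: same; rewrite /kalpha leafy_Kminus ih lh.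
have Ek : kalpha (@Kminus O) (inr h) = inr h by rewrite /kalpha leafy_Kminus ih lh.
have ar : ba O h \in broot O by rewrite leafy_rootE baK lh.
have [u _ Ea] := leafy_root_out ar.
have bu := free_fix (valP u).
have Eu : unf (inr h) = inl (val u).
  by rewrite [unf _]/(slot (T := leafy) (ba O h)) /slot Ea /= bud_black.
by rewrite Ek Eu /prune Eu bu.
Qed.

Lemma leafy_iso : iso_mob (Phi_minus O) T.
Proof.
pose F (x : mD (Phi_minus O)) := prune (val x).
have FE x : unf (val x) = inl (F x) by apply: unf_inl; exact: valP.
have Fi : injective F.
  move=> x y E; apply: val_inj; have : unf (val x) = unf (val y) by rewrite !FE E.
  by apply: (unfold_inj (aK := leafy_aK)); leafy_hyp; apply: keepm_1; exact: valP.
have Fa x : F (ma (Phi_minus O) x) = ma T (F x).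
  apply: (@inl_inj X L); rewrite -FE -prune_alpha; last exact: valP.
  by congr unf; exact: (val_alpha pre rin kg).
exists F; split=> // [|x|x|x].
- apply: inj_surj_bij => // y.
  have [v kv Ev] : exists2 v, keep1 v & unf v = inl y by apply: unfold_onto; leafy_hyp.
  have km : keepm v.
    case: v kv Ev => h // ih Ev; apply: etrans (leafy_Kminus h) _.
    by rewrite (ih : bing O h = true) (Ev : val h = inl y).
  have [x Ex] := inX (@ing_rev O) km; exists x.
  by apply: (@inl_inj X L); rewrite -FE -Ev Ex.
- apply: (@inl_inj X L); rewrite -FE.
  have -> : val (ms (Phi_minus O) x) = ksigma (val x) by exact: (val_sigma pre kg).
  have -> : unf (ksigma (val x)) = ms leafy (unf (val x)).
    by apply: (unfold_s (aK := leafy_aK)); leafy_hyp; apply: keepm_1; exact: valP.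
  by rewrite FE.
- have : mblack leafy (unf (val x)) = ~~ is_inl (val x).
    by apply: unfold_black; leafy_hyp; apply: keepm_1; exact: valP.
  by rewrite FE.
rewrite [RHS]/mw /= /t_weight -[t_alpha _ _]/(ma (Phi_minus O) x).
rewrite -(inj_eq Fi) Fa; case: ifP => [/eqP/w_bud //|nb].
have := @unfold_w leafy leafy_aK (val x).
rewrite -/(unf (val x)) FE => <- //.
case fx : (free_bud (F x)); first by rewrite leafy_alpha_free.
by rewrite leafy_alpha_nfree ?fx // (inj_eq (@inl_inj X L)) nb.
Qed.

Lemma leafy_result : [/\ is_Nbio O, inBtilde O & iso_mob (Phi_minus O) T].
Proof. by split; [|split; [|exact: leafy_admissible]|exact: leafy_iso]. Qed.

End Leaves.

Theorem Phi_minus_onto (T : mob) : is_Nmobile T -> (excess T < 0)%R ->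
  exists2 O : bio, is_Nbio O /\ inBtilde O & iso_mob (Phi_minus O) T.
Proof.
case=> -[si aK bs bb] [conn tree we wb] neg.
by have [wO OB iso] := leafy_result si aK bs bb conn tree we wb neg; exists (mobile_closure (leafy_aK aK)).
Qed.

Theorem theorem11 :
  (* (1) Phi_plus *)
  ((forall O : bio, is_Nbio O -> inB O ->
      [/\ is_Nmobile (Phi_plus O),
          (0 < excess (Phi_plus O))%R &
          excess (Phi_plus O) = Posz (outer_degree O)] /\
      [/\ corresp (inner_faces O) (black_vertices (Phi_plus O))
                  (fun f => #|f|) (fun v => #|v|),
          corresp (bvertices O) (white_vertices (Phi_plus O))
                  (@bvertex_weight O) (mvertex_weight (T:=Phi_plus O))
        & corresp (bedges O) (medges (Phi_plus O))
                  (@bedge_weight O) (medge_weight (T:=Phi_plus O))]) /\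
   (forall O1 O2 : bio, is_Nbio O1 -> inB O1 -> is_Nbio O2 -> inB O2 ->
      (iso_bio O1 O2 <-> iso_mob (Phi_plus O1) (Phi_plus O2))) /\
   (forall T : mob, is_Nmobile T -> (0 < excess T)%R ->
      exists2 O : bio, is_Nbio O /\ inB O & iso_mob (Phi_plus O) T)) /\
  (* (2) Phi_minus *)
  ((forall O : bio, is_Nbio O -> inBtilde O ->
      [/\ is_Nmobile (Phi_minus O),
          (excess (Phi_minus O) < 0)%R &
          excess (Phi_minus O) = (- Posz (outer_degree O))%R] /\
      [/\ corresp (inner_faces O) (black_vertices (Phi_minus O))
                  (fun f => #|f|) (fun v => #|v|),
          corresp (inner_vertices O) (white_vertices (Phi_minus O))
                  (@bvertex_weight O) (mvertex_weight (T:=Phi_minus O))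
        & corresp (inner_edges O) (medges (Phi_minus O))
                  (@bedge_weight O) (medge_weight (T:=Phi_minus O))]) /\
   (forall O1 O2 : bio, is_Nbio O1 -> inBtilde O1 -> is_Nbio O2 -> inBtilde O2 ->
      (iso_bio O1 O2 <-> iso_mob (Phi_minus O1) (Phi_minus O2))) /\
   (forall T : mob, is_Nmobile T -> (excess T < 0)%R ->
      exists2 O : bio, is_Nbio O /\ inBtilde O & iso_mob (Phi_minus O) T)).
Proof.
split; split.
- exact: Phi_plus_mobile.
- split; [exact: Phi_plus_iso|exact: Phi_plus_onto].
- by move=> O wO [OB adm]; exact: Phi_minus_mobile.
- split; [exact: Phi_minus_iso|exact: Phi_minus_onto].
Qed.
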